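(* Let $L_1,L_2,L_3>0$ and let $\Omega=(0,L_1)\times(0,L_2)\times\left(\frac{2L_3}{2\pi}\mathbb{S}^1\right)$. The set of eigenfunctions $$\begin{aligned}\mathcal C:=\;&\{Y^{j(n),n}\mid n\in\mathbb N^3,\ \#_0(n)\le 1,\ n_i\le 4,\ j(n)\in\{1,2-\#_0(n)\}\}\\ &\cup\{Z^{j(n),n}\mid n\in\mathbb N^3,\ \#_0(n)\le 1,\ n_i\le 4,\ j(n)\in\{1,2-\#_0(n)\}\}\\ &\cup\{Z^{1,n}\mid n\in\mathbb N^3,\ \#_0(n)=2,\ n_3=0,\ n_i\le 4\}\ \cup\ \{Z^{(0,0,0)}=(0,0,1)^\top\}\end{aligned}$$ is $(\mathtt L,\mathrm D(A))$-saturating.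
   Context: $\mathbb N=\{0,1,2,\dots\}$. Functions on $\Omega$ are identified with functions on $(0,L_1)\times(0,L_2)\times\mathbb R$ that are $2L_3$-periodic in $x_3$; $\mathbf n$ is the outward unit normal to $\partial\Omega$ (the lateral boundary $x_1\in\{0,L_1\}$ or $x_2\in\{0,L_2\}$). Spaces: $H=\{u\in L^2(\Omega,\mathbb R^3)\mid \operatorname{div}u=0,\ (u\cdot\mathbf n)|_{\partial\Omega}=0\}$ with the $L^2$ norm; $\mathrm D(A)=\{u\in H^2(\Omega,\mathbb R^3)\mid u\in H,\ (\operatorname{curl}u-(\mathbf n\cdot\operatorname{curl}u)\mathbf n)|_{\partial\Omega}=0\}$ (domain of the Stokes operator $A$ under Lions boundary conditions). $\Pi$ is the orthogonal projection of $L^2(\Omega,\mathbb R^3)$ onto $H$. For $u,v\in \mathrm D(A)$, $B(u,v)=\Pi((u\cdot\nabla)v)$, and $\mathcal B(a,b)=B(a,b)+B(b,a)$. Saturating sets: let $U=\mathrm D(A)$ and let $\mathcal C\subset U$ be a finite set. For a finite-dimensional space $E$ with $\mathcal C\subset E\subset U$, put $\mathcal F_{\mathtt L}(E)=E+\big(\operatorname{span}\{\mathcal B(a,b)\mid a\in\mathcal C,\ b\in E,\ (B(a,a),B(b,b))\in H\times H\}\cap U\big)$. Set $\mathcal G^0=\operatorname{span}\mathcal C$ and $\mathcal G^{j+1}=\mathcal F_{\mathtt L}(\mathcal G^j)$. The set $\mathcal C$ is called $(\mathtt L,\mathrm D(A))$-saturating if $\bigcup_{j\in\mathbb N}\mathcal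 G^j$ is dense in $H$. Eigenfunctions: for $k\in\mathbb N^3$, $\#_0(k)$ is the number of zero components of $k$. For $k\neq 0$, $\{k\}_0^{\perp_{[L]}}=\{z\in\mathbb R^3\setminus\{0\}\mid \frac{z_1k_1}{L_1}+\frac{z_2k_2}{L_2}+\frac{z_3k_3}{L_3}=0,\ z_i=0\text{ if }k_i=0\}$. With $C_i=\cos\left(\frac{k_i\pi x_i}{L_i}\right)$, $S_i=\sin\left(\frac{k_i\pi x_i}{L_i}\right)$ and $w=w^{j(k),k}$, $$Y^{j(k),k}=\begin{pmatrix}w_1S_1C_2C_3\\ w_2C_1S_2C_3\\ w_3C_1C_2S_3\end{pmatrix},\qquad Z^{j(k),k}=\begin{pmatrix}w_1S_1C_2S_3\\ w_2C_1S_2S_3\\ -w_3C_1C_2C_3\end{pmatrix}.$$ The $Y^{j(k),k}$ are defined for $\#_0(k)\le1$, $j(k)\in\{1,2-\#_0(k)\}$, where $\{w^{j(k),k}\mid j(k)\in\{1,2-\#_0(k)\}\}\subset\{k\}_0^{\perp_{[L]}}$ is any fixed linearly independent orthogonal family. The $Z^{j(k),k}$ are defined as follows: if $\#_0(k)\le1$ and $k_3\ne0$, $j(k)\in\{1,2-\#_0(k)\}$ and the vectors $w^{j(k),k}$ are chosen in the same way as for $Y$; if $k_3=0$ and $\#_0(k)\in\{1,2\}$, then $j(k)=1$ and $w^{1,k}=(0,0,w_3^{1,k})$ with $w_3^{1,k}\neq0$; if $k=(0,0,0)$, $w=(0,0,-1)$, so $Z^{(0,0,0)}=(0,0,1)^\top$.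 *)

(* Defs.v *)
From HB Require Import structures.
From mathcomp Require Import all_boot all_order all_algebra.
From mathcomp Require Import all_classical all_reals all_analysis.
Set Implicit Arguments.
Unset Strict Implicit.
Unset Printing Implicit Defensive.
Import Order.TTheory GRing.Theory Num.Theory numFieldNormedType.Exports.
Local Open Scope classical_set_scope.
Local Open Scope ring_scope.

(* Conventions.
   - The coordinates x_1, x_2, x_3 and the lengths L_1, L_2, L_3 are indexed by
     0, 1, 2 : 'I_3; index arithmetic in 'I_3 is modulo 3.
   - A function on Omega is a function on R^3 that is 2 L_3-periodic in x_3 on
     the strip (0,L_1) x (0,L_2) x R; its values outside the strip are
     irrelevant.
   - Elements of L^2 are represented by functions; the notions of weak
     derivative, trace, H, D(A) and B below do not depend on the representative,
     so no quotient by a.e. equality is taken.  Weak derivatives, traces and Pi,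
     being unique only up to a.e. equality, are given as relations. *)

Notation pt R := (R * R * R)%type.
Notation vfield R := (pt R -> 'rV[R]_3).

Definition leb2 (R : realType) :=
  (@lebesgue_measure R \x @lebesgue_measure R)%E.
Arguments leb2 : clear implicits.

Definition leb3 (R : realType) := (leb2 R \x @lebesgue_measure R)%E.
Arguments leb3 : clear implicits.

Definition xcoord (R : realType) (x : pt R) (i : 'I_3) : R :=
  if i == 0 then x.1.1 else if i == 1 then x.1.2 else x.2.

Definition row3 (R : realType) (a b c : R) : 'rV[R]_3 :=
  \row_i (if i == 0 then a else if i == 1 then b else c).

Definition evec (R : realType) (i : 'I_3) : pt R :=
  ((i == 0)%:R, (i == 1)%:R, (i == 2)%:R).

Definition component (R : realType) (u : vfield R) (i : 'I_3) : pt R -> R :=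
  fun x => u x 0 i.

Definition partial (R : realType) (i : 'I_3) (f : pt R -> R) : pt R -> R :=
  fun x => 'D_(evec R i) f x.

Fixpoint Ck (R : realType) (m : nat) (f : pt R -> R) : Prop :=
  continuous f /\
  if m is m'.+1 then
    forall i, (forall x, derivable f x (evec R i)) /\ Ck m' (partial i f)
  else True.

Definition smooth (R : realType) (f : pt R -> R) : Prop :=
  forall m, Ck m f.

Section Spaces.
Context (R : realType) (L : 'I_3 -> R).
Implicit Types (f g : pt R -> R) (u v w : vfield R).

Definition strip : set (pt R) :=
  [set x | 0 < x.1.1 < L 0 /\ 0 < x.1.2 < L 1].

(* One period of the strip: integrals over Omega are integrals over cell. *)
Definition cell : set (pt R) :=
  [set x | strip x /\ 0 <= x.2 < 2 * L 2].

Definition shift3 (x : pt R) : pt R := (x.1.1, x.1.2, x.2 + 2 * L 2).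

(* C^oo up to the lateral boundary of Omega *)
Definition smooth_closure f : Prop :=
  smooth f /\ forall x, f (shift3 x) = f x.

(* C^oo_c(Omega): by periodicity, the support is compact modulo the period as
   soon as it lies in the strip. *)
Definition test f : Prop :=
  smooth_closure f /\ closure [set x | f x != 0] `<=` strip.

Definition intO f : R := \int[leb3 R]_(x in cell) f x.

Definition L2 f : Prop :=
  [/\ measurable_fun strip f,
      (forall x, strip x -> f (shift3 x) = f x) &
      (leb3 R).-integrable cell (fun x => (f x ^+ 2)%:E)].

Definition weak_partial (i : 'I_3) f g : Prop :=
  [/\ L2 f, L2 g &
      forall phi, test phi ->
        intO (fun x => f x * partial i phi x) =
        - intO (fun x => g x * phi x)].

Fixpoint Sobolev (m : nat) f : Prop :=
  L2 f /\
  if m is m'.+1 then forall i, exists2 g, weak_partial i f g & Sobolev m' g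
  else True.

Definition L2v u : Prop := forall i, L2 (component u i).

Definition dot u v : R := intO (fun x => \sum_i u x 0 i * v x 0 i).

Definition normL2 u : R := Num.sqrt (dot u u).

Definition weak_div u f : Prop :=
  [/\ L2v u, L2 f &
      forall phi, test phi ->
        intO (fun x => \sum_i u x 0 i * partial i phi x) =
        - intO (fun x => f x * phi x)].

(* The normal trace of an L^2 field u with div u in L^2 is the functional
   phi |-> \int_Omega (u . grad phi + (div u) phi). *)
Definition normal_trace0 u : Prop :=
  exists2 d, weak_div u d &
    forall phi, smooth_closure phi ->
      intO (fun x => \sum_i u x 0 i * partial i phi x + d x * phi x) = 0.

Definition spaceH : set (vfield R) :=
  [set u | [/\ L2v u, weak_div u (fun=> 0) & normal_trace0 u]].

Definition is_curl u v : Prop :=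
  exists2 d : 'I_3 -> 'I_3 -> pt R -> R,
    (forall i j, weak_partial j (component u i) (d j i)) &
    v = fun x => \row_i (d (i + 1) (i + 2) x - d (i + 2) (i + 1) x).

(* The faces of Omega are {x_i = 0} (b = false) and {x_i = L_i} (b = true),
   for i = 0, 1; face_pt parametrizes them by the two remaining coordinates. *)
Definition face_pt (i : 'I_3) (b : bool) (y : R * R) : pt R :=
  let s := if b then L i else 0 in
  if i == 0 then (s, y.1, y.2) else (y.1, s, y.2).

Definition face_cell (i : 'I_3) : set (R * R) :=
  [set y | 0 < y.1 < (if i == 0 then L 1 else L 0) /\ 0 <= y.2 < 2 * L 2].

Definition outward_normal (i : 'I_3) (b : bool) : 'rV[R]_3 :=
  if b then delta_mx 0 i else - delta_mx 0 i.

(* The trace of f in H^1(Omega) on a face: the restriction operator extended by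
   continuity from functions that are smooth up to the boundary. *)
Definition is_trace (i : 'I_3) (b : bool) f (g : R * R -> R) : Prop :=
  [/\ Sobolev 1 f,
      measurable_fun (face_cell i) g,
      (leb2 R).-integrable (face_cell i) (fun y => (g y ^+ 2)%:E) &
      exists (d : 'I_3 -> pt R -> R) (phi : nat -> pt R -> R),
      [/\ (forall j, weak_partial j f (d j)),
          (forall n, smooth_closure (phi n)),
          (fun n => \int[leb3 R]_(x in cell) ((phi n x - f x) ^+ 2)%:E)%E
            @ \oo --> 0%E,
          (forall j,
            (fun n => \int[leb3 R]_(x in cell)
                        ((partial j (phi n) x - d j x) ^+ 2)%:E)%E
              @ \oo --> 0%E) &
          (fun n => \int[leb2 R]_(y in face_cell i)
                      ((phi n (face_pt i b y) - g y) ^+ 2)%:E)%E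
            @ \oo --> 0%E]].

Definition Lions_bc u : Prop :=
  exists2 v, is_curl u v &
    forall (i : 'I_3) (b : bool), i != 2 ->
      exists2 t : 'I_3 -> R * R -> R,
        (forall j, is_trace i b (component v j) (t j)) &
        let n := outward_normal i b in
        {ae leb2 R, forall y, face_cell i y ->
          forall j, t j y - (\sum_l n 0 l * t l y) * n 0 j = 0}.

Definition domA : set (vfield R) :=
  [set u | [/\ forall i, Sobolev 2 (component u i), spaceH u & Lions_bc u]].

Definition is_Pi (f w : vfield R) : Prop :=
  [/\ L2v f, spaceH w & forall h, spaceH h -> dot (f - w) h = 0].

Definition is_advection u v (f : vfield R) : Prop :=
  exists2 d : 'I_3 -> 'I_3 -> pt R -> R,
    (forall i j, weak_partial j (component v i) (d j i)) &
    f = fun x => \row_i \sum_j u x 0 j * d j i x.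

(* B(u, v) lies in H exactly when (u . grad) v is in L^2, that is, when such a
   w exists. *)
Definition is_B u v w : Prop :=
  exists2 f, is_advection u v f & is_Pi f w.

Definition is_symB (a b w : vfield R) : Prop :=
  exists w1 w2, [/\ is_B a b w1, is_B b a w2 & w = w1 + w2].

Definition lin_span (S : set (vfield R)) : set (vfield R) :=
  [set f | exists n (c : 'I_n -> R) (g : 'I_n -> vfield R),
     (forall i, S (g i)) /\ f = \sum_i c i *: g i].

Definition FL (U C E : set (vfield R)) : set (vfield R) :=
  [set f | exists e s,
     [/\ E e,
         lin_span [set w | exists a b,
                 [/\ C a, E b,
                     (exists2 z, is_B a a z & spaceH z),
                     (exists2 z, is_B b b z & spaceH z) &
                     is_symB a b w]] s,
         U s & f = e + s]].

Fixpoint GL (U C : set (vfield R)) (j : nat) : set (vfield R) :=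
  if j is j'.+1 then FL U C (GL U C j') else lin_span C.

Definition dense_in_H (S : set (vfield R)) : Prop :=
  S `<=` spaceH /\
  forall h, spaceH h -> forall eps : R, 0 < eps ->
    exists2 g, S g & normL2 (h - g) < eps.

Definition L_saturating (U C : set (vfield R)) : Prop :=
  [/\ finite_set C, C `<=` U & dense_in_H (\bigcup_j GL U C j)].

End Spaces.

Section Eigenfunctions.
Context (R : realType) (L : 'I_3 -> R).
Implicit Types (k : 'I_3 -> nat) (z : 'rV[R]_3).

Definition nzeros k : nat := #|[set i | k i == 0%N]%SET|.

(* {1, 2 - #_0(k)} without repetition *)
Definition jset k : seq nat := undup [:: 1; 2 - nzeros k]%N.

Definition perp k z : Prop :=
  [/\ z != 0, \sum_i z 0 i * (k i)%:R / L i = 0 &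
      forall i, k i = 0%N -> z 0 i = 0].

Definition orth_family k (w : nat -> 'rV[R]_3) : Prop :=
  [/\ forall j, j \in jset k -> perp k (w j),
      free [seq w j | j <- jset k] &
      forall j j', j \in jset k -> j' \in jset k -> j != j' ->
        \sum_i w j 0 i * w j' 0 i = 0].

Definition Y_vectors (w : nat -> ('I_3 -> nat) -> 'rV[R]_3) : Prop :=
  forall k, (nzeros k <= 1)%N -> orth_family k (w^~ k).

Definition Z_vectors (w : nat -> ('I_3 -> nat) -> 'rV[R]_3) : Prop :=
  (forall k, (nzeros k <= 1)%N -> k 2 != 0%N -> orth_family k (w^~ k)) /\
  (forall k, k 2 = 0%N -> nzeros k = 1%N \/ nzeros k = 2%N ->
     exists2 c : R, c != 0 & w 1%N k = row3 0 0 c).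

Definition Cf k (i : 'I_3) (x : pt R) : R :=
  cos ((k i)%:R * pi * xcoord x i / L i).

Definition Sf k (i : 'I_3) (x : pt R) : R :=
  sin ((k i)%:R * pi * xcoord x i / L i).

Definition Yfield z k : vfield R := fun x =>
  row3 (z 0 0 * Sf k 0 x * Cf k 1 x * Cf k 2 x)
       (z 0 1 * Cf k 0 x * Sf k 1 x * Cf k 2 x)
       (z 0 2 * Cf k 0 x * Cf k 1 x * Sf k 2 x).

Definition Zfield z k : vfield R := fun x =>
  row3 (z 0 0 * Sf k 0 x * Cf k 1 x * Sf k 2 x)
       (z 0 1 * Cf k 0 x * Sf k 1 x * Sf k 2 x)
       (- z 0 2 * Cf k 0 x * Cf k 1 x * Cf k 2 x).

Definition saturating_set (wY wZ : nat -> ('I_3 -> nat) -> 'rV[R]_3) :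
    set (vfield R) :=
  [set Yfield (wY p.1 p.2) p.2 | p in [set p : nat * ('I_3 -> nat) |
     [/\ (nzeros p.2 <= 1)%N, forall i, (p.2 i <= 4)%N & p.1 \in jset p.2]]]
  `|` [set Zfield (wZ p.1 p.2) p.2 | p in [set p : nat * ('I_3 -> nat) |
     [/\ (nzeros p.2 <= 1)%N, forall i, (p.2 i <= 4)%N & p.1 \in jset p.2]]]
  `|` [set Zfield (wZ 1%N k) k | k in [set k : 'I_3 -> nat |
     [/\ nzeros k = 2%N, k 2 = 0%N & forall i, (k i <= 4)%N]]]
  `|` [set Zfield (row3 0 0 (-1)) (fun=> 0%N)].

End Eigenfunctions.

(* Main.v *)
(* With [k] rescaled by [pi / L], the fields Y and Z are the averages over
   reflections of the plane waves [z sin (k . x - th)] for [th = 0] and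
   [th = pi / 2].  H is the orthogonal complement of the gradients of the
   functions smooth up to the boundary, so the projection onto H acts on such a
   mode by [z |-> z - (z . k) / (k . k) k], and the bracket of two modes is an
   explicit finite sum of modes.  The rest of the saturation is algebra:
   bracketing with a shear flow (0, 0, cos) moves [k_1] or [k_2] by one step and
   is onto, so that a level [k_3 = l > 0] follows from its modes (1, 0, l) and
   (0, 1, l); these come, for [l >= 3], from the two preceding levels by
   bracketing with the modes (1, 0, 1) and (0, 1, 1), and level 0 comes from
   level 1 in the same way.  Hence all divergence-free modes are reached.
   Finally, trigonometric polynomials are dense in L^2 of a cell, since the
   indicator of [q < 1/2] is the limit of the polynomials
   [(1 - q^(2n))^(n 4^n)], and the projections of dense fields are dense in H. *)
Require Import Defs.
From HB Require Import structures.
From mathcomp Require Import all_boot all_order all_algebra.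
From mathcomp Require Import all_classical all_reals all_analysis.
From mathcomp Require Import measurable_realfun.
From mathcomp Require Import ring lra zify.
Set Implicit Arguments.
Unset Strict Implicit.
Unset Printing Implicit Defensive.
Import Order.TTheory GRing.Theory Num.Theory numFieldNormedType.Exports.
Local Open Scope classical_set_scope.
Local Open Scope ring_scope.

(** The obstacle is the third component of the frequency: the horizontal part of a bracket with a
    shear carries the factor k_3, so on level 0 shears produce vertical fields only. That level
    therefore splits by phase, phase 0 keeping horizontal fields and phase pi / 2 vertical ones, and
    the horizontal part has to come from level 1. In the plane k_2 = 0 the bracket is the
    two-dimensional one: it vanishes between modes of equal eigenvalue, and otherwise yields a
    single linear relation between two new modes. A shear supplies the second relation, and the
    determinant of the pair is 4 up to nonzero factors, whatever the level. A phase treats Y and Z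
    at once; a shear shifts it by pi / 2, which exchanges the two families. The saturation is
    computed inside a space of smooth fields, where stability under sums needs no calculus of
    traces, and is enlarged to D(A) at the end by monotonicity. Among the three components, only the
    third has basis functions whose span is an algebra with unit. Density is proved there and passes
    to the other two by multiplication by sin (pi x_i / L_i). *)

Notation mpt2 R := (measurableTypeR R * measurableTypeR R)%type.
Notation mpt R := (measurableTypeR R * measurableTypeR R * measurableTypeR R)%type.

(** * Borel measurability of continuous functions of several variables *)

(** Countability places open sets in the product sigma-algebra, each being the union of the base
    sets that it contains. The neighbourhood filter is a parameter because the topology and the
    measurable structure are carried by different aliases of the same type. *)
Definition measurable_base d (T : measurableType d) (nb : T -> set_system T) :=
  exists B : nat -> set T, (forall n, measurable (B n)) /\
    forall x U, nb x U -> exists2 n, B n x & B n `<=` U.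

Lemma measurable_baseR (R : realType) :
  @measurable_base _ (measurableTypeR R) (@nbhs R R).
Proof.
pose B n := if @unpickle (rat * rat)%type n is Some p then
  `]ratr p.1 : R, ratr p.2[%classic else set0.
exists B; split => [n|x U /nbhs_ballP[e /= e0 xeU]].
  by rewrite /B; case: unpickle => // p; exact: measurable_itv.
have [p pP] : exists p, ratr p \in `]x - e, x[ by apply: rat_in_itvoo; lra.
have [q] : exists q, ratr q \in `]x, x + e[ by apply: rat_in_itvoo; lra.
rewrite in_itv/= => /andP[xq qe]; move: pP; rewrite in_itv/= => /andP[ep px].
exists (pickle (p, q)); rewrite /B pickleK/=.
  by rewrite in_itv/= px.
move=> y; rewrite /= in_itv/= => /andP[py yq]; apply: xeU.
by rewrite /ball/= ltr_norml; lra.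
Qed.


Lemma measurable_base_prod d1 d2 (T1 : measurableType d1)
    (T2 : measurableType d2) (nb1 : T1 -> set_system T1)
    (nb2 : T2 -> set_system T2) (nb : T1 * T2 -> set_system (T1 * T2)) :
  (forall x U, nb x U -> exists A B, [/\ nb1 x.1 A, nb2 x.2 B & A `*` B `<=` U]) ->
  measurable_base nb1 -> measurable_base nb2 -> measurable_base nb.
Proof.
move=> nbE [B1 [mB1 B1P]] [B2 [mB2 B2P]].
pose B n := if @unpickle (nat * nat)%type n is Some p then
  B1 p.1 `*` B2 p.2 else set0.
exists B; split => [n|x U /nbE[V1 [V2 [/B1P[m m1 m2] /B2P[n n1 n2] VU]]]].
  by rewrite /B; case: unpickle => // p; exact: measurableX.
exists (pickle (m, n)); rewrite /B pickleK//=.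
by move=> y [/= /m2 ? /n2 ?]; exact: VU.
Qed.

Lemma measurable_fun_base d (T : measurableType d) (nb : T -> set_system T)
    (R : realType) (f : T -> R) : measurable_base nb ->
  (forall x V, nbhs (f x) V -> nb x (f @^-1` V)) -> measurable_fun setT f.
Proof.
move=> [B [mB BP]] cf; apply: (measurability _ (RGenOpens.measurableE R)).
move=> _ [_ [a [b ->] <-]]; rewrite setTI.
set V := (X in _ @^-1` X); set S := (X in measurable X).
suff -> : S = \bigcup_(n in [set n | B n `<=` S]) B n.
  by apply: bigcup_measurable => k _; exact: mB.
apply/seteqP; split => x; last by move=> [n /= nS /nS].
move=> Sx; have /BP[n nx nS] : nb x S.
  by apply: cf; apply: open_nbhs_nbhs; split => //; exact: interval_open.
by exists n.
Qed.

Lemma nbhs_prod_rect (U1 U2 : topologicalType) (x : U1 * U2) U : nbhs x U ->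
  exists A B, [/\ nbhs x.1 A, nbhs x.2 B & A `*` B `<=` U].
Proof. by case=> -[A B] /= [nA nB] AB; exists A, B. Qed.

Lemma measurable_baseR2 (R : realType) : @measurable_base _
  (measurableTypeR R * measurableTypeR R)%type (@nbhs (R * R)%type (R * R)%type).
Proof.
apply: (measurable_base_prod _ (@measurable_baseR R) (@measurable_baseR R)).
exact: nbhs_prod_rect.
Qed.

Lemma continuous_measurable2 (R : realType) (f : R * R -> R) : continuous f ->
  @measurable_fun _ _ (measurableTypeR R * measurableTypeR R)%type R setT f.
Proof.
move=> cf; apply: (measurable_fun_base (@measurable_baseR2 R)) => x V nV.
exact: cf.
Qed.

Lemma continuous_measurable3 (R : realType) (f : pt R -> R) : continuous f ->
  @measurable_fun _ _ (mpt R) R setT f.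
Proof.
move=> cf; apply: (measurable_fun_base (nb := @nbhs (pt R) (pt R))); last first.
  by move=> x V nV; exact: cf.
apply: (measurable_base_prod _ (@measurable_baseR2 R) (@measurable_baseR R)).
exact: nbhs_prod_rect.
Qed.

(** * Integrability over one period of the domain *)

Section Cell.
Context (R : realType) (L : 'I_3 -> R) (L_gt0 : forall i, 0 < L i).

Lemma cellE : cell L = (`]0, L 0[ `*` `]0, L 1[) `*` `[0, 2 * L 2[.
Proof.
by apply/seteqP; split=> -[[x y] z] /=; rewrite /cell/strip/= !in_itv/=; tauto.
Qed.

Lemma measurable_cell : measurable (cell L : set (mpt R)).
Proof.
by rewrite cellE; apply: measurableX; [apply: measurableX|]; exact: measurable_itv.
Qed.

Lemma measurable_strip : measurable (strip L : set (mpt R)).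
Proof.
have -> : strip L = (`]0, L 0[ `*` `]0, L 1[) `*` setT.
  by apply/seteqP; split=> -[[x y] z] /=; rewrite /strip/= !in_itv/=; tauto.
by apply: measurableX => //; apply: measurableX; exact: measurable_itv.
Qed.

Lemma leb3_cell_fin : (leb3 R (cell L) < +oo)%E.
Proof.
rewrite cellE /leb3 /leb2 product_measure1E//; last by apply: measurableX; exact: measurable_itv.
rewrite [X in (X * _ < _)%E](_ : _ = lebesgue_measure `]0%R, L 0%R[%classic *
  lebesgue_measure `]0%R, L 1%R[%classic)%E; last exact: product_measure1E.
rewrite /= !lebesgue_measure_itv/= !lte_fin !L_gt0 mulr_gt0// -!EFinB -!EFinM.
exact: ltry.
Qed.

Lemma cell_strip : cell L `<=` strip L. Proof. by move=> x []. Qed.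

Lemma continuous_bounded_cell (f : pt R -> R) : continuous f ->
  [bounded f x | x in cell L].
Proof.
move=> cf.
have /compact_bounded : compact (f @` ((`[0, L 0] `*` `[0, L 1]) `*` `[0, 2 * L 2])).
  apply: continuous_compact; first exact: continuous_subspaceT.
  by apply: compact_setX; [apply: compact_setX|]; exact: segment_compact.
rewrite /bounded_set /bounded_near; apply: filterS => M.
rewrite /globally/= => HM x; rewrite cellE => -[[]]/=; rewrite !in_itv/=.
move=> /andP[? ?] /andP[? ?] /andP[? ?]; apply: HM; exists x => //.
rewrite /= !in_itv/=; repeat split; lra.
Qed.

Lemma continuous_integrable_cell (f : pt R -> R) : continuous f ->
  (leb3 R).-integrable (cell L) (EFin \o f).
Proof.
move=> cf; apply: measurable_bounded_integrable.
- exact: measurable_cell.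
- exact: leb3_cell_fin.
- by apply: measurable_funTS; exact: continuous_measurable3.
- exact: continuous_bounded_cell.
Qed.

End Cell.

(** * Vanishing of integrals by Fubini *)

Section FubiniZero.
Local Open Scope ereal_scope.
Context d1 d2 (T1 : measurableType d1) (T2 : measurableType d2) (R : realType).
Variables (m1 : {sigma_finite_measure set T1 -> \bar R})
  (m2 : {sigma_finite_measure set T2 -> \bar R}).
Variables (A : set T1) (B : set T2) (f : T1 * T2 -> \bar R).
Hypotheses (mA : measurable A) (mB : measurable B).
Hypothesis fi : (m1 \x m2).-integrable (A `*` B) f.

Lemma integral_setX0_snd : (forall x, A x -> \int[m2]_(y in B) f (x, y) = 0) ->
  \int[m1 \x m2]_(z in A `*` B) f z = 0.
Proof.
move=> f0; rewrite integral_mkcond -integral12_prod_meas1; last first.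
  by apply/(integrable_mkcond _ _).1 => //; exact: measurableX.
rewrite /fubini_F; apply: integral0_eq => x _.
have [xA|xA] := boolP (x \in A).
  rewrite -(f0 x) ?inE//; last by rewrite -in_setE.
  rewrite [RHS]integral_mkcond; apply: eq_integral => y _.
  by rewrite /patch in_setX/= xA.
by apply: integral0_eq => y _; rewrite /patch in_setX/= (negbTE xA).
Qed.

Lemma integral_setX0_fst : (forall y, B y -> \int[m1]_(x in A) f (x, y) = 0) ->
  \int[m1 \x m2]_(z in A `*` B) f z = 0.
Proof.
move=> f0; rewrite integral_mkcond -integral21_prod_meas1; last first.
  by apply/(integrable_mkcond _ _).1 => //; exact: measurableX.
rewrite /fubini_G; apply: integral0_eq => y _.
have [yB|yB] := boolP (y \in B).
  rewrite -(f0 y) ?inE//; last by rewrite -in_setE.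
  rewrite [RHS]integral_mkcond; apply: eq_integral => x _.
  by rewrite /patch in_setX/= yB andbT.
by apply: integral0_eq => x _; rewrite /patch in_setX/= (negbTE yB) andbF.
Qed.

End FubiniZero.

HB.instance Definition _ (R : realType) := Measure.copy (@leb2 R)
  (@lebesgue_measure R \x @lebesgue_measure R)%E.

Lemma leb2_sigma_finite (R : realType) : sigma_finite setT (@leb2 R).
Proof.
have /sigma_finiteP[F [TF ndF Foo]] := sigma_finiteT (@lebesgue_measure R).
exists (fun n => F n `*` F n).
  rewrite -setXTT TF predeqE => -[x y]; split.
    move=> [/= [n _ Fnx] [k _ Gky]]; exists (maxn n k) => //; split.
    - by move: x Fnx; exact/subsetPset/ndF/leq_maxl.
    - by move: y Gky; exact/subsetPset/ndF/leq_maxr.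
  by move=> [n _ []/= ? ?]; split; exists n.
move=> k; have [? ?] := Foo k; split; first exact: measurableX.
by rewrite /leb2 product_measure1E// lte_mul_pinfty// ge0_fin_numE.
Qed.

HB.instance Definition _ (R : realType) :=
  @Measure_isSigmaFinite.Build _ _ _ (@leb2 R) (@leb2_sigma_finite R).

(** The boolean covers two uses: the cross-section of the cell, open on the left, and the faces,
    where x_3 ranges over an interval closed on the left. *)
Lemma continuous_integrable_rect (R : realType) (q : bool) (f : R * R -> R)
    (a b : R) : 0 < a -> 0 < b -> continuous f ->
  (leb2 R).-integrable (`]0, a[ `*` [set` Interval (BSide q 0) (BLeft b)])
    (EFin \o f).
Proof.
move=> a0 b0 cf; apply: measurable_bounded_integrable.
- by apply: measurableX; exact: measurable_itv.
- rewrite /= /leb2 product_measure1E//; try exact: measurable_itv.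
  rewrite /= !lebesgue_measure_itv/= !lte_fin a0 b0 -!EFinB -!EFinM.
  exact: ltry.
- by apply: measurable_funTS; exact: continuous_measurable2.
- have /compact_bounded : compact (f @` (`[0, a] `*` `[0, b])).
    apply: continuous_compact; first exact: continuous_subspaceT.
    by apply: compact_setX; exact: segment_compact.
  rewrite /bounded_set /bounded_near; apply: filterS => M.
  rewrite /globally/= => HM x [/=]; rewrite !in_itv/= => /andP[x0 xa].
  move=> /andP[y0 yb]; apply: HM; exists x => //.
  rewrite /= !in_itv/=; split; first lra.
  by rewrite (ltW yb) andbT; move: y0; case: (q) => //= /ltW.
Qed.

(** * The fundamental theorem of calculus along coordinate lines *)

Section Parts.
Context (R : realType).

Lemma integral_derivative_itv (b1 b2 : bool) (g h : R -> R) (a b : R) : a < b ->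
  (forall x : R, is_derive x (1:R) g (h x)) -> continuous h ->
  (\int[lebesgue_measure]_(x in [set` Interval (BSide b1 a) (BSide b2 b)])
     (h x)%:E = (g b - g a)%:E)%E.
Proof.
move=> ab gh ch.
have mh A : measurable_fun A h.
  by apply: measurable_funTS; exact: continuous_measurable_fun.
transitivity (\int[lebesgue_measure]_(x in `[a, b]) (h x)%:E)%E.
  case: b1; case: b2 => //.
  - by rewrite integral_itv_bndo_bndc//; exact/measurable_EFinP.
  - rewrite integral_itv_bndo_bndc; last exact/measurable_EFinP.
    by rewrite integral_itv_obnd_cbnd//; exact/measurable_EFinP.
  - by rewrite integral_itv_obnd_cbnd//; exact/measurable_EFinP.
have cg : continuous g.
  by move=> x; apply/differentiable_continuous/derivable1_diffP; case: (gh x).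
rewrite (continuous_FTC2 (F := g) ab) ?EFinB//.
- exact: continuous_subspaceT.
- split.
  + by move=> x _; case: (gh x).
  + by apply: cvg_at_right_filter; exact: cg.
  + by apply: cvg_at_left_filter; exact: cg.
- by move=> x _; rewrite derive1E; case: (gh x).
Qed.

Definition line (x : pt R) (i : 'I_3) (t : R) : pt R :=
  if i == 0 then (t, x.1.2, x.2) else if i == 1 then (x.1.1, t, x.2) else (x.1, t).

Lemma line_add x i t s : line x i (s + t) = s *: evec R i + line x i t.
Proof.
case: x => -[x0 x1] x2; move: i; case=> -[|[|[|//]]] ? ; rewrite /line /evec/=.
- by congr (pair (pair _ _) _); rewrite /= ?scaler0 ?add0r// [_ *: _]mulr1.
- by congr (pair (pair _ _) _); rewrite /= ?scaler0 ?add0r// [_ *: _]mulr1.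
- by congr (pair (pair _ _) _); rewrite /= ?scaler0 ?add0r// [_ *: _]mulr1.
Qed.

Lemma is_derive_line (G : pt R -> R) i (x : pt R) (t : R) :
  (forall y, derivable G y (evec R i)) ->
  is_derive t (1:R) (G \o line x i) (partial i G (line x i t)).
Proof.
move=> dG.
have E : (fun h : R => h^-1 *: (((G \o line x i) \o shift t) (h *: 1) - (G \o line x i) t))
   = (fun h => h^-1 *: ((G \o shift (line x i t)) (h *: evec R i) - G (line x i t))).
  by apply/funext => h /=; rewrite [_ *: 1]mulr1 line_add.
split; first by rewrite /derivable E; exact: dG.
by rewrite /derive E.
Qed.

Lemma continuous_line x i : continuous (line x i).
Proof.
move: i; case=> -[|[|[|//]]] ? t; rewrite /line /=.
- apply: (cvg_pair (G := nbhs (t, x.1.2)) (H := nbhs x.2)); last exact: cvg_cst.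
  by apply: (cvg_pair (G := nbhs t) (H := nbhs x.1.2)); [exact: cvg_id|exact: cvg_cst].
- apply: (cvg_pair (G := nbhs (x.1.1, t)) (H := nbhs x.2)); last exact: cvg_cst.
  by apply: (cvg_pair (G := nbhs x.1.1) (H := nbhs t)); [exact: cvg_cst|exact: cvg_id].
- by apply: (cvg_pair (G := nbhs x.1) (H := nbhs t)); [exact: cvg_cst|exact: cvg_id].
Qed.

End Parts.

(** * The divergence theorem on one period *)

Section Gauss.
Context (R : realType) (L : 'I_3 -> R) (L_gt0 : forall i, 0 < L i).

Definition no_flux (i : 'I_3) (G : pt R -> R) : Prop :=
  if i == 2 then forall x, G (shift3 L x) = G x
  else forall x, G (line x i 0) = 0 /\ G (line x i (L i)) = 0.

Let mu1 : {sigma_finite_measure set (measurableTypeR R) -> \bar R} :=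
  @lebesgue_measure R.
Let mu2 : {sigma_finite_measure set (mpt2 R) -> \bar R} := @leb2 R.

Let S0 : set R := `]0, L 0[.
Let S1 : set R := `]0, L 1[.
Let S2 : set R := `[0, 2 * L 2[.

Lemma integral_cell0_snd (f : pt R -> \bar R) :
  (leb3 R).-integrable (cell L) f ->
  (forall x, (S0 `*` S1) x ->
     \int[lebesgue_measure]_(z in S2) f (x, z) = 0)%E ->
  (\int[leb3 R]_(x in cell L) f x = 0)%E.
Proof.
rewrite cellE => fi f0.
have mA : measurable (S0 `*` S1 : set (mpt2 R)).
  by apply: measurableX; exact: measurable_itv.
have mB : measurable (S2 : set (measurableTypeR R)).
  exact: measurable_itv.
exact: (@integral_setX0_snd _ _ _ _ R mu2 mu1 _ _ f mA mB fi f0).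
Qed.

Lemma integral_cell0_fst (f : pt R -> \bar R) :
  (leb3 R).-integrable (cell L) f ->
  (forall z, S2 z ->
     \int[leb2 R]_(x in S0 `*` S1) f (x, z) = 0)%E ->
  (\int[leb3 R]_(x in cell L) f x = 0)%E.
Proof.
rewrite cellE => fi f0.
have mA : measurable (S0 `*` S1 : set (mpt2 R)).
  by apply: measurableX; exact: measurable_itv.
have mB : measurable (S2 : set (measurableTypeR R)).
  exact: measurable_itv.
exact: (@integral_setX0_fst _ _ _ _ R mu2 mu1 _ _ f mA mB fi f0).
Qed.

Lemma integral_rect0_snd (f : R * R -> \bar R) :
  (leb2 R).-integrable (S0 `*` S1) f ->
  (forall x, S0 x ->
     \int[lebesgue_measure]_(z in S1) f (x, z) = 0)%E ->
  (\int[leb2 R]_(x in S0 `*` S1) f x = 0)%E.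
Proof.
move=> fi f0.
have mA i : measurable (`]0, L i[%classic : set (measurableTypeR R)).
  exact: measurable_itv.
exact: (@integral_setX0_snd _ _ _ _ R mu1 mu1 _ _ f (mA 0) (mA 1) fi f0).
Qed.

Lemma integral_rect0_fst (f : R * R -> \bar R) :
  (leb2 R).-integrable (S0 `*` S1) f ->
  (forall z, S1 z ->
     \int[lebesgue_measure]_(x in S0) f (x, z) = 0)%E ->
  (\int[leb2 R]_(x in S0 `*` S1) f x = 0)%E.
Proof.
move=> fi f0.
have mA i : measurable (`]0, L i[%classic : set (measurableTypeR R)).
  exact: measurable_itv.
exact: (@integral_setX0_fst _ _ _ _ R mu1 mu1 _ _ f (mA 0) (mA 1) fi f0).
Qed.

(** The fundamental theorem of calculus in the i-th variable; Fubini is arranged so that this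
    variable is integrated innermost. *)
Lemma intO_partial0 i (G : pt R -> R) : (forall x, derivable G x (evec R i)) ->
  continuous (partial i G) -> no_flux i G -> intO L (partial i G) = 0.
Proof.
move=> dG cG nf; rewrite /intO /Rintegral.
suff -> : (\int[leb3 R]_(x in cell L) (partial i G x)%:E = 0)%E by [].
have iG := continuous_integrable_cell L_gt0 cG.
have cl x : continuous (partial i G \o line x i).
  by move=> t; apply: continuous_comp; [exact: continuous_line|exact: cG].
have dl x t := is_derive_line x t dG.
have FTC x b1 a : 0 < a -> G (line x i 0) = G (line x i a) ->
  (\int[lebesgue_measure]_(t in [set` Interval (BSide b1 0%R) (BLeft a)])
     (partial i G (line x i t))%:E = 0)%E.
  by move=> a0 E; rewrite (integral_derivative_itv b1 true a0 (dl x) (cl x))/= E subrr.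
have [i2|i2] := eqVneq i 2.
  apply: integral_cell0_snd => // x _.
  apply: etrans (FTC (x, 0) true (2 * L 2) _ _).
  - by apply: eq_integral => z _; rewrite i2.
  - by rewrite mulr_gt0.
  - move: nf; rewrite /no_flux i2/= => /(_ (x, 0)).
    by rewrite /shift3/line/= add0r => <-; case: (x).
apply: integral_cell0_fst => // z _.
have nf' x : G (line x i 0) = G (line x i (L i)).
  by move: nf; rewrite /no_flux (negbTE i2) => /(_ x)[-> ->].
have iz : (leb2 R).-integrable (`]0, L 0[ `*` `]0, L 1[) (fun x => (partial i G (x, z))%:E).
  apply: (continuous_integrable_rect false (f := fun x => partial i G (x, z))) => // x.
  apply: (continuous_comp (f := fun x => (x, z))); last exact: cG.
  by apply: (cvg_pair (G := nbhs x) (H := nbhs z)); [exact: cvg_id|exact: cvg_cst].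
have [i0|i0] := eqVneq i 0.
  apply: integral_rect0_fst => // y _.
  by have := FTC (0, y, z) false (L i) (L_gt0 i) (nf' _); rewrite i0.
have i1 : i = 1.
  by apply/eqP; move: i0 i2; case: (i) => -[|[|[|//]]].
apply: integral_rect0_snd => // x _.
by have := FTC (x, 0, z) false (L i) (L_gt0 i) (nf' _); rewrite i1.
Qed.

End Gauss.

(** * Calculus of smooth functions *)

Section Smooth.
Context (R : realType).
Implicit Types (f g : pt R -> R) (i j : 'I_3).

Lemma CkS m f : Ck m.+1 f -> Ck m f.
Proof.
elim: m f => [|m IH] f; first by move=> [].
by move=> [cf df]; split=> // i; have [? ?] := df i; split => //; exact: IH.
Qed.

Lemma partialD i f g : (forall x, derivable f x (evec R i)) ->
  (forall x, derivable g x (evec R i)) ->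
  partial i (f \+ g) = partial i f \+ partial i g.
Proof. by move=> df dg; apply/funext => x; exact: deriveD. Qed.

Lemma partialM i f g : (forall x, derivable f x (evec R i)) ->
  (forall x, derivable g x (evec R i)) ->
  partial i (f \* g) = (f \* partial i g) \+ (g \* partial i f).
Proof. by move=> df dg; apply/funext => x; exact: deriveM. Qed.

Lemma partial_cst i c : partial i (cst c) = cst 0 :> (pt R -> R).
Proof. by apply/funext => x; exact: derive_cst. Qed.

Lemma Ck_cst m c : Ck m (cst c : pt R -> R).
Proof.
elim: m c => [|m IH] c; split => //; try by move=> x; exact: cvg_cst.
by move=> i; split => [x|]; [exact: derivable_cst|rewrite partial_cst].
Qed.

Lemma CkD m f g : Ck m f -> Ck m g -> Ck m (f \+ g).
Proof.
elim: m f g => [|m IH] f g [cf df] [cg dg].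
  by split => // x; apply: cvgD; [exact: cf|exact: cg].
split=> [x|i]; first by apply: cvgD; [exact: cf|exact: cg].
have [df1 df2] := df i; have [dg1 dg2] := dg i.
by rewrite partialD//; split => [x|]; [exact: derivableD|exact: IH].
Qed.

Lemma CkM m f g : Ck m f -> Ck m g -> Ck m (f \* g).
Proof.
elim: m f g => [|m IH] f g.
  by move=> [cf df] [cg dg]; split => // x; apply: cvgM; [exact: cf|exact: cg].
move=> Cf Cg; have := Cf; have := Cg => -[cg dg] [cf df].
split=> [x|i]; first by apply: cvgM; [exact: cf|exact: cg].
have [df1 df2] := df i; have [dg1 dg2] := dg i.
rewrite partialM//; split => [x|]; first exact: derivableM.
by apply: CkD; apply: IH => //; exact: CkS.
Qed.

Lemma smoothD f g : smooth f -> smooth g -> smooth (f \+ g).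
Proof. by move=> ? ? m; exact: CkD. Qed.

Lemma smoothM f g : smooth f -> smooth g -> smooth (f \* g).
Proof. by move=> ? ? m; exact: CkM. Qed.

Lemma smooth_cst c : smooth (cst c : pt R -> R).
Proof. by move=> m; exact: Ck_cst. Qed.

Lemma smooth_continuous f : smooth f -> continuous f.
Proof. by move=> /(_ 0%N)[]. Qed.

Lemma smooth_derivable f i x : smooth f -> derivable f x (evec R i).
Proof. by move=> /(_ 1%N)[_ /(_ i)[]]. Qed.

Lemma smooth_partial i f : smooth f -> smooth (partial i f).
Proof. by move=> sf m; have [_ /(_ i)[]] := sf m.+1. Qed.

(** Smoothness by coinduction: exhibiting a class stable under partial derivatives replaces a
    formula for the derivatives of every order. *)
Lemma smooth_coind (Q : (pt R -> R) -> Prop) :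
  (forall f, Q f -> continuous f /\
     forall i, (forall x, derivable f x (evec R i)) /\ Q (partial i f)) ->
  forall f, Q f -> smooth f.
Proof.
move=> QP f Qf m; elim: m f Qf => [|m IH] f /QP[cf df]; split => // i.
by have [? /IH] := df i.
Qed.

Lemma line_xcoord (x : pt R) i : line x i (xcoord x i) = x.
Proof. by case: x => -[x y] z; move: i; case=> -[|[|[|//]]] ?. Qed.

Lemma xcoord_line (x : pt R) i j t :
  xcoord (line x i t) j = if i == j then t else xcoord x j.
Proof.
case: x => -[x y] z; move: i j; case=> -[|[|[|//]]] ?.
- by case=> -[|[|[|//]]] ?.
- by case=> -[|[|[|//]]] ?.
- by case=> -[|[|[|//]]] ?.
Qed.

Lemma is_derive_of_line f i (x : pt R) (d : R) :
  is_derive (xcoord x i) (1 : R) (f \o line x i) d ->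
  is_derive x (evec R i) f d.
Proof.
have E : (fun h : R => h^-1 *: (((f \o line x i) \o shift (xcoord x i)) (h *: 1) - (f \o line x i) (xcoord x i)))
   = (fun h => h^-1 *: ((f \o shift x) (h *: evec R i) - f x)).
  by apply/funext => h /=; rewrite [_ *: 1]mulr1 line_add line_xcoord.
move=> [df D]; split.
  by move: df; rewrite /derivable E.
by move: D; rewrite /derive E.
Qed.

Lemma continuous_xcoord i : continuous (fun x : pt R => xcoord x i).
Proof.
move: i; case=> -[|[|[|//]]] ? x; rewrite /xcoord /=.
- by apply: (continuous_comp (f := fst) (g := fst)); exact: cvg_fst.
- by apply: (continuous_comp (f := fst) (g := snd)); [exact: cvg_fst|exact: cvg_snd].
- exact: cvg_snd.
Qed.

Lemma is_derive_xcoord (h : R -> R) d i j (x : pt R) :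
  is_derive (xcoord x j) (1 : R) h d ->
  is_derive x (evec R i) (fun y => h (xcoord y j)) (if i == j then d else 0).
Proof.
move=> dh; apply: is_derive_of_line.
have [->|ij] := eqVneq i j.
  suff -> : (fun y => h (xcoord y j)) \o line x j = h by [].
  by apply/funext => t /=; rewrite xcoord_line eqxx.
suff -> : (fun y => h (xcoord y j)) \o line x i = cst (h (xcoord x j)).
  exact: is_derive_cst.
by apply/funext => t /=; rewrite xcoord_line (negbTE ij).
Qed.

(** One-variable form of the coinduction, used for combinations of bumps and for phase-shifted
    cosines. The derivatives in the other variables vanish, so the zero function is adjoined to the
    class. *)
Lemma smooth_xcoord (q : (R -> R) -> Prop) :
  (forall h, q h -> exists2 h', q h' & forall t : R, is_derive t (1 : R) h (h' t)) ->
  forall h j, q h -> smooth (fun x => h (xcoord x j)).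
Proof.
move=> qP h j qh.
pose Q f := f = cst 0 \/ exists2 h, q h & f = (fun x => h (xcoord x j)).
apply: (@smooth_coind Q); last by right; exists h.
move=> {h qh} _ [->|[h qh ->]].
  split; first by move=> x; exact: cvg_cst.
  by move=> i; split => [x|]; [exact: derivable_cst|left; exact: partial_cst].
have [h' qh' dh] := qP _ qh; split => [x|i].
  apply: continuous_comp; first exact: continuous_xcoord.
  by apply/differentiable_continuous/derivable1_diffP; case: (dh (xcoord x j)).
have D x := @is_derive_xcoord h _ i j x (dh _).
split=> [x|]; first by case: (D x).
case: (boolP (i == j)) => ij.
  by right; exists h' => //; apply/funext => x; case: (D x); rewrite ij.
by left; apply/funext => x; case: (D x); rewrite (negbTE ij).
Qed.

End Smooth.

(** * Square-integrable functions, integration by parts, weak derivatives *)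

Section SquareIntegrable.
Context (R : realType) (L : 'I_3 -> R) (L_gt0 : forall i, 0 < L i).
Implicit Types (f g : pt R -> R) (i j : 'I_3).

Lemma L2_measurable f : L2 L f -> @measurable_fun _ _ (mpt R) R (cell L) f.
Proof.
move=> [mf _ _]; apply: (measurable_funS _ (@cell_strip R L) mf).
exact: measurable_strip.
Qed.

Lemma L2_integrableM f g : L2 L f -> L2 L g ->
  (leb3 R).-integrable (cell L) (fun x => (f x * g x)%:E).
Proof.
move=> Lf Lg; have mf := L2_measurable Lf; have mg := L2_measurable Lg.
have [_ _ f2] := Lf; have [_ _ g2] := Lg.
have mc : measurable (cell L : set (mpt R)) by exact: measurable_cell.
have := integrableD mc f2 g2; apply: le_integrable => //.
  by apply/measurable_EFinP; exact: measurable_funM.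
move=> x _; rewrite /= lee_fin [leRHS]ger0_norm ?addr_ge0 ?sqr_ge0//.
rewrite ler_norml; move: (f x) (g x) => a b.
have := sqr_ge0 (a - b); have := sqr_ge0 (a + b) => h1 h2.
by apply/andP; split; nra.
Qed.

Lemma L2D f g : L2 L f -> L2 L g -> L2 L (f \+ g).
Proof.
move=> Lf Lg; have [mf pf f2] := Lf; have [mg pg g2] := Lg; split.
- exact: measurable_funD.
- by move=> x sx; rewrite /= pf// pg.
- have mc : measurable (cell L : set (mpt R)) by exact: measurable_cell.
  have fg := L2_integrableM Lf Lg.
  have := integrableD mc (integrableD mc f2 g2) (integrableD mc fg fg).
  by congr (_.-integrable _ _); apply/funext => x /=; congr (_%:E); ring.
Qed.

Lemma L2Z c f : L2 L f -> L2 L (fun x => c * f x).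
Proof.
move=> Lf; have [mf pf f2] := Lf; split.
- by apply: measurable_funM => //; exact: measurable_cst.
- by move=> x sx; rewrite /= pf.
- have mc : measurable (cell L : set (mpt R)) by exact: measurable_cell.
  have := integrableZl mc (c ^+ 2) f2.
  by congr (_.-integrable _ _); apply/funext => x /=; rewrite exprMn EFinM.
Qed.

Lemma L2B f g : L2 L f -> L2 L g -> L2 L (f \- g).
Proof.
move=> Lf Lg; have := L2D Lf (L2Z (-1) Lg).
by congr L2; apply/funext => x /=; rewrite mulN1r.
Qed.

Lemma periodic_continuous_L2 f : continuous f ->
  (forall x, f (shift3 L x) = f x) -> L2 L f.
Proof.
move=> cf pf; split => //.
- apply: (@measurable_funTS _ _ (mpt R)); exact: continuous_measurable3.
- apply: (continuous_integrable_cell L_gt0 (f := fun x => f x ^+ 2)) => x.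
  by under eq_fun do rewrite expr2; apply: cvgM; exact: cf.
Qed.

Lemma smooth_closure_L2 f : smooth_closure L f -> L2 L f.
Proof.
move=> [sf pf]; apply: periodic_continuous_L2 => //; exact: smooth_continuous.
Qed.

Lemma smooth_closureD f g :
  smooth_closure L f -> smooth_closure L g -> smooth_closure L (f \+ g).
Proof.
by move=> [sf pf] [sg pg]; split => [|x]; [exact: smoothD|rewrite /= pf pg].
Qed.

Lemma smooth_closureM f g :
  smooth_closure L f -> smooth_closure L g -> smooth_closure L (f \* g).
Proof.
by move=> [sf pf] [sg pg]; split => [|x]; [exact: smoothM|rewrite /= pf pg].
Qed.

Lemma smooth_closure_cst c : smooth_closure L (cst c).
Proof. by split => [|x //]; exact: smooth_cst. Qed.

Lemma smooth_closureZ c f : smooth_closure L f -> smooth_closure L (fun x => c * f x).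
Proof. by move=> sf; apply: (smooth_closureM (f := cst c)) => //; exact: smooth_closure_cst. Qed.

Lemma shift3_add (x : pt R) (h : R) i :
  shift3 L (h *: evec R i + x) = h *: evec R i + shift3 L x.
Proof.
case: x => -[x y] z; rewrite /shift3 /evec/=.
by congr (pair (pair _ _) _); rewrite /= -addrA.
Qed.

Lemma smooth_closure_partial i f : smooth_closure L f -> smooth_closure L (partial i f).
Proof.
move=> [sf pf]; split; first exact: smooth_partial.
move=> x; rewrite /partial /derive.
suff -> : (fun h : R => h^-1 *: ((f \o shift (shift3 L x)) (h *: evec R i) - f (shift3 L x))) =
  (fun h => h^-1 *: ((f \o shift x) (h *: evec R i) - f x)) by [].
by apply/funext => h /=; rewrite -shift3_add !pf.
Qed.

Lemma intOD f g : (leb3 R).-integrable (cell L) (EFin \o f) ->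
  (leb3 R).-integrable (cell L) (EFin \o g) ->
  intO L (fun x => f x + g x) = intO L f + intO L g.
Proof. by move=> fi gi; rewrite /intO RintegralD//; exact: measurable_cell. Qed.

Lemma intOZ c f : (leb3 R).-integrable (cell L) (EFin \o f) ->
  intO L (fun x => c * f x) = c * intO L f.
Proof. by move=> fi; rewrite /intO RintegralZl//; exact: measurable_cell. Qed.

Lemma intO_cst0 : intO L (fun=> 0) = 0.
Proof. by rewrite /intO /Rintegral integral0. Qed.

Lemma integrable_sum_cell (I : Type) (r : seq I) (F : I -> pt R -> R) :
  (forall k, (leb3 R).-integrable (cell L) (EFin \o F k)) ->
  (leb3 R).-integrable (cell L) (fun x => (\sum_(k <- r) F k x)%:E).
Proof.
move=> iF; have mc : measurable (cell L : set (mpt R)) by exact: measurable_cell.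
elim: r => [|a r IH].
  by under eq_fun do rewrite big_nil; exact: integrable0.
under eq_fun do rewrite big_cons EFinD; exact: (integrableD mc (iF a) IH).
Qed.

Lemma intO_sum (I : Type) (r : seq I) (F : I -> pt R -> R) :
  (forall k, (leb3 R).-integrable (cell L) (EFin \o F k)) ->
  intO L (fun x => \sum_(k <- r) F k x) = \sum_(k <- r) intO L (F k).
Proof.
move=> iF; elim: r => [|a r IH].
  by rewrite big_nil -[RHS]intO_cst0; under [in LHS]eq_fun do rewrite big_nil.
under eq_fun do rewrite big_cons.
by rewrite big_cons -IH intOD//; exact: integrable_sum_cell.
Qed.

Lemma smooth_closure_integrable f : smooth_closure L f ->
  (leb3 R).-integrable (cell L) (EFin \o f).
Proof. by move=> [sf _]; apply: continuous_integrable_cell => //; exact: smooth_continuous. Qed.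

Lemma intO_by_parts i f g : smooth_closure L f -> smooth_closure L g ->
  (i != 2 -> no_flux L i (f \* g)) ->
  intO L (fun x => f x * partial i g x) = - intO L (fun x => partial i f x * g x).
Proof.
move=> sf sg nf; apply/eqP; rewrite -subr_eq0 opprK; apply/eqP.
have si h : smooth_closure L h -> forall x, derivable h x (evec R i).
  by move=> [sh _] x; exact: smooth_derivable.
rewrite -intOD; last 2 first.
- apply: (smooth_closure_integrable (f := f \* partial i g)).
  by apply: smooth_closureM => //; exact: smooth_closure_partial.
- apply: (smooth_closure_integrable (f := partial i f \* g)).
  by apply: smooth_closureM => //; exact: smooth_closure_partial.
have sfg := smooth_closureM sf sg.
rewrite -[RHS](@intO_partial0 _ _ L_gt0 i (f \* g)).
- congr intO; rewrite partialM; [|exact: si..].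
  by apply/funext => x /=; rewrite [X in _ + X]mulrC.
- exact: si.
- by apply: smooth_continuous; have [] := smooth_closure_partial i sfg.
- have [i2|i2] := eqVneq i 2; last exact: nf.
  by rewrite i2 /no_flux/=; have [] := sfg.
Qed.

Lemma test_flux i f phi : test L phi -> i != 2 -> no_flux L i (f \* phi).
Proof.
move=> [[sphi pphi] sup] i2; rewrite /no_flux (negbTE i2) => x.
have z y : ~ strip L y -> phi y = 0.
  by move=> ny; apply: contra_notP ny => /eqP yn; apply: sup; exact: subset_closure.
have st t : strip L (line x i t) -> 0 < t < L i.
  move: i i2; case=> -[|[|[|//]]] ? i2; rewrite /strip/line/= => -[].
  - by rewrite (_ : Ordinal _ = 0)//; exact: val_inj.
  - by rewrite (_ : Ordinal _ = 1)//; exact: val_inj.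
  - by move: i2; rewrite (_ : Ordinal _ = 2)//; exact: val_inj.
split; rewrite /= z ?mulr0//; move/st; first by rewrite ltxx.
by rewrite ltxx andbF.
Qed.

Lemma smooth_weak_partial i f : smooth_closure L f ->
  weak_partial L i f (partial i f).
Proof.
move=> sf; split; [exact: smooth_closure_L2|exact/smooth_closure_L2/smooth_closure_partial|].
move=> phi tphi; apply: intO_by_parts => //; first by case: tphi.
by move=> i2; exact: test_flux.
Qed.

Lemma smooth_Sobolev m f : smooth_closure L f -> Sobolev L m f.
Proof.
elim: m f => [|m IH] f sf; split => //; try exact: smooth_closure_L2.
move=> i; exists (partial i f); first exact: smooth_weak_partial.
exact/IH/smooth_closure_partial.
Qed.

End SquareIntegrable.

Lemma is_derive_congr (R : realType) (f g : R -> R) (x d e : R) :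
  f =1 g -> d = e -> is_derive x (1 : R) f d -> is_derive x (1 : R) g e.
Proof. by move=> /funext -> ->. Qed.

(** * The flat function exp (- 1 / t) *)

Section Bump.
Context (R : realType).

(** The factor t^-n keeps the span of the family stable under differentiation, which makes the
    member [n = 0] smooth. *)
Definition bump (n : nat) (t : R) : R :=
  if 0 < t then t^-1 ^+ n * expR (- t^-1) else 0.

Lemma bump_ge0 n t : 0 <= bump n t.
Proof.
by rewrite /bump; case: ifPn => // t0; rewrite mulr_ge0 ?expR_ge0 ?exprn_ge0 ?invr_ge0 ?ltW.
Qed.

(** With u = 1 / t, the exponential series gives exp u >= u^(n+1) / (n+1)!. At 0 the difference
    quotient of [bump n] is [bump n.+1], so this linear bound yields the derivative there. *)
Lemma bump_le n t : bump n t <= (n.+1)`!%:R * `|t|.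
Proof.
rewrite /bump; case: ifPn => [t0|_]; last by rewrite mulr_ge0.
rewrite gtr0_norm// expRN.
have u0 : 0 < t^-1 by rewrite invr_gt0.
rewrite ler_pdivrMr ?expR_gt0//.
apply: le_trans (ler_wpM2l _ (expR_ge1Dxn n (ltW u0))); last first.
  by rewrite mulr_ge0// ltW.
rewrite mulrDr mulr1 -[leLHS]add0r lerD//; first by rewrite mulr_ge0// ltW.
rewrite exprS -[leRHS]mulrA [t * _]mulrA [t * (_ * _)]mulrA divff ?gt_eqF// mul1r.
by rewrite mulrCA divff ?mulr1// pnatr_eq0 -lt0n fact_gt0.
Qed.

Lemma bump0_le1 t : bump 0 t <= 1.
Proof.
rewrite /bump; case: ifPn => // t0; rewrite expr0 mul1r -expR0 ler_expR.
by rewrite lerNl oppr0 invr_ge0 ltW.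
Qed.

Lemma is_derive_bump n (t : R) :
  is_derive t (1 : R) (bump n) (- n%:R * bump n.+1 t + bump n.+2 t).
Proof.
have [t0|t0|->] := ltgtP t 0.
- have -> : - n%:R * bump n.+1 t + bump n.+2 t = 0.
    by rewrite /bump ltNge (ltW t0)/= mulr0 addr0.
  apply: (near_eq_is_derive (f := cst 0)).
  near=> s; rewrite /bump ifF//; apply/negbTE; rewrite -leNgt ltW//.
  by near: s; exact: lt_nbhsl.
- apply: (near_eq_is_derive (f := fun s : R => s^-1 ^+ n * expR (- s^-1))).
    near=> s; rewrite /bump ifT//.
    by near: s; exact: lt_nbhsr.
  have tn0 : t != 0 by rewrite gt_eqF.
  have dV : is_derive t (1 : R) (fun s : R => s^-1) (- t ^- 2 *: 1).
    by apply: is_deriveV.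
  have dX := is_deriveX n dV.
  have dE : is_derive t (1:R) (expR \o (fun s => - s^-1)) (expR (- t^-1) * (- (- t ^- 2 *: 1))).
    by apply: is_derive1_comp; exact: is_deriveN.
  have := is_deriveM dX dE; apply: is_derive_congr; first by move=> s; rewrite !fctE.
  rewrite /bump t0.
  rewrite /= !fctE/= /GRing.scale/= !mulr1 -!exprVn.
  case: n {dX} => [|n]; rewrite ?expr0/= ?exprS; ring.
- have -> : - n%:R * bump n.+1 0 + bump n.+2 0 = 0 by rewrite /bump ltxx mulr0 addr0.
  suff H : h^-1 *: ((bump n \o shift 0) (h *: (1:R)) - bump n 0) @[h --> (0:R)^'] --> (0:R).
    by split; [apply/cvg_ex; exists 0|apply/cvg_lim].
  have E (h : R) : h != 0 -> h^-1 *: ((bump n \o shift 0) (h *: (1:R)) - bump n 0) = bump n.+1 h.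
    move=> h0; rewrite /= addr0 [h *: 1]mulr1 {2}/bump ltxx subr0 /bump.
    by case: ifPn => _; rewrite ?scaler0// [LHS]mulrA -exprS.
  apply/cvgr0Pnorm_le => e e0; near=> h.
  rewrite E; last by near: h; exact: nbhs_dnbhs_neq.
  rewrite ger0_norm ?bump_ge0//; apply: le_trans (bump_le _ _) _.
  have f0 : (0 : R) < (n.+2)`!%:R by rewrite ltr0n fact_gt0.
  rewrite mulrC -ler_pdivlMr//; near: h; apply: nbhs_dnbhs.
  have ef : 0 < e / (n.+2)`!%:R by rewrite divr_gt0.
  exact: (@nbhs0_le R R^o _ ef).
Unshelve. all: by end_near. Qed.

Lemma bump_affine_smooth (a b : R) j :
  smooth (fun x : pt R => bump 0 (a * xcoord x j + b)).
Proof.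
pose q (h : R -> R) := exists s : seq (R * nat),
  h = fun t => \sum_(p <- s) p.1 * bump p.2 (a * t + b).
apply: (@smooth_xcoord R q _ (fun t => bump 0 (a * t + b))); last first.
  by exists [:: (1, 0%N)]; apply/funext => t; rewrite big_seq1 mul1r.
move=> _ [s ->]; elim: s => [|[c n] s [_ [s' ->] IH]].
  exists (cst 0); first by exists [::]; apply/funext => t; rewrite big_nil.
  by move=> t; under eq_fun do rewrite big_nil; exact: is_derive_cst.
exists (fun t => c * a * (- n%:R * bump n.+1 (a * t + b) + bump n.+2 (a * t + b)) +
   \sum_(p <- s') p.1 * bump p.2 (a * t + b)).
  exists [:: (- (c * a * n%:R), n.+1), (c * a, n.+2) & s'].
  by apply/funext => t; rewrite !big_cons/=; ring.
move=> t; under eq_fun do rewrite big_cons/=.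
apply: is_deriveD.
have dl : is_derive t (1:R) (fun s : R => a * s + b) a.
  have := is_deriveD (is_deriveZ a (is_derive_id t (1:R))) (is_derive_cst b t (1:R)).
  by apply: is_derive_congr => //; rewrite addr0 [LHS]mulr1.
have := is_deriveZ c (is_derive1_comp (g := fun s : R => a * s + b)
  (is_derive_bump n (a * t + b)) dl).
by apply: is_derive_congr => //; rewrite /GRing.scale/=; ring.
Qed.

End Bump.

(** * Cut-off functions near the lateral boundary *)

Section Cutoff.
Context (R : realType) (L : 'I_3 -> R) (L_gt0 : forall i, 0 < L i).

(** It vanishes within distance 1 / n of the two faces. Inside it only tends to 1, instead of being
    equal to 1 on large sets; dominated convergence asks for no more. *)
Definition cutoff1 (j : 'I_3) (n : nat) (x : pt R) : R :=
  bump 0 (n%:R * xcoord x j + -1) * bump 0 (- n%:R * xcoord x j + (n%:R * L j - 1)).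

Definition cutoff (n : nat) (x : pt R) : R := cutoff1 0 n x * cutoff1 1 n x.

Lemma cutoff1_smooth j n : smooth (cutoff1 j n).
Proof. by apply: smoothM; exact: bump_affine_smooth. Qed.

Lemma cutoff_smooth_closure n : smooth_closure L (cutoff n).
Proof. by split => // ; apply: smoothM; exact: cutoff1_smooth. Qed.

Lemma cutoff1_bound j n x : 0 <= cutoff1 j n x <= 1.
Proof. by rewrite mulr_ge0 ?bump_ge0//= mulr_ile1 ?bump_ge0 ?bump0_le1. Qed.

Lemma cutoff_bound n x : 0 <= cutoff n x <= 1.
Proof.
have /andP[? ?] := cutoff1_bound 0 n x; have /andP[? ?] := cutoff1_bound 1 n x.
by rewrite mulr_ge0//= mulr_ile1.
Qed.

Lemma cutoff1_neq0 j n x : cutoff1 j n x != 0 ->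
  1 <= n%:R * xcoord x j <= n%:R * L j - 1.
Proof.
rewrite mulf_eq0 negb_or /bump => /andP[].
case: ifPn; last by rewrite eqxx.
move=> h1 _; case: ifPn; last by rewrite eqxx.
by move: h1; rewrite mulNr; move: (_ * _) => t h1 h2 _; lra.
Qed.

Lemma cutoff_test f n : smooth_closure L f -> test L (f \* cutoff n).
Proof.
move=> sf; split; first by apply: smooth_closureM => //; exact: cutoff_smooth_closure.
pose K j := [set x : pt R | n%:R * xcoord x j \in `[1, n%:R * L j - 1]].
have clK j : closed (K j).
  apply: (closed_comp (f := fun x => n%:R * xcoord x j) (D := [set` `[1, n%:R * L j - 1]])).
    by move=> x _; apply: cvgM; [exact: cvg_cst|exact: continuous_xcoord].
  exact: interval_closed.
have KL j x : K j x -> 0 < xcoord x j < L j.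
  rewrite /K/= in_itv/= => /andP[h1 h2].
  have c0 : (0 : R) < n%:R.
    by rewrite lt0r ler0n andbT; apply: contraTneq h1 => ->; rewrite mul0r ler10.
  move: (xcoord x j) (L j) h1 h2 => a b h1 h2.
  apply/andP; split; first by rewrite -(pmulr_rgt0 _ c0); apply: lt_le_trans h1.
  by rewrite -(ltr_pM2l c0); apply: le_lt_trans h2 _; rewrite ltrBlDr ltrDl.
apply: (@subset_trans _ (K 0 `&` K 1)); last first.
  by move=> x [/KL x0 /KL x1]; split.
rewrite closureE; apply: smallest_sub; first exact: closedI.
move=> x /=; rewrite mulf_eq0 negb_or => /andP[_].
rewrite mulf_eq0 negb_or => /andP[/cutoff1_neq0 h0 /cutoff1_neq0 h1].
by split; rewrite /K/= in_itv.
Qed.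

Lemma cvg_bump0 (a b : R) : 0 < a -> bump 0 (n%:R * a + b) @[n --> \oo] --> (1 : R).
Proof.
move=> a0.
have u : n%:R * a + b @[n --> \oo] --> +oo.
  have H : (n%:R : R) * a @[n --> \oo] --> +oo.
    have Ha : r * a @[r --> +oo] --> +oo by apply: gt0_cvgMly => //; exact: cvg_id.
    exact: (cvg_comp _ _ (@cvgr_idn R) Ha).
  exact: (cvg_comp _ _ H (cvg_addrr b)).
have u0 : \forall n \near \oo, 0 < n%:R * a + b.
  exact: (u _ (@nbhs_pinfty_gt R 0 (num_real _))).
have E : {near \oo, (fun n => expR (- (n%:R * a + b)^-1)) =1 (fun n => bump 0 (n%:R * a + b))}.
  by near=> n; rewrite /bump ifT ?expr0 ?mul1r//; near: n.
apply: cvg_trans (near_eq_cvg E) _.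
suff : expR (- (n%:R * a + b)^-1) @[n --> \oo] --> expR (- 0).
  by rewrite oppr0 expR0.
apply: continuous_cvg; first exact: continuous_expR.
apply: cvgN; have [_ V] := gtr0_cvgV0 (f := fun n => n%:R * a + b) u0.
exact: V u.
Unshelve. all: by end_near. Qed.

Lemma cvg_cutoff x : strip L x -> cutoff n x @[n --> \oo] --> (1 : R).
Proof.
move=> [/andP[h1 h2] /andP[h3 h4]].
have c1 j : 0 < xcoord x j < L j -> cutoff1 j n x @[n --> \oo] --> (1:R).
  move=> /andP[g1 g2]; rewrite -[X in _ --> X](mulr1 (1 : R)); apply: cvgM.
    exact: cvg_bump0.
  have := @cvg_bump0 (L j - xcoord x j) (-1); rewrite subr_gt0 => /(_ g2).
  by apply: cvg_trans; apply: near_eq_cvg; near=> n; congr (bump 0 _); ring.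
rewrite -[X in _ --> X](mulr1 (1 : R)); apply: cvgM.
  by apply: c1; rewrite h1 h2.
by apply: c1; rewrite h3 h4.
Unshelve. all: by end_near. Qed.

(** The products of [f] with the cut-offs are test functions and converge to [f], dominated by [f].
    The weak divergence is known against test functions only, whereas the normal trace is tested
    with functions smooth up to the boundary. *)
Lemma smooth_closure_orth d f : L2 L d ->
  (forall phi, test L phi -> intO L (fun x => d x * phi x) = 0) ->
  smooth_closure L f -> intO L (fun x => d x * f x) = 0.
Proof.
move=> Ld d0 sf; have Lf := smooth_closure_L2 L_gt0 sf.
have mc : measurable (cell L : set (mpt R)) by exact: measurable_cell.
have ic := L2_integrableM Ld Lf.
have mdf : @measurable_fun _ _ (mpt R) _ (cell L) (fun x => d x * f x).
  by have /integrableP[/measurable_EFinP] := ic.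
have mcut n : @measurable_fun _ _ (mpt R) _ (cell L) (cutoff n).
  by apply: L2_measurable; apply: smooth_closure_L2 => //; exact: cutoff_smooth_closure.
have [|||||_ _] := @dominated_convergence _ _ R (leb3 R) (cell L) mc
  (fun n x => (d x * (f x * cutoff n x))%:E) (fun x => (d x * f x)%:E) (fun x => `|d x * f x|%:E).
- move=> n; apply/measurable_EFinP; under eq_fun do rewrite mulrA.
  exact: measurable_funM.
- exact/measurable_EFinP.
- apply: aeW => x /cell_strip sx; apply: cvg_EFin; first by near=> n.
  have C : d x * f x * cutoff n x @[n --> \oo] --> d x * f x * 1.
    by apply: cvgM; [exact: cvg_cst|exact: cvg_cutoff].
  rewrite mulr1 in C; apply: cvg_trans C.
  by apply: near_eq_cvg; near=> n; rewrite /= mulrA.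
- exact: integrable_abse ic.
- apply: aeW => x n _; rewrite /= lee_fin mulrA normrM ler_piMr//.
  by have /andP[? ?] := cutoff_bound n x; rewrite ger0_norm.
have E n : (\int[leb3 R]_(x in cell L) (d x * (f x * cutoff n x))%:E = 0)%E.
  have := d0 _ (cutoff_test n sf); rewrite /intO /Rintegral /= => H.
  rewrite -[LHS]fineK ?H//; apply: integrable_fin_num => //.
  have := L2_integrableM Ld (smooth_closure_L2 L_gt0 (cutoff_test n sf).1).
  by [].
under eq_fun do rewrite E.
move=> /cvg_lim h; rewrite /intO /Rintegral -h ?lim_cst//.
Unshelve. all: by end_near. Qed.

End Cutoff.

(** * The spaces H and D(A) on smooth fields *)

Section SolenoidalFields.
Context (R : realType) (L : 'I_3 -> R) (L_gt0 : forall i, 0 < L i).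
Implicit Types (u v w : vfield R) (phi : pt R -> R) (i j : 'I_3).

Definition grad phi : vfield R := fun x => \row_i partial i phi x.

Lemma integrable_pairing u v : L2v L u -> L2v L v -> forall i,
  (leb3 R).-integrable (cell L) (fun x => (u x 0 i * v x 0 i)%:E).
Proof. by move=> Lu Lv i; exact: (L2_integrableM (Lu i) (Lv i)). Qed.

Lemma L2v_grad phi : smooth_closure L phi -> L2v L (grad phi).
Proof.
move=> sphi i; have := smooth_closure_L2 L_gt0 (smooth_closure_partial i sphi).
by congr L2; apply/funext => x; rewrite /component mxE.
Qed.

Lemma dotE u v : L2v L u -> L2v L v ->
  dot L u v = \sum_i intO L (fun x => u x 0 i * v x 0 i).
Proof.
move=> Lu Lv; rewrite /dot (@intO_sum _ _ _ _ (fun i x => u x 0 i * v x 0 i))//.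
exact: integrable_pairing.
Qed.

Lemma dot_gradE u phi : dot L u (grad phi) = intO L (fun x => \sum_i u x 0 i * partial i phi x).
Proof. by congr intO; apply/funext => x; apply: eq_bigr => i _; rewrite mxE. Qed.

Lemma L2vD u v : L2v L u -> L2v L v -> L2v L (u + v).
Proof.
move=> Lu Lv i; have := L2D (Lu i) (Lv i); congr L2; apply/funext => x.
by rewrite /component !fctE mxE.
Qed.

Lemma L2vZ c u : L2v L u -> L2v L (c *: u).
Proof.
move=> Lu i; have := L2Z c (Lu i); congr L2; apply/funext => x.
by rewrite /component !fctE mxE.
Qed.

Lemma dotC u v : dot L u v = dot L v u.
Proof. by congr intO; apply/funext => x; apply: eq_bigr => i _; rewrite mulrC. Qed.

Lemma dotDl u v w : L2v L u -> L2v L v -> L2v L w ->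
  dot L (u + v) w = dot L u w + dot L v w.
Proof.
move=> Lu Lv Lw; rewrite !dotE//; last exact: L2vD.
rewrite -big_split/=; apply: eq_bigr => i _; rewrite -intOD//.
- by congr intO; apply/funext => x; rewrite !fctE mxE mulrDl.
- exact: (integrable_pairing Lu Lw).
- exact: (integrable_pairing Lv Lw).
Qed.

Lemma dotZl c u w : L2v L u -> L2v L w -> dot L (c *: u) w = c * dot L u w.
Proof.
move=> Lu Lw; rewrite !dotE//; last exact: L2vZ.
rewrite big_distrr/=; apply: eq_bigr => i _; rewrite -intOZ//.
- by congr intO; apply/funext => x; rewrite !fctE mxE mulrA.
- exact: (integrable_pairing Lu Lw).
Qed.

Lemma test_partial phi : test L phi -> smooth_closure L phi. Proof. by case. Qed.

Lemma spaceHP u : spaceH L u <->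
  L2v L u /\ forall phi, smooth_closure L phi -> dot L u (grad phi) = 0.
Proof.
split.
  move=> [Lu [_ _ du] [d [_ Ld dd] nt]]; split => // phi sphi.
  (* The trace condition provides some weak divergence [d], zero only up to a.e. equality;
     comparison with the divergence 0 shows that it annihilates the test functions. *)
  have d0 : intO L (fun x => d x * phi x) = 0.
    apply: smooth_closure_orth => // psi tpsi; apply/eqP; rewrite -oppr_eq0 -dd//.
    rewrite du//; rewrite (_ : (fun x => 0 * psi x) = fun=> 0) ?intO_cst0 ?oppr0//.
    by apply/funext => x; rewrite mul0r.
  have := nt _ sphi; rewrite intOD.
  - by rewrite d0 addr0 -dot_gradE.
  - have Lg := L2v_grad sphi.
    apply: integrable_sum_cell => i.
    by have := integrable_pairing Lu Lg i; congr (_.-integrable _ _); apply/funext => x; rewrite mxE.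
  - exact: L2_integrableM (smooth_closure_L2 L_gt0 sphi).
move=> [Lu H].
have wd : weak_div L u (fun=> 0).
  split=> //; first by apply: smooth_closure_L2 => //; exact: smooth_closure_cst.
  move=> phi tphi; rewrite -dot_gradE H; last exact: test_partial.
  rewrite (_ : (fun x => 0 * phi x) = fun=> 0) ?intO_cst0 ?oppr0//.
  by apply/funext => x; rewrite mul0r.
split=> //; exists (fun=> 0) => // phi sphi.
by under eq_fun do rewrite mul0r addr0; rewrite -dot_gradE H.
Qed.

Lemma spaceH0 : spaceH L 0.
Proof.
have L0 : L2v L 0.
  move=> i; rewrite (_ : component _ _ = cst 0).
    by apply: smooth_closure_L2 => //; exact: smooth_closure_cst.
  by apply/funext => x; rewrite /component mxE.
apply/spaceHP; split=> // phi sphi.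
by rewrite -(scale0r 0) dotZl ?mul0r//; exact: L2v_grad.
Qed.

Lemma spaceHD u v : spaceH L u -> spaceH L v -> spaceH L (u + v).
Proof.
move=> /spaceHP[Lu Hu] /spaceHP[Lv Hv]; apply/spaceHP; split; first exact: L2vD.
move=> phi sphi; rewrite dotDl ?Hu ?Hv ?addr0//; exact: L2v_grad.
Qed.

Lemma spaceHZ c u : spaceH L u -> spaceH L (c *: u).
Proof.
move=> /spaceHP[Lu Hu]; apply/spaceHP; split; first exact: L2vZ.
move=> phi sphi; rewrite dotZl ?Hu ?mulr0//; exact: L2v_grad.
Qed.

Definition smooth_field u : Prop := forall i, smooth_closure L (component u i).

Definition div u : pt R -> R := fun x => \sum_i partial i (component u i) x.

Definition curl u : vfield R := fun x => \row_i
  (partial (i + 1) (component u (i + 2)) x - partial (i + 2) (component u (i + 1)) x).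

Definition impermeable u : Prop := smooth_field u /\
  forall i, i != 2 -> forall x, xcoord x i = 0 \/ xcoord x i = L i -> u x 0 i = 0.

Definition Lions_smooth u : Prop := impermeable u /\
  forall i j, i != 2 -> j != i -> forall x, xcoord x i = 0 \/ xcoord x i = L i ->
    curl u x 0 j = 0.

Lemma smooth_field_L2v u : smooth_field u -> L2v L u.
Proof. by move=> su i; exact: smooth_closure_L2. Qed.

Lemma impermeable_spaceH u : impermeable u -> div u = cst 0 -> spaceH L u.
Proof.
move=> [su nu] du; apply/spaceHP; split; first exact: smooth_field_L2v.
move=> phi sphi; rewrite dotE; [|exact: smooth_field_L2v|exact: L2v_grad].
have iL i : (leb3 R).-integrable (cell L) (EFin \o (fun x => partial i (component u i) x * phi x)).
  apply: L2_integrableM; apply: smooth_closure_L2 => //.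
  exact: smooth_closure_partial.
transitivity (\sum_i - intO L (fun x => partial i (component u i) x * phi x)).
  apply: eq_bigr => i _; under eq_fun do rewrite mxE.
  apply: (@intO_by_parts _ _ L_gt0 i (component u i)) => // i2; rewrite /no_flux (negbTE i2) => x.
  by split; rewrite /= [component _ _ _]nu ?mul0r// xcoord_line eqxx; [left|right].
rewrite sumrN -intO_sum//.
rewrite (_ : (fun x => _) = fun=> 0) ?intO_cst0 ?oppr0//.
by apply/funext => x; rewrite -big_distrl/= [X in X * _](_ : _ = div u x)// du mul0r.
Qed.

Lemma outward_normalE i b j : outward_normal R i b 0 j = (-1) ^+ (~~ b) * (i == j)%:R.
Proof. by rewrite /outward_normal; case: b; rewrite !mxE eqxx/= ?mul1r ?mulN1r eq_sym. Qed.

Lemma smooth_trace i b f : i != 2 -> smooth_closure L f ->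
  is_trace L i b f (fun y => f (face_pt L i b y)).
Proof.
move=> i2 sf; have cf : continuous (fun y => f (face_pt L i b y)).
  move=> y; apply: (continuous_comp (f := face_pt L i b)); last first.
    by apply: smooth_continuous; have [] := sf.
  move: i i2; case=> -[|[|[|//]]] ? i2; rewrite /face_pt /=; set s := (if b then _ else _).
  - apply: (cvg_pair (G := nbhs (s, y.1)) (H := nbhs y.2)); last exact: cvg_snd.
    by apply: (cvg_pair (G := nbhs s) (H := nbhs y.1)); [exact: cvg_cst|exact: cvg_fst].
  - apply: (cvg_pair (G := nbhs (y.1, s)) (H := nbhs y.2)); last exact: cvg_snd.
    by apply: (cvg_pair (G := nbhs y.1) (H := nbhs s)); [exact: cvg_fst|exact: cvg_cst].
  - by [].
split.
- exact: smooth_Sobolev.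
- apply: (@measurable_funTS _ _ (mpt2 R)); exact: continuous_measurable2.
- have -> : face_cell L i = `]0, (if i == 0 then L 1 else L 0)[ `*` `[0, 2 * L 2[.
    by apply/seteqP; split=> -[x y] /=; rewrite /face_cell/= !in_itv/=.
  apply: (continuous_integrable_rect true (f := fun y => f (face_pt L i b y) ^+ 2)).
  + by case: ifP.
  + by rewrite mulr_gt0.
  + by move=> y; under eq_fun do rewrite expr2; apply: cvgM; exact: cf.
- exists (fun j => partial j f), (fun=> f); split => //.
  + by move=> j; exact: smooth_weak_partial.
  + under eq_fun do under eq_integral do rewrite subrr expr0n/=.
    under eq_fun do rewrite integral0; exact: cvg_cst.
  + move=> j; under eq_fun do under eq_integral do rewrite subrr expr0n/=.
    under eq_fun do rewrite integral0; exact: cvg_cst.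
  + under eq_fun do under eq_integral do rewrite subrr expr0n/=.
    under eq_fun do rewrite integral0; exact: cvg_cst.
Qed.

Lemma smooth_field_curl u : smooth_field u -> smooth_field (curl u).
Proof.
move=> su i.
rewrite (_ : component _ _ = partial (i + 1) (component u (i + 2)) \+
  (fun x => -1 * partial (i + 2) (component u (i + 1)) x)).
  by apply: smooth_closureD; [|apply: smooth_closureZ]; exact: smooth_closure_partial.
by apply/funext => x; rewrite /component mxE/= mulN1r.
Qed.

Lemma xcoord_face i b y : i != 2 -> xcoord (face_pt L i b y) i = if b then L i else 0.
Proof. by move: i; case=> -[|[|[|//]]] ?. Qed.

Lemma Lions_smooth_domA u : Lions_smooth u -> div u = cst 0 -> domA L u.
Proof.
move=> [iu cu] du; have [su _] := iu; split.
- by move=> i; exact: smooth_Sobolev.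
- exact: impermeable_spaceH.
- exists (curl u).
    exists (fun j i => partial j (component u i)) => //.
    by move=> i j; exact: smooth_weak_partial.
  move=> i b i2; exists (fun j y => curl u (face_pt L i b y) 0 j).
    by move=> j; apply: smooth_trace => //; exact: smooth_field_curl.
  apply: aeW => y _ j; rewrite (bigD1 i)//= big1 ?addr0; last first.
    by move=> l li; rewrite outward_normalE eq_sym (negbTE li) mulr0 mul0r.
  rewrite !outward_normalE eqxx mulr1.
  have [<-|ij] := eqVneq i j.
    by rewrite mulr1 mulrAC -expr2 sqrr_sign mul1r subrr.
  rewrite (cu i)// 1?eq_sym// ?mulr0 ?subrr//.
  by rewrite xcoord_face//; case: (b); [right|left].
Qed.

Lemma is_PiW f w phi : smooth_closure L phi -> spaceH L w -> f = w + grad phi ->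
  is_Pi L f w.
Proof.
move=> sphi Hw ->; have /spaceHP[Lw _] := Hw; have Lg := L2v_grad sphi.
split => // ; first exact: L2vD.
by move=> h /spaceHP[Lh Hh]; rewrite addrAC subrr add0r dotC Hh.
Qed.

Definition adv u v : vfield R := fun x => \row_i \sum_j u x 0 j * partial j (component v i) x.

Lemma smooth_advection u v : smooth_field v -> is_advection L u v (adv u v).
Proof.
move=> sv; exists (fun j i => partial j (component v i)) => //.
by move=> i j; exact: smooth_weak_partial.
Qed.

Lemma is_BW u v w phi : smooth_field v -> smooth_closure L phi -> spaceH L w ->
  adv u v = w + grad phi -> is_B L u v w.
Proof.
move=> sv sphi Hw E; exists (adv u v); first exact: smooth_advection.
exact: is_PiW E.
Qed.

End SolenoidalFields.

(** * Products of functions of one variable *)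

Section TripleProducts.
Context (R : realType).

Lemma forall_ord3 (P : 'I_3 -> Prop) : P 0 -> P 1 -> P 2 -> forall i, P i.
Proof.
move=> P0 P1 P2; case=> -[|[|[|//]]] ?.
- by rewrite (_ : Ordinal _ = 0)//; exact: val_inj.
- by rewrite (_ : Ordinal _ = 1)//; exact: val_inj.
- by rewrite (_ : Ordinal _ = 2)//; exact: val_inj.
Qed.

Lemma sum_ord3 (F : 'I_3 -> R) : \sum_i F i = F 0 + F 1 + F 2.
Proof.
rewrite !big_ord_recl big_ord0 addr0 -addrA; congr (F _ + (F _ + F _)); exact: val_inj.
Qed.

Lemma row3E (a b c : R) : (row3 a b c 0 0 = a) * (row3 a b c 0 1 = b) * (row3 a b c 0 2 = c).
Proof. by rewrite !mxE. Qed.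

Definition prod3 (f g h : R -> R) : pt R -> R := fun x => f x.1.1 * g x.1.2 * h x.2.

Definition derives (f f' : R -> R) := forall t : R, is_derive t (1 : R) f (f' t).

Lemma partial0_prod3 f f' g h : derives f f' ->
  partial 0 (prod3 f g h) = prod3 f' g h.
Proof.
move=> df; apply/funext => x; rewrite /partial.
have H : is_derive x (evec R 0) (prod3 f g h) (prod3 f' g h x); last by case: H.
apply: is_derive_of_line; rewrite /prod3/=.
have := is_deriveZ (g x.1.2 * h x.2) (df x.1.1); apply: is_derive_congr.
  by move=> t; rewrite /line/= [LHS]mulrC -mulrA.
by rewrite [LHS]mulrC -mulrA.
Qed.

Lemma partial1_prod3 f g g' h : derives g g' ->
  partial 1 (prod3 f g h) = prod3 f g' h.
Proof.
move=> dg; apply/funext => x; rewrite /partial.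
have H : is_derive x (evec R 1) (prod3 f g h) (prod3 f g' h x); last by case: H.
apply: is_derive_of_line; rewrite /prod3/=.
have := is_deriveZ (f x.1.1 * h x.2) (dg x.1.2); apply: is_derive_congr.
  by move=> t; rewrite /line/= [LHS]mulrAC.
by rewrite [LHS]mulrAC.
Qed.

Lemma partial2_prod3 f g h h' : derives h h' ->
  partial 2 (prod3 f g h) = prod3 f g h'.
Proof.
move=> dh; apply/funext => x; rewrite /partial.
have H : is_derive x (evec R 2) (prod3 f g h) (prod3 f g h' x); last by case: H.
apply: is_derive_of_line; rewrite /prod3/=.
by have := is_deriveZ (f x.1.1 * g x.1.2) (dh x.2); exact: is_derive_congr.
Qed.

Lemma derives_affine_comp (f f' : R -> R) (a b : R) : derives f f' ->
  derives (fun t => f (a * t - b)) (fun t => a * f' (a * t - b)).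
Proof.
move=> df t.
have dl : is_derive t (1:R) (fun s : R => a * s - b) a.
  have := is_deriveD (is_deriveZ a (is_derive_id t (1:R))) (is_derive_cst (- b) t (1:R)).
  by apply: is_derive_congr => //; rewrite addr0 [LHS]mulr1.
have := is_derive1_comp (g := fun s : R => a * s - b) (df (a * t - b)) dl.
by apply: is_derive_congr => //; rewrite mulrC.
Qed.

Lemma derives_cos : derives (@cos R) (fun t => - sin t).
Proof. by move=> t; exact: is_derive_cos. Qed.

Lemma derives_sin : derives (@sin R) (@cos R).
Proof. by move=> t; exact: is_derive_sin. Qed.

Lemma derivesZ c (f f' : R -> R) : derives f f' ->
  derives (fun t => c * f t) (fun t => c * f' t).
Proof. by move=> df t; exact: is_deriveZ (df t). Qed.

Lemma smooth_cos (a b : R) j : smooth (fun x : pt R => cos (a * xcoord x j - b)).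
Proof.
pose q (h : R -> R) := exists c b, h = fun t => c * cos (a * t - b).
apply: (@smooth_xcoord R q _ (fun t => cos (a * t - b))); last first.
  by exists 1, b; apply/funext => t; rewrite mul1r.
move=> _ [c [s ->]]; exists (fun t => c * (a * - sin (a * t - s))).
  exists (c * a), (s - pi / 2); apply/funext => t.
  by rewrite opprB addrCA [pi / 2 + _]addrC cosDpihalf mulrA.
exact: derivesZ (derives_affine_comp _ _ derives_cos).
Qed.

Lemma smooth_sin (a b : R) j : smooth (fun x : pt R => sin (a * xcoord x j - b)).
Proof.
have := smooth_cos a (b + pi / 2) j; congr smooth; apply/funext => x.
by rewrite opprD addrA cosBpihalf.
Qed.

End TripleProducts.

(** * Modes and their advection *)

Section Modes.
Context (R : realType) (L : 'I_3 -> R) (L_gt0 : forall i, 0 < L i).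
Implicit Types (z w k n : pt R) (th : R).

(* The average over sign changes of the first two coordinates of the plane wave
   [z sin (k . x - th)]: the fields Y correspond to [th = 0] and the fields Z to
   [th = pi / 2], with [k] rescaled by [pi / L]. *)
Definition mode z k th : vfield R := fun x =>
  row3 (z.1.1 * sin (k.1.1 * x.1.1) * cos (k.1.2 * x.1.2) * cos (k.2 * x.2 - th))
       (z.1.2 * cos (k.1.1 * x.1.1) * sin (k.1.2 * x.1.2) * cos (k.2 * x.2 - th))
       (z.2 * cos (k.1.1 * x.1.1) * cos (k.1.2 * x.1.2) * sin (k.2 * x.2 - th)).

(** The pressure of a mode: its gradient is the mode whose amplitude is the frequency itself. *)
Definition potential k th : pt R -> R := fun x =>
  - cos (k.1.1 * x.1.1) * cos (k.1.2 * x.1.2) * cos (k.2 * x.2 - th).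

(** Integer multiples, because brackets subtract frequencies; reflections bring the indices back to
    natural numbers. *)
Definition frequency k : Prop :=
  forall i, exists m : int, xcoord k i = m%:~R * pi / L i.

Definition dot3 z w : R := z.1.1 * w.1.1 + z.1.2 * w.1.2 + z.2 * w.2.

Lemma vfieldP (u v : vfield R) :
  (forall x, [/\ u x 0 0 = v x 0 0, u x 0 1 = v x 0 1 & u x 0 2 = v x 0 2]) ->
  u = v.
Proof.
by move=> uv; apply/funext => x; apply/rowP; have [? ? ?] := uv x; apply: forall_ord3.
Qed.

Lemma derives_sinM (a : R) : derives (fun t => sin (a * t)) (fun t => a * cos (a * t)).
Proof.
move=> t; have := derives_affine_comp a 0 (@derives_sin R) t.
by apply: is_derive_congr => [s|]; rewrite ?subr0.
Qed.

Lemma derives_cosM (a : R) : derives (fun t => cos (a * t)) (fun t => a * - sin (a * t)).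
Proof.
move=> t; have := derives_affine_comp a 0 (@derives_cos R) t.
by apply: is_derive_congr => [s|]; rewrite ?subr0.
Qed.

Lemma component_mode z k th :
  (component (mode z k th) 0 = prod3 (fun t => z.1.1 * sin (k.1.1 * t))
    (fun t => cos (k.1.2 * t)) (fun t => cos (k.2 * t - th))) *
  (component (mode z k th) 1 = prod3 (fun t => z.1.2 * cos (k.1.1 * t))
    (fun t => sin (k.1.2 * t)) (fun t => cos (k.2 * t - th))) *
  (component (mode z k th) 2 = prod3 (fun t => z.2 * cos (k.1.1 * t))
    (fun t => cos (k.1.2 * t)) (fun t => sin (k.2 * t - th))).
Proof. by split; [split|]; apply/funext => x; rewrite /component mxE. Qed.

Lemma partial_mode z k th x :
  let S0 := sin (k.1.1 * x.1.1) in let C0 := cos (k.1.1 * x.1.1) in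
  let S1 := sin (k.1.2 * x.1.2) in let C1 := cos (k.1.2 * x.1.2) in
  let S2 := sin (k.2 * x.2 - th) in let C2 := cos (k.2 * x.2 - th) in
  (partial 0 (component (mode z k th) 0) x = z.1.1 * k.1.1 * C0 * C1 * C2) *
  (partial 1 (component (mode z k th) 0) x = - z.1.1 * k.1.2 * S0 * S1 * C2) *
  (partial 2 (component (mode z k th) 0) x = - z.1.1 * k.2 * S0 * C1 * S2) *
  (partial 0 (component (mode z k th) 1) x = - z.1.2 * k.1.1 * S0 * S1 * C2) *
  (partial 1 (component (mode z k th) 1) x = z.1.2 * k.1.2 * C0 * C1 * C2) *
  (partial 2 (component (mode z k th) 1) x = - z.1.2 * k.2 * C0 * S1 * S2) *
  (partial 0 (component (mode z k th) 2) x = - z.2 * k.1.1 * S0 * C1 * S2) *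
  (partial 1 (component (mode z k th) 2) x = - z.2 * k.1.2 * C0 * S1 * S2) *
  (partial 2 (component (mode z k th) 2) x = z.2 * k.2 * C0 * C1 * C2).
Proof.
rewrite /= !component_mode; repeat split.
- rewrite (partial0_prod3 _ _ (derivesZ _ (derives_sinM _))) /prod3; ring.
- rewrite (partial1_prod3 _ _ (derives_cosM _)) /prod3; ring.
- rewrite (partial2_prod3 _ _ (derives_affine_comp _ _ (@derives_cos R))) /prod3; ring.
- rewrite (partial0_prod3 _ _ (derivesZ _ (derives_cosM _))) /prod3; ring.
- rewrite (partial1_prod3 _ _ (derives_sinM _)) /prod3; ring.
- rewrite (partial2_prod3 _ _ (derives_affine_comp _ _ (@derives_cos R))) /prod3; ring.
- rewrite (partial0_prod3 _ _ (derivesZ _ (derives_cosM _))) /prod3; ring.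
- rewrite (partial1_prod3 _ _ (derives_cosM _)) /prod3; ring.
- rewrite (partial2_prod3 _ _ (derives_affine_comp _ _ (@derives_sin R))) /prod3; ring.
Qed.

Lemma derivesN (f f' : R -> R) : derives f f' -> derives (fun t => - f t) (fun t => - f' t).
Proof. by move=> df t; exact: is_deriveN (df t). Qed.

Lemma grad_potential k th : grad (potential k th) = mode k k th.
Proof.
apply: vfieldP => x; rewrite /grad /mode !row3E !mxE.
have -> : potential k th = prod3 (fun t => - cos (k.1.1 * t))
  (fun t => cos (k.1.2 * t)) (fun t => cos (k.2 * t - th)) by [].
split.
- rewrite (partial0_prod3 _ _ (derivesN (derives_cosM _))) /prod3; ring.
- rewrite (partial1_prod3 _ _ (derives_cosM _)) /prod3; ring.
- rewrite (partial2_prod3 _ _ (derives_affine_comp _ _ (@derives_cos R))) /prod3; ring.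
Qed.

Lemma frequencyD k n : frequency k -> frequency n -> frequency (k + n).
Proof.
move=> fk fn i; have [m km] := fk i; have [p np] := fn i; exists (m + p).
have -> : xcoord (k + n) i = xcoord k i + xcoord n i.
  by rewrite /xcoord; case: ifP => // _; case: ifP.
by rewrite km np intrD; ring.
Qed.

Lemma frequencyN k : frequency k -> frequency (- k).
Proof.
move=> fk i; have [m km] := fk i; exists (- m).
have -> : xcoord (- k) i = - xcoord k i.
  by rewrite /xcoord; case: ifP => // _; case: ifP.
by rewrite km intrN; ring.
Qed.

Lemma sin_intpi (m : int) : sin (m%:~R * pi) = 0 :> R.
Proof.
have H (n : nat) : sin (n%:R * pi) = 0 :> R.
  elim: n => [|n IH]; first by rewrite mul0r sin0.
  by rewrite -natr1 mulrDl mul1r sinDpi IH oppr0.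
by case: m => n; rewrite ?H// NegzE intrN mulNr sinN H oppr0.
Qed.

Lemma trig_add_int2pi (m : int) (y : R) :
  (cos (y + m%:~R * (2 * pi)) = cos y) * (sin (y + m%:~R * (2 * pi)) = sin y).
Proof.
have E (n : nat) (t : R) : (cos (t + n%:R * (2 * pi)) = cos t) * (sin (t + n%:R * (2 * pi)) = sin t).
  elim: n => [|n IH]; first by rewrite mul0r addr0.
  have -> : n.+1%:R * (2 * pi) = n%:R * (2 * pi) + pi *+ 2 :> R.
    by rewrite -natr1 mulrDl mul1r [2 * pi]mulr_natl.
  by rewrite addrA cosD2pi sinD2pi !IH.
case: m => n; first exact: E.
by rewrite NegzE intrN mulNr -(E n.+1 (_ - _)) subrK -[X in sin _ = sin X](subrK (n.+1%:R * (2 * pi))) E.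
Qed.

Lemma sin_frequency k i : frequency k -> sin (xcoord k i * L i) = 0.
Proof.
by move=> /(_ i)[m ->]; rewrite divfK ?gt_eqF// sin_intpi.
Qed.

Lemma trig_frequency k (t th : R) : frequency k ->
  (cos (k.2 * (t + 2 * L 2) - th) = cos (k.2 * t - th)) *
  (sin (k.2 * (t + 2 * L 2) - th) = sin (k.2 * t - th)).
Proof.
move=> /(_ 2)[m]; rewrite /xcoord/= => E.
have -> : k.2 * (t + 2 * L 2) - th = k.2 * t - th + m%:~R * (2 * pi).
  by rewrite E; field; rewrite gt_eqF.
exact: trig_add_int2pi.
Qed.

Lemma smooth_potential k th : frequency k -> smooth_closure L (potential k th).
Proof.
move=> fk; split; last by move=> x; rewrite /potential /shift3/= trig_frequency.
have := smoothM (smoothM (smooth_cos k.1.1 0 0) (smooth_cos k.1.2 0 1)) (smooth_cos k.2 th 2).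
move=> /(smoothM (smooth_cst (-1))); congr smooth; apply/funext => x.
by rewrite /potential /prod3 /xcoord/= !subr0 mulN1r !mulNr.
Qed.

Lemma smooth_mode z k th : frequency k -> smooth_field L (mode z k th).
Proof.
move=> fk; apply: forall_ord3; rewrite !component_mode.
- split; last by move=> x; rewrite /prod3 /shift3/= trig_frequency.
  have := smoothM (smoothM (smooth_sin k.1.1 0 0) (smooth_cos k.1.2 0 1)) (smooth_cos k.2 th 2).
  move=> /(smoothM (smooth_cst z.1.1)); congr smooth; apply/funext => x.
  by rewrite /prod3 /xcoord/= !subr0 !mulrA.
- split; last by move=> x; rewrite /prod3 /shift3/= trig_frequency.
  have := smoothM (smoothM (smooth_cos k.1.1 0 0) (smooth_sin k.1.2 0 1)) (smooth_cos k.2 th 2).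
  move=> /(smoothM (smooth_cst z.1.2)); congr smooth; apply/funext => x.
  by rewrite /prod3 /xcoord/= !subr0 !mulrA.
- split; last by move=> x; rewrite /prod3 /shift3/= trig_frequency.
  have := smoothM (smoothM (smooth_cos k.1.1 0 0) (smooth_cos k.1.2 0 1)) (smooth_sin k.2 th 2).
  move=> /(smoothM (smooth_cst z.2)); congr smooth; apply/funext => x.
  by rewrite /prod3 /xcoord/= !subr0 !mulrA.
Qed.

Lemma sin_face k i (x : pt R) : frequency k -> xcoord x i = 0 \/ xcoord x i = L i ->
  sin (xcoord k i * xcoord x i) = 0.
Proof. by move=> fk [] ->; [rewrite mulr0 sin0|exact: sin_frequency]. Qed.

Lemma curlE (u : vfield R) x :
  (curl u x 0 0 = partial 1 (component u 2) x - partial 2 (component u 1) x) *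
  (curl u x 0 1 = partial 2 (component u 0) x - partial 0 (component u 2) x) *
  (curl u x 0 2 = partial 0 (component u 1) x - partial 1 (component u 0) x).
Proof.
have e01 : (0 + 1 = 1 :> 'I_3)%R by apply: val_inj.
have e02 : (0 + 2 = 2 :> 'I_3)%R by apply: val_inj.
have e11 : (1 + 1 = 2 :> 'I_3)%R by apply: val_inj.
have e12 : (1 + 2 = 0 :> 'I_3)%R by apply: val_inj.
have e21 : (2 + 1 = 0 :> 'I_3)%R by apply: val_inj.
have e22 : (2 + 2 = 1 :> 'I_3)%R by apply: val_inj.
by rewrite /curl !mxE e01 e02 e11 e12 e21 e22.
Qed.

(** On a face orthogonal to the i-th axis, the normal component and both tangential components of
    the curl carry the factor sin (k_i x_i). *)
Lemma Lions_mode z k th : frequency k -> Lions_smooth L (mode z k th).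
Proof.
move=> fk; split; [split; first exact: smooth_mode|].
- apply: forall_ord3 => // _ x xi; have := sin_face fk xi; rewrite /xcoord/= => s0.
  + by rewrite /mode row3E s0 mulr0 !mul0r.
  + by rewrite /mode row3E s0 mulr0 !mul0r.
- apply: forall_ord3 => //; apply: forall_ord3 => // _ _ x xi;
    have := sin_face fk xi; rewrite /xcoord/= => s0;
    by rewrite curlE !partial_mode s0 !(mulr0, mul0r) subrr.
Qed.

Lemma div_mode z k th : dot3 z k = 0 -> div (mode z k th) = cst 0.
Proof.
move=> zk; apply/funext => x; rewrite /div sum_ord3 !partial_mode/=.
transitivity (dot3 z k * (cos (k.1.1 * x.1.1) * cos (k.1.2 * x.1.2) * cos (k.2 * x.2 - th))).
  by rewrite /dot3; ring.
by rewrite zk mul0r.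
Qed.

Lemma modeD z w k th : mode (z + w) k th = mode z k th + mode w k th.
Proof. by apply: vfieldP => x; rewrite !fctE !mxE/=; split; ring. Qed.

Lemma modeZ c z k th : mode (c *: z) k th = c *: mode z k th.
Proof. by apply: vfieldP => x; rewrite !fctE !mxE/=; split; rewrite /GRing.scale/=; ring. Qed.

Definition flip (s t : R) (v : pt R) : pt R := (s * v.1.1, t * v.1.2, v.2).

Definition adv_term z k th w n et s t : vfield R :=
  dot3 z (flip s t n) *: (mode (flip s t w) (k + flip s t n) (th + et) +
    mode (flip s t w) (k - flip s t n) (th - et)).

(** Each factor is an average over four reflections. Reflecting both factors together does not
    change the average, so only the four relative reflections of the second remain, each with weight
    1/4; the product formula for sin times cos contributes the other 1/2. *)
Lemma adv_mode z k th w n et :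
  adv (mode z k th) (mode w n et) = 8^-1 *:
    (adv_term z k th w n et 1 1 + adv_term z k th w n et 1 (-1) +
     adv_term z k th w n et (-1) 1 + adv_term z k th w n et (-1) (-1)).
Proof.
have F1 s (a b x : R) : (s = 1) \/ (s = -1) ->
  (cos ((a + s * b) * x) = cos (a * x) * cos (b * x) - s * (sin (a * x) * sin (b * x))) *
  (cos ((a - s * b) * x) = cos (a * x) * cos (b * x) + s * (sin (a * x) * sin (b * x))) *
  (sin ((a + s * b) * x) = sin (a * x) * cos (b * x) + s * (cos (a * x) * sin (b * x))) *
  (sin ((a - s * b) * x) = sin (a * x) * cos (b * x) - s * (cos (a * x) * sin (b * x))).
  case=> ->; rewrite !(mul1r, mulN1r) ?opprK !mulrDl !mulNr !(sinD, cosD) ?sinB ?cosB ?sinN ?cosN;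
    repeat split; ring.
have F2 (a b x : R) :
  (cos ((a + b) * x - (th + et)) = cos (a * x - th) * cos (b * x - et) - sin (a * x - th) * sin (b * x - et)) *
  (cos ((a - b) * x - (th - et)) = cos (a * x - th) * cos (b * x - et) + sin (a * x - th) * sin (b * x - et)) *
  (sin ((a + b) * x - (th + et)) = sin (a * x - th) * cos (b * x - et) + cos (a * x - th) * sin (b * x - et)) *
  (sin ((a - b) * x - (th - et)) = sin (a * x - th) * cos (b * x - et) - cos (a * x - th) * sin (b * x - et)).
  have -> : (a + b) * x - (th + et) = (a * x - th) + (b * x - et) by ring.
  have -> : (a - b) * x - (th - et) = (a * x - th) - (b * x - et) by ring.
  by move: (a * x - th) (b * x - et) => p q; rewrite cosD sinD cosB sinB.
have F1p a b x := F1 _ a b x (or_introl erefl).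
have F1n a b x := F1 _ a b x (or_intror erefl).
apply: vfieldP => x; rewrite /adv /adv_term !fctE !mxE /= !sum_ord3 !partial_mode /mode !row3E /= !F2 !F1p !F1n /dot3/flip/GRing.scale/=.
move: (sin (k.1.1 * _)) (cos (k.1.1 * _)) (sin (k.1.2 * _)) (cos (k.1.2 * _)) => S0 C0 S1 C1.
move: (sin (k.2 * _ - _)) (cos (k.2 * _ - _)) => S2 C2.
move: (sin (n.1.1 * _)) (cos (n.1.1 * _)) (sin (n.1.2 * _)) (cos (n.1.2 * _)) => s0 c0 s1 c1.
move: (sin (n.2 * _ - _)) (cos (n.2 * _ - _)) => s2 c2.
rewrite !mul1r !mulN1r.
split.
- by field.
- by field.
- by field.
Qed.

End Modes.

(** * Linearity of the differential operators *)

Section Linearity.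
Context (R : realType) (L : 'I_3 -> R) (L_gt0 : forall i, 0 < L i).
Implicit Types (u v w : vfield R) (c : R).

Lemma componentD u v i : component (u + v) i = component u i \+ component v i.
Proof. by apply/funext => x; rewrite /component !fctE mxE. Qed.

Lemma componentZ c u i : component (c *: u) i = cst c \* component u i.
Proof. by apply/funext => x; rewrite /component !fctE mxE. Qed.

Lemma smooth_fieldD u v : smooth_field L u -> smooth_field L v -> smooth_field L (u + v).
Proof. by move=> su sv i; rewrite componentD; exact: smooth_closureD. Qed.

Lemma smooth_fieldZ c u : smooth_field L u -> smooth_field L (c *: u).
Proof. by move=> su i; rewrite componentZ; apply: smooth_closureM => //; exact: smooth_closure_cst. Qed.

Lemma smooth_field_derivable u i j x : smooth_field L u ->
  derivable (component u i) x (evec R j).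
Proof. by move=> /(_ i)[su _]; exact: smooth_derivable. Qed.

Lemma partial_componentD u v i j : smooth_field L u -> smooth_field L v ->
  partial j (component (u + v) i) = partial j (component u i) \+ partial j (component v i).
Proof. by move=> su sv; rewrite componentD partialD// => x; exact: smooth_field_derivable. Qed.

Lemma partial_componentZ c u i j : smooth_field L u ->
  partial j (component (c *: u) i) = fun x => c * partial j (component u i) x.
Proof.
move=> su; rewrite componentZ partialM.
- by rewrite partial_cst; apply/funext => x; rewrite /= mulr0 addr0.
- by move=> x; exact: derivable_cst.
- by move=> x; exact: smooth_field_derivable.
Qed.

Lemma divD u v : smooth_field L u -> smooth_field L v -> div (u + v) = div u \+ div v.
Proof.
move=> su sv; apply/funext => x; rewrite /div/= -big_split; apply: eq_bigr => i _.
by rewrite partial_componentD.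
Qed.

Lemma divZ c u : smooth_field L u -> div (c *: u) = fun x => c * div u x.
Proof.
move=> su; apply/funext => x; rewrite /div/= big_distrr; apply: eq_bigr => i _.
by rewrite partial_componentZ.
Qed.

Lemma curlD u v : smooth_field L u -> smooth_field L v -> curl (u + v) = curl u + curl v.
Proof.
move=> su sv; apply/funext => x; apply/rowP => i.
by rewrite /curl !fctE !mxE !partial_componentD//=; ring.
Qed.

Lemma curlZ c u : smooth_field L u -> curl (c *: u) = c *: curl u.
Proof.
move=> su; apply/funext => x; apply/rowP => i.
by rewrite /curl !fctE !mxE !partial_componentZ// mulrBr.
Qed.

Lemma advZl c u w : adv (c *: u) w = c *: adv u w.
Proof.
apply/funext => x; apply/rowP => i; rewrite /adv !fctE !mxE big_distrr/=.
by apply: eq_bigr => j _; rewrite mxE mulrA.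
Qed.

Lemma advZr c u w : smooth_field L w -> adv u (c *: w) = c *: adv u w.
Proof.
move=> sw; apply/funext => x; apply/rowP => i; rewrite /adv !fctE !mxE big_distrr/=.
by apply: eq_bigr => j _; rewrite partial_componentZ// mulrCA.
Qed.

(** Stands in for [domA] as the ambient space of the saturation: its stability under sums is
    pointwise calculus, with no addition of weak derivatives or traces. [GL_mono] transfers the
    result to [domA]. *)
Definition stokes_smooth u := Lions_smooth L u /\ div u = cst 0.

Lemma stokes_smoothD u v : stokes_smooth u -> stokes_smooth v -> stokes_smooth (u + v).
Proof.
move=> [[[su nu] cu] du] [[[sv nv] cv] dv]; split; last first.
  by rewrite divD// du dv; apply/funext => x /=; rewrite addr0.
split; first (split; first exact: smooth_fieldD).
  by move=> i i2 x xi; rewrite !fctE mxE (nu i) ?(nv i) ?addr0.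
by move=> i j i2 ij x xi; rewrite curlD// !fctE mxE (cu i) ?(cv i) ?addr0.
Qed.

Lemma stokes_smoothZ c u : stokes_smooth u -> stokes_smooth (c *: u).
Proof.
move=> [[[su nu] cu] du]; split; last first.
  by rewrite divZ// du; apply/funext => x /=; rewrite mulr0.
split; first (split; first exact: smooth_fieldZ).
  by move=> i i2 x xi; rewrite !fctE mxE (nu i) ?mulr0.
by move=> i j i2 ij x xi; rewrite curlZ// !fctE mxE (cu i) ?mulr0.
Qed.

Lemma stokes_smooth0 : stokes_smooth 0.
Proof.
rewrite -(scale0r (mode 0 0 0)); apply: stokes_smoothZ; split.
  apply: Lions_mode => // i; exists 0; rewrite !mul0r /xcoord.
  by case: ifP => // _; case: ifP.
by apply: div_mode; rewrite /dot3/= !mul0r !addr0.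
Qed.

Lemma stokes_smooth_domA u : stokes_smooth u -> domA L u.
Proof. by move=> [? ?]; exact: Lions_smooth_domA. Qed.

Lemma stokes_smooth_spaceH u : stokes_smooth u -> spaceH L u.
Proof. by move=> [[? _] ?]; exact: impermeable_spaceH. Qed.

Lemma gradD p q : smooth_closure L p -> smooth_closure L q ->
  grad (p \+ q) = grad p + grad q.
Proof.
move=> [sp _] [sq _]; apply/funext => x; apply/rowP => i; rewrite /grad !fctE !mxE.
by rewrite partialD// => y; exact: smooth_derivable.
Qed.

Lemma gradZ c p : smooth_closure L p -> grad (fun x => c * p x) = c *: grad p.
Proof.
move=> [sp _]; apply/funext => x; apply/rowP => i; rewrite /grad !fctE !mxE.
rewrite (partialM (f := cst c)).
- by rewrite partial_cst/= mulr0 addr0.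
- by move=> y; exact: derivable_cst.
- by move=> y; exact: smooth_derivable.
Qed.

End Linearity.

(** * Helmholtz decomposition of sums of modes *)

Section ModeSums.
Context (R : realType) (L : 'I_3 -> R) (L_gt0 : forall i, 0 < L i).
Implicit Types (z w k n p : pt R) (th : R).

(* For [p = 0] the division yields [0] and [proj v 0 = v], as it should: constant
   modes are divergence free. *)
Definition proj (v p : pt R) : pt R := v - (dot3 v p / dot3 p p) *: p.

Lemma dot3_eq0 p : (dot3 p p == 0) = (p == 0).
Proof.
case: p => -[a b] c; rewrite /dot3/= -!expr2.
rewrite !paddr_eq0 ?addr_ge0 ?sqr_ge0// !sqrf_eq0.
by apply/andP/eqP => [[/andP[/eqP -> /eqP ->] /eqP ->]//|[-> -> ->]]; rewrite !eqxx.
Qed.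

Lemma dot3_proj v p : dot3 (proj v p) p = 0.
Proof.
have E : dot3 (proj v p) p = dot3 v p - dot3 v p / dot3 p p * dot3 p p.
  by rewrite /proj /dot3/= /GRing.scale/=; ring.
have [p0|p0] := eqVneq (dot3 p p) 0; last by rewrite E divfK// subrr.
move/eqP: p0; rewrite dot3_eq0 => /eqP ->; rewrite /dot3/=; ring.
Qed.

(** The entries are coefficient, amplitude, frequency and phase. Explicit lists make the projection
    of a bracket a termwise operation. *)
Definition mode_sum (s : seq (R * pt R * pt R * R)) : vfield R :=
  \sum_(t <- s) t.1.1.1 *: mode t.1.1.2 t.1.2 t.2.

Definition proj_sum (s : seq (R * pt R * pt R * R)) : vfield R :=
  \sum_(t <- s) t.1.1.1 *: mode (proj t.1.1.2 t.1.2) t.1.2 t.2.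

(** On a concrete list the fold computes to a plain conjunction. *)
Definition frequencies (s : seq (R * pt R * pt R * R)) : Prop :=
  foldr (fun t P => frequency L t.1.2 /\ P) True s.

Lemma stokes_smooth_mode z k th : frequency L k -> dot3 z k = 0 ->
  stokes_smooth L (mode z k th).
Proof. by move=> fk zk; split; [exact: Lions_mode|exact: div_mode]. Qed.

Lemma stokes_smooth_proj_sum s : frequencies s -> stokes_smooth L (proj_sum s).
Proof.
rewrite /proj_sum; elim: s => [_|t s IH [ft /IH fs]]; first by rewrite big_nil; exact: stokes_smooth0.
rewrite big_cons; apply: stokes_smoothD => //.
by apply: stokes_smoothZ; apply: stokes_smooth_mode => //; exact: dot3_proj.
Qed.

Lemma mode_helmholtz v p th :
  mode v p th = mode (proj v p) p th + (dot3 v p / dot3 p p) *: grad (potential p th).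
Proof. by rewrite grad_potential -modeZ -modeD /proj subrK. Qed.

Lemma mode_sum_helmholtz s : frequencies s ->
  exists2 q, smooth_closure L q & mode_sum s = proj_sum s + grad q.
Proof.
rewrite /mode_sum /proj_sum; elim: s => [_|t s IH [ft /IH[q sq E]]].
  exists (fun x => 0 * potential 0 0 x).
    apply: smooth_closureZ; apply: smooth_potential => // i; exists 0.
    by rewrite !mul0r /xcoord; case: ifP => // _; case: ifP.
  rewrite !big_nil (@gradZ _ L) ?scale0r ?addr0//.
  apply: smooth_potential => // i; exists 0.
  by rewrite !mul0r /xcoord; case: ifP => // _; case: ifP.
pose c := t.1.1.1 * (dot3 t.1.1.2 t.1.2 / dot3 t.1.2 t.1.2).
have sc : smooth_closure L (fun x => c * potential t.1.2 t.2 x).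
  by apply: smooth_closureZ; exact: smooth_potential.
exists ((fun x => c * potential t.1.2 t.2 x) \+ q); first exact: smooth_closureD.
rewrite !big_cons E (@gradD _ L)// (@gradZ _ L); last exact: smooth_potential.
by rewrite mode_helmholtz scalerDr scalerA -/c addrACA.
Qed.

(** Ensures that B is defined with values in H for every pair of modes, in particular for the
    self-interactions B(a, a) and B(b, b) that [FL] asks for. *)
Lemma adv_mode_helmholtz z k th w n et : frequency L k -> frequency L n ->
  exists b q, [/\ spaceH L b, smooth_closure L q &
    adv (mode z k th) (mode w n et) = b + grad q].
Proof.
move=> fk fn.
have ff s t : (s = 1) \/ (s = -1) -> (t = 1) \/ (t = -1) -> frequency L (flip s t n).
  move=> s1 t1 i; have [m] := fn i; move: i; apply: forall_ord3; rewrite /xcoord/=.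
  - by case: s1 => -> E; [exists m|exists (- m)]; rewrite E ?intrN; ring.
  - by case: t1 => -> E; [exists m|exists (- m)]; rewrite E ?intrN; ring.
  - by move=> E; exists m.
pose T s t := [:: (8^-1 * dot3 z (flip s t n), flip s t w, (k + flip s t n : pt R), th + et);
  (8^-1 * dot3 z (flip s t n), flip s t w, (k - flip s t n : pt R), th - et)].
pose s := T 1 1 ++ T 1 (-1) ++ T (-1) 1 ++ T (-1) (-1).
have fs : frequencies s.
  have l1 : (1 : R) = 1 \/ (1 : R) = -1 by left.
  have l2 : (-1 : R) = 1 \/ (-1 : R) = -1 by right.
  have fD a b : frequency L a -> frequency L b -> frequency L (a - b).
    by move=> fa fb; apply: frequencyD => //; exact: frequencyN.
  by rewrite /s /T /frequencies/=; repeat split; (apply: fD || apply: frequencyD) => //; apply: ff; assumption.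
have [q sq E] := mode_sum_helmholtz fs.
exists (proj_sum s), q; split => //.
  by apply: stokes_smooth_spaceH => //; exact: stokes_smooth_proj_sum.
rewrite -E /mode_sum /s /T !big_cat !big_cons !big_nil /= !addr0 adv_mode /adv_term.
by rewrite !scalerDr !scalerA !addrA.
Qed.

End ModeSums.

(** * Linear spans and the increasing spaces of the saturation *)

Section Spans.
Context (R : realType).
Implicit Types (S T U E C : set (vfield R)) (f g : vfield R).

Lemma lin_span_sub S : S `<=` lin_span S.
Proof.
move=> f Sf; exists 1%N, (fun=> 1), (fun=> f); split => //.
by rewrite big_ord1 scale1r.
Qed.

Lemma lin_span_mono S T : S `<=` T -> lin_span S `<=` lin_span T.
Proof. by move=> ST _ [n [c [g [Sg ->]]]]; exists n, c, g; split => // i; exact: ST. Qed.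

Lemma lin_span0 S : lin_span S 0.
Proof.
exists 0%N, (fun=> 0), (fun=> 0); split; first by case.
by rewrite big_ord0.
Qed.

Lemma lin_spanD S f g : lin_span S f -> lin_span S g -> lin_span S (f + g).
Proof.
move=> [n [c [h [Sh ->]]]] [n' [c' [h' [Sh' ->]]]].
exists (n + n')%N, (fun i => match fintype.split i with inl a => c a | inr b => c' b end),
  (fun i => match fintype.split i with inl a => h a | inr b => h' b end).
split; first by move=> i; case: fintype.split.
rewrite big_split_ord /=; congr (_ + _); apply: eq_bigr => i _.
  by rewrite (unsplitK (inl i : 'I_n + 'I_n')).
by rewrite (unsplitK (inr i : 'I_n + 'I_n')).
Qed.

Lemma lin_spanZ S a f : lin_span S f -> lin_span S (a *: f).
Proof.
move=> [n [c [h [Sh ->]]]]; exists n, (fun i => a * c i), h; split => //.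
by rewrite scaler_sumr; apply: eq_bigr => i _; rewrite scalerA.
Qed.

Definition is_subspace S :=
  [/\ S 0, forall f g, S f -> S g -> S (f + g) & forall a f, S f -> S (a *: f)].

Lemma lin_span_subspace S : is_subspace (lin_span S).
Proof. by split; [exact: lin_span0|move=> *; exact: lin_spanD|move=> *; exact: lin_spanZ]. Qed.

Lemma lin_span_min S T : is_subspace T -> S `<=` T -> lin_span S `<=` T.
Proof.
move=> [T0 TD TZ] ST _ [n [c [g [Sg ->]]]].
by elim/big_ind: _ => // i _; apply: TZ; exact: ST.
Qed.

Context (L : 'I_3 -> R).

Lemma FL_subspace U C E : is_subspace U -> is_subspace E -> is_subspace (FL L U C E).
Proof.
move=> [U0 UD UZ] [E0 ED EZ]; split.
- exists 0, 0; split; [exact: E0|exact: lin_span0|exact: U0|].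
  by rewrite addr0.
- move=> _ _ [e [s [Ee ss Us ->]]] [e' [s' [Ee' ss' Us' ->]]].
  exists (e + e'), (s + s'); split; [exact: ED|exact: lin_spanD|exact: UD|].
  by rewrite addrACA.
- move=> a _ [e [s [Ee ss Us ->]]]; exists (a *: e), (a *: s).
  split; [exact: EZ|exact: lin_spanZ|exact: UZ|].
  by rewrite scalerDr.
Qed.

Lemma GL_subspace U C j : is_subspace U -> is_subspace (GL L U C j).
Proof.
by move=> sU; elim: j => [|j IH]; [exact: lin_span_subspace|exact: FL_subspace].
Qed.

Lemma GL_incr U C j k : is_subspace U -> (j <= k)%N -> GL L U C j `<=` GL L U C k.
Proof.
move=> [U0 _ _] /subnK <-; elim: (k - j)%N => [|m IH] //=.
apply: (subset_trans IH) => f Gf; exists f, 0; split => //; last by rewrite addr0.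
exact: lin_span0.
Qed.

Lemma GL_mono U U' C j : U `<=` U' -> GL L U C j `<=` GL L U' C j.
Proof.
move=> UU'; elim: j => [|j IH] //= _ [e [s [Ee ss Us ->]]].
exists e, s; split; [exact: IH| |exact: UU'|by []].
apply: lin_span_mono ss => w [a [b [Ca Eb ? ? ?]]]; exists a, b; split => //.
exact: IH.
Qed.

Lemma bigcup_GL_subspace U C : is_subspace U -> is_subspace (\bigcup_j GL L U C j).
Proof.
move=> sU; have G j := GL_subspace C j sU; split.
- by exists 0%N => //; have [] := G 0%N.
- move=> f g [j _ Gf] [k _ Gg]; exists (maxn j k) => //.
  have [_ GD _] := G (maxn j k).
  by apply: GD; [apply: GL_incr Gf|apply: GL_incr Gg]; rewrite ?leq_maxl ?leq_maxr.
- by move=> a f [j _ Gf]; exists j => //; have [_ _] := G j; apply.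
Qed.

Lemma GL_symB U C a b w : is_subspace U -> C a -> (\bigcup_j GL L U C j) b ->
  (exists2 z, is_B L a a z & spaceH L z) -> (exists2 z, is_B L b b z & spaceH L z) ->
  is_symB L a b w -> U w -> (\bigcup_j GL L U C j) w.
Proof.
move=> sU Ca [j _ Gb] Ba Bb Bw Uw; exists j.+1 => //=; exists 0, w; split => //.
- by have [] := GL_subspace C j sU.
- by apply: lin_span_sub; exists a, b.
- by rewrite add0r.
Qed.

End Spans.

(** * The saturation is stable under brackets with generators *)

Section Bracket.
Context (R : realType) (L : 'I_3 -> R) (L_gt0 : forall i, 0 < L i).
Context (C : set (vfield R)).
Implicit Types (a b k p z : pt R) (s : seq (R * pt R * pt R * R)).

Definition saturation := \bigcup_j GL L (stokes_smooth L) C j.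

Lemma stokes_smooth_subspace : is_subspace (stokes_smooth L).
Proof.
by split; [exact: stokes_smooth0|move=> *; exact: stokes_smoothD|move=> *; exact: stokes_smoothZ].
Qed.

Lemma saturation_subspace : is_subspace saturation.
Proof. exact/bigcup_GL_subspace/stokes_smooth_subspace. Qed.

Lemma is_symB_mode al ka th be kb et s c :
  frequency L ka -> frequency L kb -> frequencies L s ->
  adv (mode (c *: al) ka th) (mode be kb et) + adv (mode be kb et) (mode (c *: al) ka th)
    = c *: mode_sum s ->
  is_symB L (mode (c *: al) ka th) (mode be kb et) (c *: proj_sum s).
Proof.
move=> fa fb fs E.
set u := mode (c *: al) ka th in E *; set v := mode be kb et in E *.
have su : smooth_field L u by exact: smooth_mode.
have sv : smooth_field L v by exact: smooth_mode.
have [w1 [q1 [Hw1 sq1 E1]]] := adv_mode_helmholtz L_gt0 (c *: al) th be et fa fb.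
have [q sq Es] := mode_sum_helmholtz L_gt0 fs.
(* Only the symmetrized advection has the short list [s]. One projection is taken from the Helmholtz
   decomposition of [adv u v], and the other is what is missing to the projection of the sum. *)
exists w1, (c *: proj_sum s - w1); split.
- exact: (@is_BW _ _ L_gt0 _ _ _ q1).
- apply: (@is_BW _ _ L_gt0 _ _ _ ((fun x => c * q x) \+ (fun x => -1 * q1 x))) => //.
  + by apply: smooth_closureD; exact: smooth_closureZ.
  + rewrite -scaleN1r; apply: spaceHD => //; apply: spaceHZ => //.
    by apply: stokes_smooth_spaceH => //; exact: stokes_smooth_proj_sum.
  + rewrite (@gradD _ L) ?(@gradZ _ L)//; try exact: smooth_closureZ.
    have -> : adv v u = c *: mode_sum s - adv u v by rewrite -E addrAC subrr add0r.
    by rewrite Es scalerDr E1 scaleN1r opprD addrACA.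
- by rewrite addrC subrK.
Qed.

(** The projected bracket is again a smooth field of the ambient space, so the intersection with U
    in [FL] loses nothing; the factor [c] is divided out at the end. *)
Lemma saturation_bracket al ka th be kb et s c :
  c != 0 -> frequency L ka -> frequency L kb -> frequencies L s ->
  C (mode (c *: al) ka th) -> saturation (mode be kb et) ->
  adv (mode al ka th) (mode be kb et) + adv (mode be kb et) (mode al ka th) = mode_sum s ->
  saturation (proj_sum s).
Proof.
move=> c0 fa fb fs Ca Gb E; have [_ _ GZ] := saturation_subspace.
suff : saturation (c *: proj_sum s).
  by move=> /(GZ c^-1); rewrite scalerA mulVf// scale1r.
have ex be' kb' et' : frequency L kb' ->
    exists2 z, is_B L (mode be' kb' et') (mode be' kb' et') z & spaceH L z.
  move=> fb'; have [w1 [q1 [Hw1 sq1 E1]]] := adv_mode_helmholtz L_gt0 be' et' be' et' fb' fb'.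
  by exists w1 => //; apply: (@is_BW _ _ L_gt0 _ _ _ q1) => //; exact: smooth_mode.
apply: (GL_symB stokes_smooth_subspace Ca Gb).
- exact: ex.
- exact: ex.
- apply: is_symB_mode => //; rewrite modeZ advZl (advZr _ _ (smooth_mode L_gt0 _ _ fa)).
  by rewrite -scalerDr E.
- by apply: stokes_smoothZ; exact: stokes_smooth_proj_sum.
Qed.

End Bracket.

(** * Explicit brackets with shears and with plane modes *)

Section Brackets.
Context (R : realType).
Implicit Types (al a be k : pt R).

Definition symadv (u v : vfield R) := adv u v + adv v u.

Lemma mode_sum_cons c v p th s :
  @mode_sum R ((c, v, p, th) :: s) = c *: mode v p th + mode_sum s.
Proof. by rewrite /mode_sum big_cons. Qed.

Lemma mode_sum_nil : @mode_sum R [::] = 0.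
Proof. exact: big_nil. Qed.

Lemma trigD_scaled (a b x : R) :
  (cos ((a + b) * x) = cos (a * x) * cos (b * x) - sin (a * x) * sin (b * x)) *
  (cos ((a - b) * x) = cos (a * x) * cos (b * x) + sin (a * x) * sin (b * x)) *
  (sin ((a + b) * x) = sin (a * x) * cos (b * x) + cos (a * x) * sin (b * x)) *
  (sin ((a - b) * x) = sin (a * x) * cos (b * x) - cos (a * x) * sin (b * x)).
Proof. by rewrite mulrDl mulrBl cosD sinD cosB sinB. Qed.

Lemma trigD_phase (a b x th et : R) :
  (cos ((a + b) * x - (th + et)) = cos (a * x - th) * cos (b * x - et) - sin (a * x - th) * sin (b * x - et)) *
  (cos ((a - b) * x - (th - et)) = cos (a * x - th) * cos (b * x - et) + sin (a * x - th) * sin (b * x - et)) *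
  (sin ((a + b) * x - (th + et)) = sin (a * x - th) * cos (b * x - et) + cos (a * x - th) * sin (b * x - et)) *
  (sin ((a - b) * x - (th - et)) = sin (a * x - th) * cos (b * x - et) - cos (a * x - th) * sin (b * x - et)).
Proof.
have -> : (a + b) * x - (th + et) = (a * x - th) + (b * x - et) by ring.
have -> : (a - b) * x - (th - et) = (a * x - th) - (b * x - et) by ring.
by move: (a * x - th) (b * x - et) => p q; rewrite cosD sinD cosB sinB.
Qed.

Lemma trig_quarter (y et : R) :
  (cos (y - (et - pi / 2)) = - sin (y - et)) * (sin (y - (et - pi / 2)) = cos (y - et)).
Proof. by rewrite opprB addrCA [pi / 2 + _]addrC cosDpihalf sinDpihalf. Qed.

(* The shear flow (0, 0, cos (ka x_1)). *)
Lemma symadv_shear0 (ka : R) be k et :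
  symadv (mode (0, 0, -1) (ka, 0, 0) (pi / 2)) (mode be k et) = mode_sum
   [:: (2^-1, (k.2 * be.1.1, k.2 * be.1.2, k.2 * be.2 + ka * be.1.1),
        (k.1.1 + ka, k.1.2, k.2), et - pi / 2);
       (2^-1, (k.2 * be.1.1, k.2 * be.1.2, k.2 * be.2 - ka * be.1.1),
        (k.1.1 - ka, k.1.2, k.2), et - pi / 2)].
Proof.
rewrite !mode_sum_cons mode_sum_nil addr0 /symadv.
apply: vfieldP => x; rewrite /adv !fctE !mxE /= !sum_ord3 !partial_mode /mode !row3E /=.
rewrite !trig_quarter !trigD_scaled !mulNr !mul0r !sub0r !sinN !cosN cos_pihalf sin_pihalf sin0 cos0 ?sinN ?cosN.
move: (sin (k.1.1 * _)) (cos (k.1.1 * _)) (sin (k.1.2 * _)) (cos (k.1.2 * _)) => S0 C0 S1 C1.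
move: (sin (k.2 * _ - _)) (cos (k.2 * _ - _)) (sin (ka * _)) (cos (ka * _)) => S2 C2 s c.
split.
by field.
by field.
by field.
Qed.

Lemma symadv_shear1 (ka : R) be k et :
  symadv (mode (0, 0, -1) (0, ka, 0) (pi / 2)) (mode be k et) = mode_sum
   [:: (2^-1, (k.2 * be.1.1, k.2 * be.1.2, k.2 * be.2 + ka * be.1.2),
        (k.1.1, k.1.2 + ka, k.2), et - pi / 2);
       (2^-1, (k.2 * be.1.1, k.2 * be.1.2, k.2 * be.2 - ka * be.1.2),
        (k.1.1, k.1.2 - ka, k.2), et - pi / 2)].
Proof.
rewrite !mode_sum_cons mode_sum_nil addr0 /symadv.
apply: vfieldP => x; rewrite /adv !fctE !mxE /= !sum_ord3 !partial_mode /mode !row3E /=.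
rewrite !trig_quarter !trigD_scaled !mulNr !mul0r !sub0r !sinN !cosN cos_pihalf sin_pihalf sin0 cos0 ?sinN ?cosN.
move: (sin (k.1.1 * _)) (cos (k.1.1 * _)) (sin (k.1.2 * _)) (cos (k.1.2 * _)) => S0 C0 S1 C1.
move: (sin (k.2 * _ - _)) (cos (k.2 * _ - _)) (sin (ka * _)) (cos (ka * _)) => S2 C2 s c.
split.
by field.
by field.
by field.
Qed.

(** The generator does not depend on x_2, so reflections in this coordinate give nothing new: the
    terms of [adv_mode] pair up and the weight 1/8 becomes 1/4. *)
Lemma symadv_plane0 (p q r s th : R) be k et :
  symadv (mode (p, 0, q) (r, 0, s) th) (mode be k et) = mode_sum
   [:: (4^-1, (p * k.1.1 + q * k.2) *: be + (r * be.1.1 + s * be.2) *: (p, 0, q),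
        (k.1.1 + r, k.1.2, k.2 + s), et + th);
       (4^-1, (- p * k.1.1 + q * k.2) *: be + (- r * be.1.1 + s * be.2) *: (- p, 0, q),
        (k.1.1 - r, k.1.2, k.2 + s), et + th);
       (4^-1, - (p * k.1.1 + q * k.2) *: be + (r * be.1.1 + s * be.2) *: (p, 0, q),
        (k.1.1 - r, k.1.2, k.2 - s), et - th);
       (4^-1, - (- p * k.1.1 + q * k.2) *: be + (- r * be.1.1 + s * be.2) *: (- p, 0, q),
        (k.1.1 + r, k.1.2, k.2 - s), et - th)].
Proof.
rewrite !mode_sum_cons mode_sum_nil addr0 /symadv.
apply: vfieldP => x; rewrite /adv !fctE !mxE /= !sum_ord3 !partial_mode /mode !row3E /=.
rewrite /GRing.scale/= !trigD_phase !trigD_scaled !mulNr !mul0r -!opprD sin0 cos0 !sinN !cosN.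
move: (sin (k.1.1 * _)) (cos (k.1.1 * _)) (sin (k.1.2 * _)) (cos (k.1.2 * _)) => S0 C0 S1 C1.
move: (sin (k.2 * _ - _)) (cos (k.2 * _ - _)) => S2 C2.
move: (sin (r * _)) (cos (r * _)) (sin (s * _ - _)) (cos (s * _ - _)) => s0 c0 s2 c2.
split.
by field.
by field.
by field.
Qed.

End Brackets.

(* All that the generation of modes uses of the saturation; unlike the bracket
   on H, it is visibly invariant under the exchange of the first two
   coordinates. *)
Definition bracket_closed (R : realType) (L : 'I_3 -> R)
    (gen : pt R -> pt R -> R -> Prop) (G : set (vfield R)) :=
  [/\ is_subspace G, forall z k th, gen z k th -> G (mode z k th) &
    forall al ka th be kb et s, gen al ka th ->
      frequency L ka -> frequency L kb -> frequencies L s -> G (mode be kb et) ->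
      symadv (mode al ka th) (mode be kb et) = mode_sum s -> G (proj_sum s)].

(** * Generation of modes on the levels l > 0 *)

Section Generation.
Context (R : realType) (L : 'I_3 -> R) (L_gt0 : forall i, 0 < L i).
Context (gen : pt R -> pt R -> R -> Prop) (G : set (vfield R)).
Context (bG : bracket_closed L gen G).
Implicit Types (z k p be al : pt R) (th et c : R) (m n l : nat).
Local Notation ka0 := (pi / L 0).
Local Notation ka1 := (pi / L 1).
Local Notation ka2 := (pi / L 2).

Definition wn (m n l : nat) : pt R := (m%:R * ka0, n%:R * ka1, l%:R * ka2).

Hypothesis gen_shear : forall m n, (m <= 2)%N -> (n <= 2)%N ->
  gen (0, 0, -1) (wn m n 0) (pi / 2).
Hypothesis gen_plane0 : forall l th, (0 < l <= 2)%N -> th = 0 \/ th = pi / 2 ->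
  gen (l%:R * ka2, 0, - ka0) (wn 1 0 l) th.

Lemma ka_gt0 i : 0 < pi / L i.
Proof. by rewrite divr_gt0 ?pi_gt0. Qed.

Lemma frequency_wn m n l : frequency L (wn m n l).
Proof.
by apply: forall_ord3; [exists m|exists n|exists l]; rewrite /wn /xcoord/= mulrA.
Qed.

Lemma wn_succ0 m n l : (wn m.+1 n l).1.1 = m%:R * ka0 + ka0.
Proof. by rewrite /wn/= -natr1 mulrDl mul1r. Qed.

Lemma wn_succ1 m n l : (wn m n.+1 l).1.2 = n%:R * ka1 + ka1.
Proof. by rewrite /wn/= -natr1 mulrDl mul1r. Qed.

Lemma G_D u v : G u -> G v -> G (u + v).
Proof. by have [[_ + _] _ _] := bG; exact. Qed.

Lemma G_Z c u : G u -> G (c *: u).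
Proof. by have [[_ _ +] _ _] := bG; exact. Qed.

Lemma G_0 : G 0.
Proof. by have [[]] := bG. Qed.

Lemma G_unZ c u : c != 0 -> G (c *: u) -> G u.
Proof. by move=> c0 /(G_Z c^-1); rewrite scalerA mulVf// scale1r. Qed.

Lemma G_addl u v : G (u + v) -> G v -> G u.
Proof. by move=> uv /(G_Z (-1)) /(G_D uv); rewrite scaleN1r addrK. Qed.

Lemma G_addr u v : G (u + v) -> G u -> G v.
Proof. by rewrite addrC; exact: G_addl. Qed.

Lemma G_gen z k th : gen z k th -> G (mode z k th).
Proof. by have [_ + _] := bG; exact. Qed.

Lemma G_bracket al ka th be kb et s :
  gen al ka th -> frequency L ka -> frequency L kb -> frequencies L s ->
  G (mode be kb et) -> symadv (mode al ka th) (mode be kb et) = mode_sum s ->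
  G (proj_sum s).
Proof. by have [_ _] := bG; exact. Qed.

Lemma proj_sum_cons c v p th s :
  @proj_sum R ((c, v, p, th) :: s) = c *: mode (proj v p) p th + proj_sum s.
Proof. by rewrite /proj_sum big_cons. Qed.

Lemma proj_sum_nil : @proj_sum R [::] = 0.
Proof. exact: big_nil. Qed.

Lemma proj_id (z p : pt R) : dot3 z p = 0 -> proj z p = z.
Proof. by move=> zp; rewrite /proj zp mul0r scale0r subr0. Qed.

Lemma proj_add (z p : pt R) c : dot3 z p = 0 -> proj (z + c *: p) p = z.
Proof.
move=> zp; have E : dot3 (z + c *: p) p = c * dot3 p p.
  by rewrite -[RHS]add0r -zp /dot3/= /GRing.scale/=; ring.
rewrite /proj E; have [/eqP|p0] := eqVneq (dot3 p p) 0; last by rewrite mulfK// addrK.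
by rewrite dot3_eq0 => /eqP ->; rewrite !scaler0 addr0 subr0.
Qed.

Lemma dot3_gt0 (p : pt R) : p != 0 -> 0 < dot3 p p.
Proof.
move=> p0; rewrite lt0r dot3_eq0 p0 /dot3 -!expr2 !addr_ge0 ?sqr_ge0//.
Qed.

Lemma pt_eq (x y : pt R) : x.1.1 = y.1.1 -> x.1.2 = y.1.2 -> x.2 = y.2 -> x = y.
Proof. by case: x => -[? ?] ?; case: y => -[? ?] ? /= -> -> ->. Qed.

Lemma mode_rot z k th et : mode z k (th + et) =
  cos et *: mode z k th + sin et *: mode z k (th + pi / 2).
Proof.
have E y : (cos (y - (th + et)) = cos et * cos (y - th) + sin et * sin (y - th)) *
   (sin (y - (th + et)) = cos et * sin (y - th) - sin et * cos (y - th)) *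
   (cos (y - (th + pi / 2)) = sin (y - th)) * (sin (y - (th + pi / 2)) = - cos (y - th)).
  rewrite !opprD !addrA cosBpihalf sinBpihalf.
  move: (y - th) => t; rewrite cosB sinB.
  by repeat split; ring.
apply: vfieldP => x; rewrite !fctE !mxE/= !E; by split; ring.
Qed.

(** Two phases a quarter turn apart span all phases, so a Y and a Z field of the same amplitude
    yield every phase. *)
Lemma G_rot z k th et : G (mode z k th) -> G (mode z k (th + pi / 2)) -> G (mode z k (th + et)).
Proof. by move=> G1 G2; rewrite mode_rot; apply: G_D; exact: G_Z. Qed.

Definition full m n l := forall z th, dot3 z (wn m n l) = 0 -> G (mode z (wn m n l) th).

Lemma wn2_neq0 m n l : (wn m n l.+1).2 != 0.
Proof. by rewrite /wn/= gt_eqF// mulr_gt0 ?ltr0n// ka_gt0. Qed.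

(** A vertical frequency forces a horizontal amplitude, which is multiplied by sin 0: these modes
    are zero. They serve as the starting value of recursions of step two. *)
Lemma full00 l : full 0 0 l.+1.
Proof.
move=> z th zk; rewrite (_ : mode _ _ _ = 0); first exact: G_0.
have z2 : z.2 = 0.
  move: zk; rewrite /dot3 /wn/= !mul0r !mulr0 !add0r => /eqP.
  by rewrite mulf_eq0 (negbTE (wn2_neq0 0 0 l)) orbF => /eqP.
by apply: vfieldP => x; rewrite !mxE/= !mul0r sin0 z2 !(mulr0, mul0r).
Qed.

Lemma frequency_shift0 k s : frequency L k -> s = ka0 \/ s = - ka0 ->
  frequency L (k.1.1 + s, k.1.2, k.2).
Proof.
move=> fk sE; have f1 := frequency_wn 1 0 0.
have -> : (k.1.1 + s, k.1.2, k.2) = k + (s, 0, 0) by apply: pt_eq; rewrite //= addr0.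
apply: frequencyD => //; case: sE => ->.
  by move: f1; rewrite /wn !mul0r mul1r.
by move/frequencyN: f1; rewrite /wn !mul0r mul1r; congr frequency; apply: pt_eq; rewrite //= oppr0.
Qed.

Lemma G_shear0 k be th : frequency L k -> G (mode be k (th + pi / 2)) ->
  G (mode (proj (k.2 * be.1.1, k.2 * be.1.2, k.2 * be.2 + ka0 * be.1.1)
       (k.1.1 + ka0, k.1.2, k.2)) (k.1.1 + ka0, k.1.2, k.2) th +
     mode (proj (k.2 * be.1.1, k.2 * be.1.2, k.2 * be.2 - ka0 * be.1.1)
       (k.1.1 - ka0, k.1.2, k.2)) (k.1.1 - ka0, k.1.2, k.2) th).
Proof.
move=> fk Gb.
have := G_bracket (gen_shear (m := 1) (n := 0) isT isT) (frequency_wn 1 0 0) fk _ Gb.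
rewrite /wn !mul0r mul1r symadv_shear0 addrK => /(_ _ _ erefl) H.
have fp := frequency_shift0 fk (or_introl erefl).
have fm := frequency_shift0 fk (or_intror erefl).
have {}H := H (conj fp (conj fm I)).
move: H; rewrite !proj_sum_cons proj_sum_nil addr0 -scalerDr.
by apply: G_unZ; rewrite invr_eq0 pnatr_eq0.
Qed.

Lemma frequency_shift1 k s : frequency L k -> s = ka1 \/ s = - ka1 ->
  frequency L (k.1.1, k.1.2 + s, k.2).
Proof.
move=> fk sE; have f1 := frequency_wn 0 1 0.
have -> : (k.1.1, k.1.2 + s, k.2) = k + (0, s, 0) by apply: pt_eq; rewrite //= addr0.
apply: frequencyD => //; case: sE => ->.
  by move: f1; rewrite /wn !mul0r mul1r.
by move/frequencyN: f1; rewrite /wn !mul0r mul1r; congr frequency; apply: pt_eq; rewrite //= oppr0.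
Qed.

Lemma G_shear1 k be th : frequency L k -> G (mode be k (th + pi / 2)) ->
  G (mode (proj (k.2 * be.1.1, k.2 * be.1.2, k.2 * be.2 + ka1 * be.1.2)
       (k.1.1, k.1.2 + ka1, k.2)) (k.1.1, k.1.2 + ka1, k.2) th +
     mode (proj (k.2 * be.1.1, k.2 * be.1.2, k.2 * be.2 - ka1 * be.1.2)
       (k.1.1, k.1.2 - ka1, k.2)) (k.1.1, k.1.2 - ka1, k.2) th).
Proof.
move=> fk Gb.
have := G_bracket (gen_shear (m := 0) (n := 1) isT isT) (frequency_wn 0 1 0) fk _ Gb.
rewrite /wn !mul0r mul1r symadv_shear1 addrK => /(_ _ _ erefl) H.
have fp := frequency_shift1 fk (or_introl erefl).
have fm := frequency_shift1 fk (or_intror erefl).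
have {}H := H (conj fp (conj fm I)).
move: H; rewrite !proj_sum_cons proj_sum_nil addr0 -scalerDr.
by apply: G_unZ; rewrite invr_eq0 pnatr_eq0.
Qed.

(* Modulo [p], bracketing with a shear maps [k^perp] onto [p^perp]; this fails
   for |k| = |ka|. *)
Lemma shear0_onto z k ka : let p : pt R := (k.1.1 + ka, k.1.2, k.2) in
  ka != 0 -> k.2 != 0 -> ka ^+ 2 != dot3 k k -> dot3 z p = 0 ->
  exists2 be, dot3 be k = 0 & exists c,
    (k.2 * be.1.1, k.2 * be.1.2, k.2 * be.2 + ka * be.1.1) = z + c *: p.
Proof.
case: k => -[x y] w; case: z => -[z0 z1] z2; rewrite /dot3/= => kz w0 D0 zp.
set P := (x + ka) ^+ 2 + y ^+ 2 + w ^+ 2.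
have P0 : P != 0.
  rewrite /P gt_eqF// ltr_wpDl ?addr_ge0 ?sqr_ge0// lt0r sqr_ge0 sqrf_eq0 w0//.
set D := x * x + y * y + w * w - ka ^+ 2.
have {}D0 : D != 0 by rewrite /D subr_eq0 eq_sym.
(* Here [t] is to be the value of ka * be.1.1. Since k = p - (ka, 0, 0), orthogonality of [be] to
   [k] reads c P = 2 w t; inserted in the definition of [t], this gives w t (P - 2 ka (x + ka)) = ka
   z0 P, where the parenthesis equals [D]. *)
pose t := ka * z0 * P / (w * D); pose c := 2 * w * t / P.
have b0 : ka * (w^-1 * (z0 + c * (x + ka))) = t.
  rewrite /c /t; clear c t; have DE : P = D + 2 * ka * (x + ka) by rewrite /P /D; ring.
  move: P0; rewrite DE; clearbody D => P0; field.
  by rewrite w0 D0 P0.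
exists (w^-1 * (z0 + c * (x + ka)), w^-1 * (z1 + c * y), w^-1 * (z2 - t + c * w)) => /=.
  transitivity (w^-1 * ((z0 * (x + ka) + z1 * y + z2 * w) + c * P - t * w) -
    ka * (w^-1 * (z0 + c * (x + ka)))); first by rewrite /P; ring.
  by rewrite b0 zp /c; field; rewrite P0 w0.
exists c; rewrite b0; congr (_, _, _); rewrite mulVKf//.
by rewrite addrAC subrK.
Qed.

Lemma shear1_onto z k ka : let p : pt R := (k.1.1, k.1.2 + ka, k.2) in
  ka != 0 -> k.2 != 0 -> ka ^+ 2 != dot3 k k -> dot3 z p = 0 ->
  exists2 be, dot3 be k = 0 & exists c,
    (k.2 * be.1.1, k.2 * be.1.2, k.2 * be.2 + ka * be.1.2) = z + c *: p.
Proof.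
move=> /= kz k2 D0 zp.
have [||be bk [c E]] := @shear0_onto (z.1.2, z.1.1, z.2) (k.1.2, k.1.1, k.2) ka kz k2.
- by apply: contraNneq D0 => ->; rewrite /dot3/= [X in X + _ == _]addrC.
- by rewrite -zp /dot3/=; ring.
exists (be.1.2, be.1.1, be.2); first by rewrite -bk /dot3/=; ring.
by exists c; case: E => E0 E1 E2; apply: pt_eq.
Qed.

(** The shear sends index m+1 to both m+2 and m, and the latter is known. The exceptional case |k| =
    ka of [shear0_onto] is excluded by k_1 >= ka together with k_3 <> 0. *)
Lemma full_shear0 m n l : full m n l.+1 -> full m.+1 n l.+1 -> full m.+2 n l.+1.
Proof.
move=> F0 F1 z th; set k := wn m.+1 n l.+1.
have Ep : wn m.+2 n l.+1 = (k.1.1 + ka0, k.1.2, k.2).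
  by apply: pt_eq; rewrite // wn_succ0.
have Ek : (k.1.1 - ka0, k.1.2, k.2) = wn m n l.+1.
  by apply: pt_eq; rewrite // wn_succ0 addrK.
have k2 : k.2 != 0 by exact: wn2_neq0.
have k1 : ka0 <= k.1.1 by rewrite wn_succ0 lerDr mulr_ge0// ltW// ka_gt0.
rewrite Ep => zp.
have [|be bk [c Ec]] := shear0_onto (lt0r_neq0 (ka_gt0 0)) k2 _ zp.
  have h : ka0 ^+ 2 <= k.1.1 ^+ 2.
    by rewrite ler_sqr ?nnegrE ?(le_trans _ k1) ?(ltW (ka_gt0 _)).
  rewrite lt_eqF// /dot3 -!expr2 -addrA (le_lt_trans h)// ltrDl.
  by rewrite ltr_wpDl ?sqr_ge0// lt0r sqr_ge0 sqrf_eq0 k2.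
have Gb := F1 be (th + pi / 2) bk.
have H := G_shear0 (frequency_wn m.+1 n l.+1) Gb.
move: H; rewrite -/k Ec -Ep Ek => H.
have Gp := G_addl H (F0 _ _ (dot3_proj _ _)).
by move: Gp; rewrite proj_add ?Ep.
Qed.

Lemma full_shear1 m n l : full m n l.+1 -> full m n.+1 l.+1 -> full m n.+2 l.+1.
Proof.
move=> F0 F1 z th; set k := wn m n.+1 l.+1.
have Ep : wn m n.+2 l.+1 = (k.1.1, k.1.2 + ka1, k.2).
  by apply: pt_eq; rewrite // wn_succ1.
have Ek : (k.1.1, k.1.2 - ka1, k.2) = wn m n l.+1.
  by apply: pt_eq; rewrite // wn_succ1 addrK.
have k2 : k.2 != 0 by exact: wn2_neq0.
have k1 : ka1 <= k.1.2 by rewrite wn_succ1 lerDr mulr_ge0// ltW// ka_gt0.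
rewrite Ep => zp.
have [|be bk [c Ec]] := shear1_onto (lt0r_neq0 (ka_gt0 1)) k2 _ zp.
  have h : ka1 ^+ 2 <= k.1.2 ^+ 2.
    by rewrite ler_sqr ?nnegrE ?(le_trans _ k1) ?(ltW (ka_gt0 _)).
  rewrite lt_eqF// /dot3 -!expr2 [X in X + _]addrC -addrA (le_lt_trans h)// ltrDl.
  by rewrite ltr_wpDl ?sqr_ge0// lt0r sqr_ge0 sqrf_eq0 k2.
have Gb := F1 be (th + pi / 2) bk.
have H := G_shear1 (frequency_wn m n.+1 l.+1) Gb.
move: H; rewrite -/k Ec -Ep Ek => H.
have Gp := G_addl H (F0 _ _ (dot3_proj _ _)).
by move: Gp; rewrite proj_add ?Ep.
Qed.

Lemma mode_flip1 z k th :
  mode (z.1.1, - z.1.2, z.2) (k.1.1, - k.1.2, k.2) th = mode z k th.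
Proof. by apply: vfieldP => x; rewrite !mxE/= !mulNr sinN cosN; split; ring. Qed.

Lemma mode_flip0 z k th :
  mode (- z.1.1, z.1.2, z.2) (- k.1.1, k.1.2, k.2) th = mode z k th.
Proof. by apply: vfieldP => x; rewrite !mxE/= !mulNr sinN cosN; split; ring. Qed.

Lemma mode_flip2 z k th :
  mode (z.1.1, z.1.2, - z.2) (k.1.1, k.1.2, - k.2) (- th) = mode z k th.
Proof.
apply: vfieldP => x; rewrite !mxE/= (_ : - k.2 * x.2 - - th = - (k.2 * x.2 - th)); last by ring.
by rewrite cosN sinN; split; ring.
Qed.

(** From (1, 0, l) the shear in x_2 reaches two mirror frequencies carrying the same mode, so the
    bracket is twice that mode. The shear in x_1 acts likewise on (0, 1, l), and the two amplitudes
    obtained span the plane orthogonal to [p]. *)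
Lemma full11 l : full 1 0 l.+1 -> full 0 1 l.+1 -> full 1 1 l.+1.
Proof.
move=> F10 F01; set w := (wn 1 1 l.+1).2.
have w0 : w != 0 by exact: wn2_neq0.
set p := wn 1 1 l.+1.
have p0 : p.1.1 = ka0 by rewrite /p/= mul1r.
have p1 : p.1.2 = ka1 by rewrite /p/= mul1r.
have p2 : p.2 = w by [].
have h1 th : G (mode (w ^+ 2, 0, - (w * ka0)) p th).
  have bk : dot3 (w, 0, - ka0) (wn 1 0 l.+1) = 0.
    by rewrite /dot3 /w /wn/=; ring.
  have := G_shear1 (frequency_wn 1 0 l.+1) (F10 _ (th + pi / 2) bk).
  have -> : ((wn 1 0 l.+1).1.1, (wn 1 0 l.+1).1.2 + ka1, (wn 1 0 l.+1).2) = p.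
    by apply: pt_eq => //=; rewrite mul0r add0r mul1r.
  have -> : ((wn 1 0 l.+1).1.1, (wn 1 0 l.+1).1.2 - ka1, (wn 1 0 l.+1).2) =
     (p.1.1, - p.1.2, p.2) by apply: pt_eq => //=; rewrite mul0r add0r mul1r.
  rewrite (_ : (wn 1 0 l.+1).2 = w)//.
  set V : pt R := (w ^+ 2, 0, - (w * ka0)).
  rewrite (_ : (_, _, _ + _) = V); last by apply: pt_eq; rewrite /V/=; ring.
  rewrite (_ : (_, _, w * _ - _) = V); last by apply: pt_eq; rewrite /V/=; ring.
  rewrite proj_id; last by rewrite /dot3 p0 p1 p2 /V/=; ring.
  rewrite proj_id; last first.
    by transitivity (V.1.1 * p.1.1 + V.1.2 * - p.1.2 + V.2 * p.2) => //; rewrite p0 p1 p2 /V/=; ring.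
  rewrite -(mode_flip1 V p) (_ : (V.1.1, - V.1.2, V.2) = V); last by apply: pt_eq; rewrite /V//= oppr0.
  by rewrite -mulr2n -scaler_nat; apply: G_unZ; rewrite pnatr_eq0.
have h2 th : G (mode (0, w ^+ 2, - (w * ka1)) p th).
  have bk : dot3 (0, w, - ka1) (wn 0 1 l.+1) = 0.
    by rewrite /dot3 /w /wn/=; ring.
  have := G_shear0 (frequency_wn 0 1 l.+1) (F01 _ (th + pi / 2) bk).
  have -> : ((wn 0 1 l.+1).1.1 + ka0, (wn 0 1 l.+1).1.2, (wn 0 1 l.+1).2) = p.
    by apply: pt_eq => //=; rewrite mul0r add0r mul1r.
  have -> : ((wn 0 1 l.+1).1.1 - ka0, (wn 0 1 l.+1).1.2, (wn 0 1 l.+1).2) =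
     (- p.1.1, p.1.2, p.2) by apply: pt_eq => //=; rewrite mul0r add0r mul1r.
  rewrite (_ : (wn 0 1 l.+1).2 = w)//.
  set V : pt R := (0, w ^+ 2, - (w * ka1)).
  rewrite (_ : (_, _, _ + _) = V); last by apply: pt_eq; rewrite /V/=; ring.
  rewrite (_ : (_, _, w * _ - _) = V); last by apply: pt_eq; rewrite /V/=; ring.
  rewrite proj_id; last by rewrite /dot3 p0 p1 p2 /V/=; ring.
  rewrite proj_id; last first.
    by transitivity (V.1.1 * - p.1.1 + V.1.2 * p.1.2 + V.2 * p.2) => //; rewrite p0 p1 p2 /V/=; ring.
  rewrite -(mode_flip0 V p) (_ : (- V.1.1, V.1.2, V.2) = V); last by apply: pt_eq; rewrite /V//= oppr0.
  by rewrite -mulr2n -scaler_nat; apply: G_unZ; rewrite pnatr_eq0.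
move=> z th zp.
have -> : z = (z.1.1 / w ^+ 2) *: (w ^+ 2, 0, - (w * ka0)) + (z.1.2 / w ^+ 2) *: (0, w ^+ 2, - (w * ka1)).
  apply: pt_eq; rewrite /= /GRing.scale/=; first by field.
    by field.
  have -> : z.2 = - (z.1.1 * ka0 + z.1.2 * ka1) / w.
    apply: (mulIf w0); rewrite divfK//; apply/eqP; rewrite -addr_eq0 -zp /dot3 p0 p1 -/w.
    by apply/eqP; ring.
  by field; apply/and3P; split; [rewrite gt_eqF|exact: w0|rewrite gt_eqF].
by rewrite modeD !modeZ; apply: G_D; apply: G_Z.
Qed.

Lemma full_level l : full 1 0 l.+1 -> full 0 1 l.+1 -> forall m n, full m n l.+1.
Proof.
move=> F10 F01 m n.
have two_step (P : nat -> Prop) : P 0%N -> P 1%N -> (forall i, P i -> P i.+1 -> P i.+2) ->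
    forall i, P i.
  move=> P0 P1 PS i; suff : P i /\ P i.+1 by case.
  by elim: i => // i [? ?]; split => //; exact: PS.
have r0 : forall i, full i 0 l.+1.
  by apply: two_step => // [|i]; [exact: full00|exact: full_shear0].
have r1 : forall i, full i 1 l.+1.
  by apply: two_step => // [|i]; [exact: full11|exact: full_shear0].
by apply: (two_step (fun j => full m j l.+1)) => // j; exact: full_shear1.
Qed.

Lemma frequency_plane0 k s t : frequency L k -> s = ka0 \/ s = - ka0 ->
  t = ka2 \/ t = - ka2 -> frequency L (k.1.1 + s, k.1.2, k.2 + t).
Proof.
move=> fk sE tE; have := frequency_shift0 fk sE => f1.
have f2 := frequency_wn 0 0 1.
have -> : (k.1.1 + s, k.1.2, k.2 + t) = (k.1.1 + s, k.1.2, k.2) + (0, 0, t).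
  by apply: pt_eq; rewrite //= addr0.
apply: frequencyD => //; case: tE => ->.
  by move: f2; rewrite /wn !mul0r mul1r.
by move/frequencyN: f2; rewrite /wn !mul0r mul1r; congr frequency; apply: pt_eq; rewrite //= oppr0.
Qed.

Lemma G_plane0 k be th : frequency L k -> G (mode be k th) ->
  let V s t := (s * ka2 * k.1.1 - ka0 * k.2) *: be
    + (s * ka0 * be.1.1 + ka2 * be.2) *: (t * ka2, 0, - ka0) in
  let W s t := - (s * ka2 * k.1.1 - ka0 * k.2) *: be
    + (s * ka0 * be.1.1 + ka2 * be.2) *: (t * ka2, 0, - ka0) in
  let U s t : pt R := (k.1.1 + s * ka0, k.1.2, k.2 + t * ka2) in
  G ((mode (proj (V 1 1) (U 1 1)) (U 1 1) th + mode (proj (V (-1) (-1)) (U (-1) 1)) (U (-1) 1) th) +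
     (mode (proj (W 1 1) (U (-1) (-1))) (U (-1) (-1)) th +
      mode (proj (W (-1) (-1)) (U 1 (-1))) (U 1 (-1)) th)).
Proof.
move=> fk Gb V W U.
have := G_bracket (gen_plane0 (l := 1) isT (or_introl erefl)) (frequency_wn 1 0 1) fk _ Gb.
rewrite /wn !mul0r !mul1r symadv_plane0 addr0 subr0 => /(_ _ _ erefl) H.
have f s t : s = ka0 \/ s = - ka0 -> t = ka2 \/ t = - ka2 ->
  frequency L (k.1.1 + s, k.1.2, k.2 + t) by exact: frequency_plane0.
have {}H : G (proj_sum _) := H (conj (f _ _ (or_introl erefl) (or_introl erefl))
  (conj (f _ _ (or_intror erefl) (or_introl erefl))
  (conj (f _ _ (or_intror erefl) (or_intror erefl))
  (conj (f _ _ (or_introl erefl) (or_intror erefl)) I)))).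
move: H; rewrite !proj_sum_cons proj_sum_nil addr0 -!scalerDr addrA.
rewrite /V /W /U !mulN1r !mul1r !mulNr.
by apply: G_unZ; rewrite invr_eq0 pnatr_eq0.
Qed.

(** The frequency rotated by a quarter turn in the plane of x_1 and x_3. *)
Definition perp0 k : pt R := (k.2, 0, - k.1.1).

Lemma mode_proj_plane0 (V p : pt R) th : V.1.2 = 0 -> p.1.2 = 0 -> p.2 != 0 ->
  mode (proj V p) p th =
  ((V.1.1 * p.2 - V.2 * p.1.1) / dot3 p p) *: mode (perp0 p) p th.
Proof.
move=> V1 p1 p2; rewrite -modeZ; congr mode.
have P0 : p.1.1 * p.1.1 + p.2 * p.2 != 0.
  by rewrite gt_eqF// ltr_wpDl -?expr2 ?sqr_ge0// lt0r sqr_ge0 sqrf_eq0 p2.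
have E : dot3 p p = p.1.1 * p.1.1 + p.2 * p.2 by rewrite /dot3 p1 mulr0 addr0.
have E2 : dot3 V p = V.1.1 * p.1.1 + V.2 * p.2 by rewrite /dot3 p1 mulr0 addr0.
move: E E2 P0 p1 p2; rewrite /proj; case: (p) => -[a b] c /=.
case: V V1 => -[u v] w /= -> -> -> P0 -> p2.
apply: pt_eq => /=; rewrite /GRing.scale/=; first by field.
  by rewrite !mulr0 subrr.
by field.
Qed.

(** For k_2 = 0 the second component of the amplitude is multiplied by sin 0, so the divergence-free
    modes of a given phase form a line. *)
Lemma mode_perp0 z k th : k.1.2 = 0 -> k.2 != 0 -> dot3 z k = 0 ->
  mode z k th = (z.1.1 / k.2) *: mode (perp0 k) k th.
Proof.
case: z => -[z0 z1] z2; case: k => -[k0 k1] k2; rewrite /dot3 /perp0/= => -> k20 zk.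
have -> : z2 = - (z0 / k2) * k0.
  apply: (mulIf k20); move/eqP: zk; rewrite mulr0 addr0.
  by rewrite addrC addr_eq0 => /eqP ->; rewrite mulNr mulNr mulrAC divfK.
by apply: vfieldP => x; rewrite !fctE !mxE/= mul0r sin0 /GRing.scale/=; split; field.
Qed.

Lemma full_perp0 m l : (forall th, G (mode (perp0 (wn m 0 l.+1)) (wn m 0 l.+1) th)) ->
  full m 0 l.+1.
Proof.
move=> H z th zp; rewrite mode_perp0 ?wn2_neq0//; first exact/G_Z/H.
by rewrite /wn/= mul0r.
Qed.

Lemma dot3_wn_gt0 m n l : 0 < dot3 (wn m n l.+1) (wn m n l.+1).
Proof. by apply: dot3_gt0; apply: contraNneq (wn2_neq0 m n l) => ->. Qed.

(** In two dimensions the symmetrized bracket of two eigenfunctions is, in vorticity form, the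
    Poisson bracket of the stream functions times the difference of the eigenvalues. This difference
    is the factor [D] that is divided out; the remaining numerators are cross products of the
    frequencies. *)
Lemma G_plane0_perp (x w th : R) :
  let k : pt R := (x, 0, w) in
  let p s t : pt R := (x + s * ka0, 0, w + t * ka2) in
  frequency L k -> G (mode (perp0 k) k th) ->
  (forall s z, s = 1 \/ s = -1 -> dot3 z (p s (-1)) = 0 -> G (mode z (p s (-1)) th)) ->
  (p 1 1).2 != 0 -> x ^+ 2 + w ^+ 2 != ka0 ^+ 2 + ka2 ^+ 2 ->
  G (((ka2 * x - ka0 * w) / dot3 (p 1 1) (p 1 1)) *: mode (perp0 (p 1 1)) (p 1 1) th -
     ((ka2 * x + ka0 * w) / dot3 (p (-1) 1) (p (-1) 1)) *:
       mode (perp0 (p (-1) 1)) (p (-1) 1) th).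
Proof.
move=> k p fk Gk low p2 D0.
have := G_plane0 fk Gk; rewrite -/(p _ _) => H.
have {}H := G_addl H (G_D (low _ _ (or_intror erefl) (dot3_proj _ _))
  (low _ _ (or_introl erefl) (dot3_proj _ _))).
have V1 (a b c d : R) : (a *: (perp0 k) + b *: ((c, 0, d) : pt R)).1.2 = 0.
  by rewrite /= /GRing.scale/= !mulr0 addr0.
pose V s : pt R := (s * ka2 * x - ka0 * w) *: perp0 k +
  (s * ka0 * w + ka2 * - x) *: ((s * ka2, 0, - ka0) : pt R).
have {}H : G (mode (proj (V 1) (p 1 1)) (p 1 1) th +
  mode (proj (V (-1)) (p (-1) 1)) (p (-1) 1) th) := H.
move: H; rewrite !mode_proj_plane0 ?V1//; set D := x ^+ 2 + w ^+ 2 - (ka0 ^+ 2 + ka2 ^+ 2).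
set E1 := mode (perp0 (p 1 1)) _ _; set E2 := mode (perp0 (p (-1) 1)) _ _.
set N1 := dot3 (p 1 1) _; set N2 := dot3 (p (-1) 1) _.
rewrite (_ : _ * _ - _ * _ = D * (ka2 * x - ka0 * w)); last by rewrite /D/= /GRing.scale/=; ring.
rewrite (_ : _ * (p (-1) 1).2 - _ = D * - (ka2 * x + ka0 * w)); last by rewrite /D/= /GRing.scale/=; ring.
rewrite -[D * _ / N1]mulrA -[D * _ / N2]mulrA -[(D * _) *: E1]scalerA.
rewrite -[(D * _) *: E2]scalerA -scalerDr mulNr scaleNr.
by apply: G_unZ; rewrite /D subr_eq0.
Qed.

(** The numerators are the cross products of the indices (m+1, l+2) with (1, 1) and (-1, 1), in
    units of ka0 * ka2. The eigenvalues differ because l+2 exceeds 1. *)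
Lemma plane0_step m l th :
  full m.+1 0 l.+2 -> full m 0 l.+1 -> full m.+2 0 l.+1 ->
  let N i := dot3 (wn i 0 l.+3) (wn i 0 l.+3) in
  let E i := mode (perp0 (wn i 0 l.+3)) (wn i 0 l.+3) th in
  G (((m%:R - l.+1%:R) / N m.+2) *: E m.+2 - ((m%:R + l.+3%:R) / N m) *: E m).
Proof.
move=> F F0 F2 N E.
have nS j : j.+1%:R = j%:R + 1 :> R by rewrite natr1.
have Ew i j : wn i 0 j = (i%:R * ka0, 0, j%:R * ka2) by rewrite /wn mul0r.
have Ep : (m.+1%:R * ka0 + 1 * ka0, 0, l.+2%:R * ka2 + 1 * ka2) = wn m.+2 0 l.+3.
  by rewrite Ew; apply: pt_eq => //=; rewrite !nS; ring.
have Em : (m.+1%:R * ka0 + -1 * ka0, 0, l.+2%:R * ka2 + 1 * ka2) = wn m 0 l.+3.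
  by rewrite Ew; apply: pt_eq => //=; rewrite !nS; ring.
have Ep' : (m.+1%:R * ka0 + 1 * ka0, 0, l.+2%:R * ka2 + -1 * ka2) = wn m.+2 0 l.+1.
  by rewrite Ew; apply: pt_eq => //=; rewrite !nS; ring.
have Em' : (m.+1%:R * ka0 + -1 * ka0, 0, l.+2%:R * ka2 + -1 * ka2) = wn m 0 l.+1.
  by rewrite Ew; apply: pt_eq => //=; rewrite !nS; ring.
have := @G_plane0_perp (m.+1%:R * ka0) (l.+2%:R * ka2) th; rewrite /= Ep Em.
rewrite -Ew -/(E _) -/(E _) -/(N _) -/(N _).
have lt2 : ka0 ^+ 2 + ka2 ^+ 2 < (m.+1%:R * ka0) ^+ 2 + (l.+2%:R * ka2) ^+ 2.
  have q j (y : R) : 0 < y -> y ^+ 2 <= (j.+1%:R * y) ^+ 2.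
    move=> y0; rewrite exprMn ler_peMl ?sqr_ge0//.
    by rewrite exprn_ege1// ler1n.
  rewrite ler_ltD ?q ?ka_gt0//.
  by rewrite [ltRHS]exprMn ltr_pMl ?exprn_gt0 ?ka_gt0// exprn_egt1// ltr1n.
have p20 : l.+2%:R * ka2 + 1 * ka2 != 0.
  by have := wn2_neq0 m.+2 0 l.+2; rewrite -Ep.
have ne : (m.+1%:R * ka0) ^+ 2 + (l.+2%:R * ka2) ^+ 2 != ka0 ^+ 2 + ka2 ^+ 2.
  by rewrite gt_eqF.
move=> H; have {}H := fun a b => H (frequency_wn _ _ _) (F _ _ a) b p20 ne.
have {}H : G (((ka2 * (m.+1%:R * ka0) - ka0 * (l.+2%:R * ka2)) / N m.+2) *: E m.+2 -
    ((ka2 * (m.+1%:R * ka0) + ka0 * (l.+2%:R * ka2)) / N m) *: E m).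
  apply: H; first by rewrite Ew /dot3/=; ring.
  by move=> s z [] ->; rewrite ?Ep' ?Em'; [exact: F2|exact: F0].
apply: (@G_unZ (ka0 * ka2)); first by rewrite mulf_neq0// gt_eqF// ka_gt0.
rewrite scalerBr !scalerA; move: H; congr (G (_ *: _ - _ *: _)).
  by rewrite [RHS]mulrA; congr (_ / _); rewrite !nS; ring.
by rewrite [RHS]mulrA; congr (_ / _); rewrite !nS; ring.
Qed.

(** Since [E 0] vanishes, the step at m = 0 isolates [E 2]. The step at m = 1 relates [E 3] to
    [E 1], and the shear applied to [E 2] gives a second relation between them. Eliminating [E 3]
    leaves [E 1] with the coefficient - 4 / [N 1], nonzero for every [l]. *)
Lemma full10 l : (forall m, full m 0 l.+1) -> (forall m, full m 0 l.+2) ->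
  full 1 0 l.+3.
Proof.
move=> F1 F2; apply: full_perp0 => th.
pose N i := dot3 (wn i 0 l.+3) (wn i 0 l.+3).
pose E i th := mode (perp0 (wn i 0 l.+3)) (wn i 0 l.+3) th.
have N0 i : N i != 0 by rewrite gt_eqF// dot3_wn_gt0.
have h2 t : G (E 2%N t).
  have : G (((0 - l.+1%:R) / N 2%N) *: E 2%N t - ((0 + l.+3%:R) / N 0%N) *: E 0%N t).
    exact: (@plane0_step 0 l t (F2 _) (F1 _) (F1 _)).
  have -> : E 0%N t = 0.
    by apply: vfieldP => x; rewrite !mxE/= !mul0r sin0 oppr0 !(mulr0, mul0r).
  rewrite scaler0 subr0 sub0r; apply: G_unZ.
  by rewrite mulf_neq0 ?invr_eq0// oppr_eq0 pnatr_eq0.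
have h31 : G (((1 - l.+1%:R) / N 3%N) *: E 3%N th - ((1 + l.+3%:R) / N 1%N) *: E 1%N th).
  exact: (@plane0_step 1 l th (F2 _) (F1 _) (F1 _)).
set k := wn 2 0 l.+3.
have := G_shear0 (be := perp0 k) (th := th) (frequency_wn 2 0 l.+3) (h2 _); rewrite -/k.
have -> : (k.1.1 + ka0, k.1.2, k.2) = wn 3 0 l.+3.
  by apply: pt_eq; rewrite // [RHS]wn_succ0.
have -> : (k.1.1 - ka0, k.1.2, k.2) = wn 1 0 l.+3.
  by apply: pt_eq; rewrite // /k wn_succ0 addrK.
have k0 : k.1.1 = 2 * ka0 by [].
have k2 : k.2 = l.+3%:R * ka2 by [].
have w0 i : (wn i 0 l.+3).1.1 = i%:R * ka0 by [].
have w1 i : (wn i 0 l.+3).1.2 = 0 by rewrite /= mul0r.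
have w2 i : (wn i 0 l.+3).2 = k.2 by [].
have k20 : k.2 != 0 by exact: wn2_neq0.
set V1 : pt R := (_, _, _ + _); set V2 : pt R := (_, _, _ - _).
have v1 : V1.1.2 = 0 by rewrite /V1/= mulr0.
have v2 : V2.1.2 = 0 by rewrite /V2/= mulr0.
rewrite !mode_proj_plane0 ?w1// -/(E _ th) -/(E _ th) -/(N _) -/(N _).
have v11 : V1.1.1 = k.2 * k.2 by [].
have v12 : V1.2 = k.2 * - (2 * ka0) + ka0 * k.2 by [].
have v21 : V2.1.1 = k.2 * k.2 by [].
have v22 : V2.2 = k.2 * - (2 * ka0) - ka0 * k.2 by [].
pose D := k.2 * (k.2 ^+ 2 + 3 * ka0 ^+ 2).
rewrite (_ : V1.1.1 * _ - _ = D); last by rewrite w0 w2 v11 v12 /D; ring.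
rewrite (_ : V2.1.1 * _ - _ = D); last by rewrite w0 w2 v21 v22 /D; ring.
rewrite -[(D / N 3%N) *: _]scalerA -[(D / N 1%N) *: _]scalerA -scalerDr => /G_unZ h.
have {}h : G ((N 3%N)^-1 *: E 3%N th + (N 1%N)^-1 *: E 1%N th).
  have d0 : 0 < k.2 ^+ 2 by rewrite lt0r sqr_ge0 sqrf_eq0 k20.
  have d1 : 0 <= 3 * ka0 ^+ 2 by rewrite mulr_ge0 ?sqr_ge0.
  by apply: h; rewrite mulf_neq0// gt_eqF// ltr_wpDr.
have := G_D h31 (G_Z (- (1 - l.+1%:R)) h).
rewrite scalerDr !scalerA addrACA mulNr scaleNr subrr add0r -scaleNr -scalerDl.
apply: G_unZ; rewrite !mulNr -opprD oppr_eq0 -mulrDl mulf_neq0 ?invr_eq0//.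
rewrite (_ : _ + _ = 4) ?pnatr_eq0// -[l.+3%:R]natr1 -[l.+2%:R]natr1; ring.
Qed.

Lemma full10_base l : (l < 2)%N -> full 1 0 l.+1.
Proof.
move=> l2; apply: full_perp0 => // th; rewrite -[th]add0r.
have E : perp0 (wn 1 0 l.+1) = (l.+1%:R * ka2, 0, - ka0) by rewrite /perp0/= mul1r.
by rewrite E; apply: G_rot; apply: G_gen; apply: gen_plane0; rewrite ?add0r; auto.
Qed.

End Generation.

(** * Exchange of the first two coordinates *)

Section Swap.
Context (R : realType).
Implicit Types (p z k w n : pt R) (th et : R).

Definition swap p : pt R := (p.1.2, p.1.1, p.2).

Definition swap_field (u : vfield R) : vfield R := fun x =>
  row3 (u (swap x) 0 1) (u (swap x) 0 0) (u (swap x) 0 2).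

Lemma swapK p : swap (swap p) = p.
Proof. by case: p => -[]. Qed.

Lemma mode_swap z k th : swap_field (mode z k th) = mode (swap z) (swap k) th.
Proof. by apply: vfieldP => x; rewrite /swap_field !mxE/=; split; ring. Qed.

Lemma swap_fieldD u v : swap_field (u + v) = swap_field u + swap_field v.
Proof. by apply: vfieldP => x; rewrite /swap_field !fctE !mxE/=. Qed.

Lemma swap_fieldZ c u : swap_field (c *: u) = c *: swap_field u.
Proof. by apply: vfieldP => x; rewrite /swap_field !fctE !mxE/=. Qed.

Lemma adv_swap z k th w n et :
  adv (mode (swap z) (swap k) th) (mode (swap w) (swap n) et) =
  swap_field (adv (mode z k th) (mode w n et)).
Proof.
by apply: vfieldP => x; rewrite /swap_field /adv !mxE !sum_ord3 !partial_mode !mxE/=; split; ring.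
Qed.

Lemma symadv_swap z k th w n et :
  symadv (mode (swap z) (swap k) th) (mode (swap w) (swap n) et) =
  swap_field (symadv (mode z k th) (mode w n et)).
Proof. by rewrite /symadv !adv_swap swap_fieldD. Qed.

Definition swap_term (t : R * pt R * pt R * R) := (t.1.1.1, swap t.1.1.2, swap t.1.2, t.2).

Lemma mode_sum_swap s : swap_field (mode_sum s) = mode_sum (map swap_term s).
Proof.
rewrite /mode_sum big_map; elim: s => [|t s IH].
  by rewrite !big_nil -[0 in LHS](scale0r 0) swap_fieldZ scale0r.
by rewrite !big_cons swap_fieldD swap_fieldZ IH mode_swap.
Qed.

Lemma proj_swap z k : proj (swap z) (swap k) = swap (proj z k).
Proof.
have D v p : dot3 (swap v) (swap p) = dot3 v p by rewrite /dot3/=; ring.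
by rewrite /proj !D; apply: pt_eq.
Qed.

Lemma proj_sum_swap s : swap_field (proj_sum s) = proj_sum (map swap_term s).
Proof.
rewrite /proj_sum big_map; elim: s => [|t s IH].
  by rewrite !big_nil -[0 in LHS](scale0r 0) swap_fieldZ scale0r.
by rewrite !big_cons swap_fieldD swap_fieldZ IH mode_swap proj_swap.
Qed.

Definition swap_index (i : 'I_3) : 'I_3 := if i == 0 then 1 else if i == 1 then 0 else i.

Lemma frequency_swap (L : 'I_3 -> R) k : frequency (L \o swap_index) k -> frequency L (swap k).
Proof.
by move=> fk; apply: forall_ord3; [exact: (fk 1)|exact: (fk 0)|exact: (fk 2)].
Qed.

(** Pulling everything back along the exchange lets the modes (0, 1, l) inherit the arguments given
    for (1, 0, l). *)
Lemma bracket_closed_swap (L : 'I_3 -> R) gen G : bracket_closed L gen G ->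
  bracket_closed (L \o swap_index) (fun z k => gen (swap z) (swap k))
    [set u | G (swap_field u)].
Proof.
move=> [[G0 GD GZ] Gg Gb]; split.
- split=> /=.
  + by rewrite -(scale0r 0) swap_fieldZ scale0r.
  + by move=> f g Gf Gh; rewrite swap_fieldD; exact: GD.
  + by move=> a f Gf; rewrite swap_fieldZ; exact: GZ.
- by move=> z k th /Gg /=; rewrite mode_swap.
- move=> al ka th be kb et s ga fa fb fs /=; rewrite mode_swap proj_sum_swap => Gbe E.
  apply: (Gb _ _ _ _ _ _ _ ga (frequency_swap fa) (frequency_swap fb) _ Gbe).
    by elim: s fs {E} => //= t s IH [/frequency_swap ft /IH].
  by rewrite symadv_swap E mode_sum_swap.
Qed.

Lemma full_swap (L : 'I_3 -> R) G (m n l : nat) :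
  full (L \o swap_index) [set u | G (swap_field u)] m n l <-> full L G n m l.
Proof.
split=> F z th zk; have := F (swap z) th; rewrite /= ?mode_swap ?swapK; apply;
by rewrite -zk /dot3/=; ring.
Qed.

End Swap.

(** * All levels, including level 0 *)

Section GenerationAll.
Context (R : realType) (L : 'I_3 -> R) (L_gt0 : forall i, 0 < L i).
Context (gen : pt R -> pt R -> R -> Prop) (G : set (vfield R)).
Context (bG : bracket_closed L gen G).
Implicit Types (z k p be al : pt R) (th et c : R) (m n l : nat).
Local Notation ka0 := (pi / L 0).
Local Notation ka1 := (pi / L 1).
Local Notation ka2 := (pi / L 2).
Local Notation wn := (wn L).
Local Notation full := (full L G).

Hypothesis gen_shear : forall m n, (m <= 2)%N -> (n <= 2)%N ->
  gen (0, 0, -1) (wn m n 0) (pi / 2).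
Hypothesis gen_plane0 : forall l th, (0 < l <= 2)%N -> th = 0 \/ th = pi / 2 ->
  gen (l%:R * ka2, 0, - ka0) (wn 1 0 l) th.
Hypothesis gen_plane1 : forall l th, (0 < l <= 2)%N -> th = 0 \/ th = pi / 2 ->
  gen (0, l%:R * ka2, - ka1) (wn 0 1 l) th.

Let L_swap_gt0 i : 0 < (L \o swap_index) i. Proof. exact: L_gt0. Qed.

Lemma full01_base l : (l < 2)%N -> full 0 1 l.+1.
Proof.
move=> l2; apply/full_swap.
exact: (full10_base L_swap_gt0 (bracket_closed_swap bG) gen_plane1).
Qed.

Lemma full01 l : (forall m, full 0 m l.+1) -> (forall m, full 0 m l.+2) -> full 0 1 l.+3.
Proof.
move=> F1 F2; apply/full_swap; refine (full10 L_swap_gt0 (bracket_closed_swap bG)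
  (fun m n hm hn => gen_shear hn hm) gen_plane1 _ _) => m; exact/full_swap.
Qed.

Lemma full_all m n l : full m n l.+1.
Proof.
suff H : (forall m n, full m n l.+1) /\ (forall m n, full m n l.+2) by case: H.
elim: l {m n} => [|l [H1 H2]].
  by split=> m n; apply: (full_level L_gt0 bG gen_shear);
    first [exact: (full10_base L_gt0 bG gen_plane0)|exact: full01_base].
split=> // m n; apply: (full_level L_gt0 bG gen_shear); last exact: full01.
exact: (full10 L_gt0 bG gen_shear gen_plane0).
Qed.

(** When k_3 = 0 the phase separates the components: phase 0 retains the horizontal part, whose
    divergence-free direction is (k_2, - k_1), and phase pi / 2 retains the vertical part. *)
Definition planar p := mode (p.1.2, - p.1.1, 0) p 0.

Lemma mode_proj_level0 (V p : pt R) : p.2 = 0 -> dot3 p p != 0 ->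
  mode (proj V p) p 0 = ((V.1.1 * p.1.2 - V.1.2 * p.1.1) / dot3 p p) *: planar p.
Proof.
rewrite /planar /proj; case: p => -[a b] c /= ->; case: V => -[u v] w; rewrite /dot3/=.
rewrite !mulr0 !addr0 => P0; apply: vfieldP => x; rewrite !fctE !mxE/= /GRing.scale/=.
rewrite mul0r subrr sin0 cos0; split; last by rewrite !mulr0.
  by field.
by field.
Qed.

(** Brackets of level 1 with the mode (1, 0, 1) reach levels 2 and 0. Level 2 is already full and is
    subtracted; what remains relates the two neighbours on level 0, with [be] still free. *)
Lemma level0_step m n be : dot3 be (wn m.+1 n.+1 1) = 0 ->
  let x := m.+1%:R * ka0 in let y := n.+1%:R * ka1 in
  let p0 := wn m n.+1 0 in let p2 := wn m.+2 n.+1 0 in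
  G ((- (2 * y * (x - ka0) * be.1.1 + (y ^+ 2 - (x - ka0) ^+ 2) * be.1.2) / dot3 p0 p0)
       *: planar p0 +
     ((2 * y * (x + ka0) * be.1.1 + (y ^+ 2 - (x + ka0) ^+ 2) * be.1.2) / dot3 p2 p2)
       *: planar p2).
Proof.
move=> bk x y p0 p2; have fk := frequency_wn L m.+1 n.+1 1.
pose k := wn m.+1 n.+1 1.
pose V s : pt R := (s * ka2 * k.1.1 - ka0 * k.2) *: be
    + (s * ka0 * be.1.1 + ka2 * be.2) *: (s * ka2, 0, - ka0).
pose W s : pt R := - (s * ka2 * k.1.1 - ka0 * k.2) *: be
    + (s * ka0 * be.1.1 + ka2 * be.2) *: (s * ka2, 0, - ka0).
pose U s t : pt R := (k.1.1 + s * ka0, k.1.2, k.2 + t * ka2).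
have : G ((mode (proj (V 1) (U 1 1)) (U 1 1) 0 +
     mode (proj (V (-1)) (U (-1) 1)) (U (-1) 1) 0) +
    (mode (proj (W 1) (U (-1) (-1))) (U (-1) (-1)) 0 +
     mode (proj (W (-1)) (U 1 (-1))) (U 1 (-1)) 0)).
  exact: (G_plane0 bG gen_plane0 fk (@full_all _ _ 0 be 0 bk)).
have nS j : j.+1%:R = j%:R + 1 :> R by rewrite natr1.
have -> : U 1 1 = wn m.+2 n.+1 2 by apply: pt_eq; rewrite /U/= !nS; ring.
have -> : U (-1) 1 = wn m n.+1 2 by apply: pt_eq; rewrite /U/= !nS; ring.
have -> : U 1 (-1) = p2 by apply: pt_eq; rewrite /U/= !nS; ring.
have -> : U (-1) (-1) = p0 by apply: pt_eq; rewrite /U/= !nS; ring.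
move=> H; have {}H := G_addr bG H (G_D bG (full_all 0 (dot3_proj _ _)) (full_all 0 (dot3_proj _ _))).
have np i : dot3 (wn i n.+1 0) (wn i n.+1 0) != 0.
  rewrite dot3_eq0; apply/eqP => /(congr1 (fun q : pt R => q.1.2))/=.
  by apply/eqP; rewrite mulf_neq0 ?pnatr_eq0// gt_eqF// ka_gt0.
move: H; rewrite !mode_proj_level0; [|by rewrite /= mul0r|exact: np|by rewrite /= mul0r|exact: np].
have k2 : ka2 != 0 by rewrite gt_eqF// ka_gt0.
have b2 : ka2 * be.2 = - (x * be.1.1 + y * be.1.2).
  by apply/eqP; rewrite -addr_eq0 -bk /dot3/= mul1r; apply/eqP; rewrite /x /y; ring.
move=> H; apply: (G_unZ bG k2); move: H.
have sc (c N : R) (u : vfield R) : ka2 *: ((c / N) *: u) = (ka2 * c / N) *: u.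
  by rewrite scalerA mulrA.
rewrite scalerDr !sc.
have k01 : k.1.1 = x by [].
have k2E : k.2 = ka2 by rewrite /k/= mul1r.
have p01 : p0.1.1 = x - ka0 by rewrite /p0 /x/= nS; ring.
have p21 : p2.1.1 = x + ka0 by rewrite /p2 /x/= !nS; ring.
have p02 : p0.1.2 = y by [].
have p22 : p2.1.2 = y by [].
have W1 s : (W s).1.1 = - (s * ka2 * x - ka0 * k.2) * be.1.1 + (s * ka0 * be.1.1 + ka2 * be.2) * (s * ka2).
  by [].
have W2 s : (W s).1.2 = - (s * ka2 * x - ka0 * k.2) * be.1.2.
  by rewrite /W/= /GRing.scale/= mulr0 addr0.
rewrite !W1 !W2 k2E p01 p21 p02 p22 b2.
congr (G (_ / _ *: _ + _ / _ *: _)); ring.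
Qed.

Lemma planar_all m n : G (planar (wn m n 0)).
Proof.
have N0 i j : dot3 (wn i j.+1 0) (wn i j.+1 0) != 0.
  rewrite dot3_eq0; apply/eqP => /(congr1 (fun q : pt R => q.1.2))/=.
  by apply/eqP; rewrite mulf_neq0 ?pnatr_eq0// gt_eqF// ka_gt0.
have ka0_gt0 : 0 < ka0 by exact: ka_gt0.
have ka1_gt0 : 0 < ka1 by exact: ka_gt0.
have k2 : ka2 != 0 by rewrite gt_eqF// ka_gt0.
case: n => [|n].
  rewrite (_ : planar _ = 0); first exact: (G_0 bG).
  by apply: vfieldP => x; rewrite !mxE/= !mul0r sin0 !(mulr0, mul0r).
set y := n.+1%:R * ka1; have y0 : 0 < y by rewrite mulr_gt0.
have bek i (b0 b1 : R) : dot3 (b0, b1, - (i.+1%:R * ka0 * b0 + y * b1) / ka2) (wn i.+1 n.+1 1) = 0.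
  by rewrite /dot3/= mul1r divfK// /y; ring.
have big i : G (planar (wn i.+2 n.+1 0)).
  set x := i.+1%:R * ka0.
  (* This amplitude annihilates the coefficient of the lower neighbour. *)
  have := level0_step (bek i (y ^+ 2 - (x - ka0) ^+ 2) (- (2 * y * (x - ka0)))).
  rewrite /= -/x -/y.
  rewrite (_ : - (_ + _) = 0) ?mul0r ?scale0r ?add0r; last by ring.
  apply: (G_unZ bG) => //; rewrite mulf_neq0 ?invr_eq0//.
  rewrite (_ : _ + _ = 4 * y * ka0 * (y ^+ 2 + (x ^+ 2 - ka0 ^+ 2))); last by ring.
  have d : 0 < y ^+ 2 + (x ^+ 2 - ka0 ^+ 2).
    have xg : ka0 <= x by rewrite /x ler_peMl ?(ltW ka0_gt0)// ler1n.
    by rewrite ltr_wpDr ?exprn_gt0// subr_ge0 ler_sqr ?nnegrE ?(ltW ka0_gt0)// (le_trans (ltW ka0_gt0)).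
  by apply: lt0r_neq0; rewrite mulr_gt0// mulr_gt0// mulr_gt0.
case: m => [|[|m]]; last exact: big.
  rewrite (_ : planar _ = 0); first exact: (G_0 bG).
  by apply: vfieldP => x; rewrite !mxE/= !mul0r sin0 oppr0 !(mulr0, mul0r).
(* Index 1 is reached from above: its companion at index 3 is already known, and the amplitude (1,
   0) gives it a nonzero coefficient. *)
have := level0_step (bek 1%N 1 0) => /= H.
have {}H := G_addl bG H (G_Z bG _ (big _)).
move: H; rewrite mulr0 addr0 -/y; apply: (G_unZ bG) => //.
rewrite mulf_neq0 ?invr_eq0// oppr_eq0 (_ : _ - ka0 = ka0); last by ring.
by rewrite mulr1; apply: lt0r_neq0; rewrite mulr_gt0// mulr_gt0.
Qed.

Definition vertical m n := mode (0, 0, -1) (wn m n 0) (pi / 2).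

Lemma vertical_quarter (c : R) p :
  mode (0, 0, c) p (- (pi / 2)) = c *: mode (0, 0, -1) p (pi / 2).
Proof.
apply: vfieldP => x; rewrite !fctE !mxE /GRing.scale/= !opprK sinDpihalf sinBpihalf.
by split; ring.
Qed.

(** Because k_3 = 0, the bracket of a planar mode with the shear is purely vertical, with opposite
    coefficients at the two neighbours. *)
Lemma vertical_step0 m n : G (vertical m.+2 n.+1 - vertical m n.+1).
Proof.
set k := wn m.+1 n.+1 0; set y := n.+1%:R * ka1.
have y0 : y != 0 by rewrite mulf_neq0 ?pnatr_eq0// gt_eqF// ka_gt0.
have ka0_neq0 : ka0 != 0 by rewrite gt_eqF// ka_gt0.
have := planar_all m.+1 n.+1; rewrite /planar -/k -(subrK (pi / 2) 0) => Gb.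
have := G_shear0 bG gen_shear (frequency_wn L m.+1 n.+1 0) Gb; rewrite -/k.
have -> : (k.1.1 + ka0, k.1.2, k.2) = wn m.+2 n.+1 0.
  by apply: pt_eq; rewrite // [RHS]wn_succ0.
have -> : (k.1.1 - ka0, k.1.2, k.2) = wn m n.+1 0.
  by apply: pt_eq; rewrite // /k wn_succ0 addrK.
have k2 : k.2 = 0 by rewrite /k/= mul0r.
have k1 : k.1.2 = y by [].
rewrite k2 k1 !mul0r add0r !sub0r.
rewrite !proj_id; try by rewrite /dot3/= !(mul0r, mulr0) !addr0.
rewrite !(vertical_quarter (_ * _)) (vertical_quarter (- _)) -/(vertical _ _) -/(vertical _ _) scaleNr -scalerBr.
by apply: (G_unZ bG) => //; rewrite mulf_neq0.
Qed.

Lemma vertical_step1 m n : G (vertical m.+1 n.+2 - vertical m.+1 n).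
Proof.
set k := wn m.+1 n.+1 0; set x := m.+1%:R * ka0.
have x0 : x != 0 by rewrite mulf_neq0 ?pnatr_eq0// gt_eqF// ka_gt0.
have ka1_neq0 : ka1 != 0 by rewrite gt_eqF// ka_gt0.
have := planar_all m.+1 n.+1; rewrite /planar -/k -(subrK (pi / 2) 0) => Gb.
have := G_shear1 bG gen_shear (frequency_wn L m.+1 n.+1 0) Gb; rewrite -/k.
have -> : (k.1.1, k.1.2 + ka1, k.2) = wn m.+1 n.+2 0.
  by apply: pt_eq; rewrite // [RHS]wn_succ1.
have -> : (k.1.1, k.1.2 - ka1, k.2) = wn m.+1 n 0.
  by apply: pt_eq; rewrite // /k wn_succ1 addrK.
have k2 : k.2 = 0 by rewrite /k/= mul0r.
have k1 : k.1.1 = x by [].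
rewrite k2 k1 !mul0r add0r !sub0r.
rewrite !proj_id; try by rewrite /dot3/= !(mul0r, mulr0) !addr0.
rewrite !(vertical_quarter (ka1 * _)) (vertical_quarter (- _)) -/(vertical _ _) -/(vertical _ _) scaleNr -scalerBr.
by apply: (G_unZ bG) => //; rewrite mulf_neq0// oppr_eq0.
Qed.

(** The steps give differences of modes two indices apart, and only where the other index is
    positive. The starting values are therefore generators, and index 0 is reached backwards from
    index 2. *)
Lemma vertical_all m n : G (vertical m n).
Proof.
have base i j : (i <= 2)%N -> (j <= 2)%N -> G (vertical i j).
  by move=> i2 j2; apply: (G_gen bG); exact: gen_shear.
have col i : (i < 2)%N -> forall j, G (vertical i.+1 j).
  move=> i2 j; suff : G (vertical i.+1 j) /\ G (vertical i.+1 j.+1) by case.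
  elim: j => [|j [H0 H1]]; first by split; apply: base.
  by split => //; rewrite -[vertical _ _](subrK (vertical i.+1 j)); apply: (G_D bG) => //; exact: vertical_step1.
have row0 j : G (vertical 0 j.+1).
  have := vertical_step0 0 j => H.
  by have := G_addr bG H (col 1%N isT j.+1) => /(G_Z bG (-1)); rewrite scaleN1r opprK.
have row j i : G (vertical i j.+1).
  suff : G (vertical i j.+1) /\ G (vertical i.+1 j.+1) by case.
  elim: i => [|i [H0 H1]]; first by split => //; exact: col.
  by split => //; rewrite -[vertical _ _](subrK (vertical i j.+1)); apply: (G_D bG) => //; exact: vertical_step0.
case: n => [|n]; last exact: row.
case: m => [|m]; first exact: base.
have := G_addr bG (vertical_step1 m 0) (row 1%N m.+1) => /(G_Z bG (-1)).
by rewrite scaleN1r opprK.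
Qed.

Lemma mode_planar z k : k.2 = 0 -> dot3 z k = 0 ->
  exists c, mode z k 0 = c *: planar k.
Proof.
move=> k2; rewrite /dot3 k2 mulr0 addr0 => /eqP zk.
have [k1|k1] := eqVneq k.1.2 0.
  exists 0; rewrite scale0r; apply: vfieldP => x; rewrite !mxE/= k1 k2 !mul0r subr0 sin0.
  move: zk; rewrite k1 mulr0 addr0 mulf_eq0 => /orP[] /eqP ->; first by rewrite !(mulr0, mul0r).
  by rewrite !mul0r sin0 !(mulr0, mul0r).
exists (z.1.1 / k.1.2).
have E : z.1.2 = - (z.1.1 / k.1.2) * k.1.1.
  by apply: (mulIf k1); move: zk; rewrite addrC addr_eq0 => /eqP ->; field.
apply: vfieldP => x; rewrite !fctE !mxE /GRing.scale/= k2 mul0r subr0 sin0 cos0 E.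
by split; [field|ring|ring].
Qed.

Lemma G_wn m n l z th : dot3 z (wn m n l) = 0 -> G (mode z (wn m n l) th).
Proof.
case: l => [|l] zk; last exact: full_all.
set k := wn m n 0 in zk *.
have k2 : k.2 = 0 by rewrite /k/= mul0r.
rewrite -[th]add0r; apply: (G_rot bG) => //; last first.
  have -> : mode z k (0 + pi / 2) = (- z.2) *: vertical m n.
    apply: vfieldP => x; rewrite !fctE !mxE /GRing.scale/= !mul0r !sub0r !add0r cosN cos_pihalf.
    by split; ring.
  exact/(G_Z bG)/vertical_all.
by have [c ->] := mode_planar k2 zk; exact/(G_Z bG)/planar_all.
Qed.

(** Negative frequencies are removed one coordinate at a time by reflection, which changes a mode
    only through its amplitude, frequency and phase. *)
Lemma G_mode z k th : frequency L k -> dot3 z k = 0 -> G (mode z k th).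
Proof.
move=> fk zk.
have nat_or (i : 'I_3) : exists2 j : nat, xcoord k i = j%:R * (pi / L i) \/ xcoord k i = - (j%:R * (pi / L i)) & True.
  have [[j|j] E] := fk i; [exists j|exists j.+1] => //; rewrite E -mulrA; first by left.
  by right; rewrite NegzE intrN mulNr.
have [[m E0 _] [[n E1 _] [l E2 _]]] := (nat_or 0, (nat_or 1, nat_or 2)).
move: E0 E1 E2; rewrite /xcoord/= => E0 E1 E2.
have key (z' : pt R) (k' : pt R) th' : k'.1.1 = m%:R * ka0 -> k'.1.2 = n%:R * ka1 ->
    k'.2 = l%:R * ka2 -> dot3 z' k' = 0 -> G (mode z' k' th').
  by move=> e0 e1 e2 zk'; have kE : k' = wn m n l by [apply: pt_eq]; rewrite kE in zk' *; exact: G_wn.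
have key1 (z' : pt R) (k' : pt R) th' : k'.1.1 = m%:R * ka0 -> k'.1.2 = n%:R * ka1 ->
    dot3 z' k' = 0 -> k'.2 = k.2 -> G (mode z' k' th').
  move=> e0 e1 zk' e2; case: E2 => E2; first by apply: key; rewrite // e2.
  rewrite -mode_flip2; apply: key => //=; first by rewrite e2 E2 opprK.
  by rewrite -zk' /dot3/=; ring.
have key2 (z' : pt R) (k' : pt R) th' : k'.1.1 = m%:R * ka0 -> k'.1.2 = k.1.2 ->
    dot3 z' k' = 0 -> k'.2 = k.2 -> G (mode z' k' th').
  move=> e0 e1 zk' e2; case: E1 => E1; first by apply: key1; rewrite // e1.
  rewrite -mode_flip1; apply: key1 => //=; first by rewrite e1 E1 opprK.
  by rewrite -zk' /dot3/=; ring.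
case: E0 => E0; first exact: key2.
rewrite -mode_flip0; apply: key2 => //=; first by rewrite E0 opprK.
by rewrite -zk /dot3/=; ring.
Qed.

End GenerationAll.

Import HBNNSimple.

(** * Closure of a space of functions in square mean *)

Section SquareMeanApproximation.
Context d (T : measurableType d) (R : realType).
Context (mu : {measure set T -> \bar R}) (D : set T) (mD : measurable D).
Implicit Types (f g h p : T -> R) (P : set (T -> R)).

Definition sqnorm f : \bar R := (\int[mu]_(x in D) (f x ^+ 2)%:E)%E.

(** The closure of [P] in L^2(D). The norm is extended real, so that no integrability has to be
    carried along. *)
Definition approximable P f := measurable_fun D f /\
  forall e : R, 0 < e -> exists2 p, P p & (sqnorm (f \- p)%R < e%:E)%E.

Lemma measurable_sqr f : measurable_fun D f ->
  measurable_fun D (fun x => (f x ^+ 2)%:E).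
Proof. by move=> mf; apply/measurable_EFinP; exact: measurable_funX. Qed.

Lemma sqnorm_le f g : measurable_fun D f -> measurable_fun D g ->
  (forall x, D x -> `|f x| <= `|g x|) -> (sqnorm f <= sqnorm g)%E.
Proof.
move=> mf mg fg; apply: ge0_le_integral => //; try exact: measurable_sqr.
  by move=> x _; rewrite lee_fin sqr_ge0.
by move=> x Dx; rewrite lee_fin -(real_normK (num_real (f x))) -(real_normK (num_real (g x))) ler_sqr ?nnegrE// fg.
Qed.

Lemma eq_sqnorm f g : (forall x, D x -> f x = g x) -> sqnorm f = sqnorm g.
Proof. by move=> fg; apply: eq_integral => x; rewrite inE => /fg ->. Qed.

Lemma sqnormZ c f : measurable_fun D f ->
  sqnorm (fun x => c * f x) = ((c ^+ 2)%:E * sqnorm f)%E.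
Proof.
move=> mf; rewrite /sqnorm -ge0_integralZl//.
- by apply: eq_integral => x _; rewrite exprMn.
- exact: measurable_sqr.
- by move=> x _; rewrite lee_fin sqr_ge0.
- by rewrite lee_fin sqr_ge0.
Qed.

Lemma sqnormD f g : measurable_fun D f -> measurable_fun D g ->
  (sqnorm (f \+ g)%R <= 2%:E * sqnorm f + 2%:E * sqnorm g)%E.
Proof.
move=> mf mg; rewrite /sqnorm -!ge0_integralZl//; try exact: measurable_sqr; try by move=> x _; rewrite lee_fin sqr_ge0.
rewrite -ge0_integralD//; last 4 first.
- by move=> x _; rewrite -EFinM lee_fin mulr_ge0// sqr_ge0.
- by apply: measurable_funeM; exact: measurable_sqr.
- by move=> x _; rewrite -EFinM lee_fin mulr_ge0// sqr_ge0.
- by apply: measurable_funeM; exact: measurable_sqr.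
apply: ge0_le_integral => //.
- by move=> x _; rewrite lee_fin sqr_ge0.
- by apply: measurable_sqr; exact: measurable_funD.
- by apply: emeasurable_funD; apply: measurable_funeM; exact: measurable_sqr.
- move=> x _; rewrite -!EFinM -EFinD lee_fin -subr_ge0.
  by rewrite (_ : _ - _ = (f x - g x) ^+ 2) ?sqr_ge0//=; ring.
Qed.

Lemma sqnormD_lt f g (e : R) : measurable_fun D f -> measurable_fun D g ->
  (sqnorm f < (e / 4)%:E)%E -> (sqnorm g < (e / 4)%:E)%E -> (sqnorm (f \+ g)%R < e%:E)%E.
Proof.
move=> mf mg fe ge; apply: le_lt_trans (sqnormD mf mg) _.
rewrite (_ : e%:E = 2%:E * (e / 4)%:E + 2%:E * (e / 4)%:E)%E; last by rewrite -EFinM -EFinD; congr EFin; field.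
by apply: lteD; rewrite lte_pmul2l// lte_fin.
Qed.

Lemma sqnorm_cvg (f_ : nat -> T -> R) f h :
  (forall n, measurable_fun D (f_ n)) -> measurable_fun D f ->
  (forall x, D x -> f_ ^~ x @ \oo --> f x) ->
  (forall n x, D x -> `|f x - f_ n x| <= h x) ->
  mu.-integrable D (fun x => (h x ^+ 2)%:E) ->
  forall e : R, 0 < e -> exists n, (sqnorm (f \- f_ n)%R < e%:E)%E.
Proof.
move=> mf_ mf cf fh ih e e0.
have H : (fun n => \int[mu]_(x in D) (((f \- f_ n) x) ^+ 2)%:E)%E @ \oo --> (\int[mu]_(x in D) (cst 0 x))%E.
  apply: (dominated_cvg mD (g := fun x => (h x ^+ 2)%:E)) => //.
  - by move=> n; apply: measurable_sqr; exact: measurable_funB.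
  - move=> x Dx /=; apply: cvg_EFin; first by apply: nearW.
    have c0 : (fun n => f x - f_ n x) @ \oo --> (0 : R).
      by rewrite -(subrr (f x)); apply: cvgB; [exact: cvg_cst|exact: cf].
    rewrite -(mulr0 0) (_ : _ \o _ = (fun n => (f x - f_ n x) * (f x - f_ n x))); first exact: cvgM.
    by apply/funext => n /=; rewrite expr2.
  - move=> n x Dx; rewrite gee0_abs ?lee_fin ?sqr_ge0//.
    rewrite -(real_normK (num_real (f x - f_ n x))) ler_sqr ?nnegrE ?fh//.
    by rewrite (le_trans _ (fh n x Dx)).
rewrite integral0 in H.
have [N _ HN] := H _ (nbhs_open_ereal_lt (f := fun=> e) e0).
by exists N; exact: (HN N (leqnn N)).
Qed.

Lemma eq_approximable P f g : (forall x, D x -> f x = g x) ->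
  approximable P f -> approximable P g.
Proof.
move=> fg [mf Pf]; split.
  by apply: (eq_measurable_fun f) => // x; rewrite inE => /fg.
move=> e /Pf[p Pp H]; exists p => //; rewrite -(@eq_sqnorm (f \- p)) => // x /fg /= ->.
by [].
Qed.

Section Closure.
Context P (mP : forall p, P p -> measurable_fun D p).
Hypothesis PD : forall p q, P p -> P q -> P (p \+ q).
Hypothesis PZ : forall c p, P p -> P (fun x => c * p x).
Local Notation A := (approximable P).

Lemma approximable_self p : P p -> A p.
Proof.
move=> Pp; split; first exact: mP.
move=> e e0; exists p => //; rewrite (@eq_sqnorm _ (cst 0)); last by move=> x _ /=; rewrite subrr.
by rewrite /sqnorm (eq_integral (cst 0)%E) ?integral0 ?lte_fin// => x _ /=; rewrite expr0n.
Qed.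

Lemma approximable_lim f : measurable_fun D f ->
  (forall e : R, 0 < e -> exists2 g, A g & (sqnorm (f \- g)%R < e%:E)%E) -> A f.
Proof.
move=> mf Af; split => // e e0; have e4 : 0 < e / 4 by rewrite divr_gt0.
have [g [mg Ag] fg] := Af _ e4; have [p Pp gp] := Ag _ e4; exists p => //.
rewrite (@eq_sqnorm _ ((f \- g) \+ (g \- p))); last by move=> x _ /=; ring.
by apply: sqnormD_lt => //; apply: measurable_funB => //; exact: mP.
Qed.

Lemma approximable_cvg (f_ : nat -> T -> R) f h :
  (forall n, A (f_ n)) -> measurable_fun D f ->
  (forall x, D x -> f_ ^~ x @ \oo --> f x) ->
  (forall n x, D x -> `|f x - f_ n x| <= h x) ->
  mu.-integrable D (fun x => (h x ^+ 2)%:E) -> A f.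
Proof.
move=> Af mf cf fh ih; apply: approximable_lim => // e e0.
have [n Hn] := sqnorm_cvg (fun n => (Af n).1) mf cf fh ih e0.
by exists (f_ n).
Qed.

Lemma approximableD f g : A f -> A g -> A (f \+ g).
Proof.
move=> [mf Af] [mg Ag]; split; first exact: measurable_funD.
move=> e e0; have e4 : 0 < e / 4 by rewrite divr_gt0.
have [p Pp fp] := Af _ e4; have [q Pq gq] := Ag _ e4; exists (p \+ q); first exact: PD.
rewrite (@eq_sqnorm _ ((f \- p) \+ (g \- q))); last by move=> x _ /=; ring.
by apply: sqnormD_lt => //; apply: measurable_funB => //; exact: mP.
Qed.

Lemma approximableZ c f : A f -> A (fun x => c * f x).
Proof.
move=> [mf Af]; split; first by apply: measurable_funM => //; exact: measurable_cst.
move=> e e0; have c0 : 0 < c ^+ 2 + 1 by rewrite ltr_wpDl ?sqr_ge0.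
have [p Pp fp] := Af (e / (c ^+ 2 + 1)) (divr_gt0 e0 c0).
exists (fun x => c * p x); first exact: PZ.
rewrite (@eq_sqnorm _ (fun x => c * (f \- p) x)); last by move=> x _ /=; ring.
rewrite sqnormZ; last by apply: measurable_funB => //; exact: mP.
apply: (@le_lt_trans _ _ ((c ^+ 2 + 1)%:E * sqnorm (f \- p)%R)%E).
  apply: lee_wpmul2r; first by apply: integral_ge0 => x _; rewrite lee_fin sqr_ge0.
  by rewrite lee_fin lerDl.
rewrite (_ : e%:E = (c ^+ 2 + 1)%:E * (e / (c ^+ 2 + 1))%:E)%E; last first.
  by rewrite -EFinM mulrC divfK// gt_eqF.
by rewrite lte_pmul2l// lte_fin.
Qed.

Lemma approximable_sum (I : Type) (r : seq I) (F : I -> T -> R) : A (cst 0) ->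
  (forall i, A (F i)) -> A (fun x => \sum_(i <- r) F i x).
Proof.
move=> A0 AF; elim: r => [|i r IH]; first by apply: eq_approximable A0 => x _; rewrite big_nil.
by apply: eq_approximable (approximableD (AF i) IH) => x _; rewrite big_cons.
Qed.

Section Indicators.
Hypothesis finD : (mu D < +oo)%E.
Hypothesis P0 : P (cst 0).

Lemma integrable_cst_fin c : mu.-integrable D (fun=> c%:E).
Proof.
apply: (measurable_bounded_integrable (f := cst c)) => //; exists `|c|; split => // M cM x _ /=.
exact: ltW.
Qed.

(** The admissible sets [S] form a Dynkin system: complements relative to [Z] are differences, and
    countable disjoint unions are dominated limits of sums. The fixed set [Z] holds the constraints
    on the other coordinates, so that one factor is freed at a time. *)
Lemma approximable_preimage d' (T' : measurableType d') (G : set (set T'))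
    (pi : T -> T') (Z : set T) :
  @measurable _ T' = <<s G >> -> setI_closed G -> measurable_fun setT pi ->
  measurable Z -> A \1_Z -> (forall S, G S -> A \1_(Z `&` pi @^-1` S)) ->
  forall S, measurable S -> A \1_(Z `&` pi @^-1` S).
Proof.
move=> GE GI mpi mZ AZ AG S; rewrite GE.
have mpre (U : set T') : measurable U -> measurable (Z `&` pi @^-1` U).
  by move=> mU; apply: measurableI => //; rewrite -[_ @^-1` _]setTI; exact: mpi.
apply: (dynkin_induction (P := fun S => A \1_(Z `&` pi @^-1` S)) GE GI) => //.
- by rewrite preimage_setT setIT.
- move=> U mU AU; apply: eq_approximable (approximableD AZ (approximableZ (-1) AU)) => x _.
  rewrite /= !indicE !in_setI -preimage_setC in_setC.
  by case: (x \in Z); case: (x \in _) => /=; ring.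
move=> F mF tF AF.
have Fn n : A \1_(Z `&` pi @^-1` \big[setU/set0]_(i < n) F i).
  elim: n => [|n IH].
    by apply: eq_approximable (approximable_self P0) => x _; rewrite big_ord0 preimage_set0 setI0 indic0.
  apply: eq_approximable (approximableD IH (AF n)) => x _.
  rewrite big_ord_recr /= !indicE !in_setI preimage_setU in_setU.
  have [_|_] := boolP (x \in Z) => /=; last by rewrite addr0.
  have [xb|_] := boolP (x \in _ @^-1` _) => /=; last by rewrite add0r.
  rewrite (_ : x \in _ = false) ?addr0//; apply/negbTE/negP; rewrite inE /= => xn.
  move: xb; rewrite inE /= -bigcup_mkord => -[m /= mn xm].
  by move: mn; rewrite (tF m n) ?ltnn//; exists (pi x).
apply: (approximable_cvg (h := cst 1) Fn).
- by apply: measurable_indic; apply: mpre; exact: bigcupT_measurable.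
- move=> x Dx; have [[Zx [m _ xm]]|nx] := pselect ((Z `&` pi @^-1` (\bigcup_k F k)) x).
    apply: cvg_near_cst; exists m.+1 => // n /= mn.
    have xn : (Z `&` pi @^-1` \big[setU/set0]_(i < n) F i) x.
      by split => //; rewrite /= -bigcup_mkord; exists m.
    by rewrite !indicE (mem_set xn) mem_set//; split => //; exists m.
  apply: cvg_near_cst; apply: nearW => n; rewrite !indicE (memNset nx) memNset// => -[Zx].
  by rewrite /= -bigcup_mkord => -[m _ xm]; apply: nx; split => //; exists m.
- move=> n x _; rewrite !indicE; case: (_ \in _); case: (_ \in _);
    by rewrite /= ?subrr ?subr0 ?sub0r ?normrN ?normr1 ?normr0.
- exact: (integrable_cst_fin (1 ^+ 2)).
Qed.

Hypothesis AI : forall S, measurable S -> A \1_S.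

Lemma approximable_sfun (g : {nnsfun T >-> R}) : A g.
Proof.
pose F (y : R) := fun x => y * \1_(g @^-1` [set y]) x.
have AF y : A (F y).
  by apply: approximableZ; apply: AI; rewrite -[_ @^-1` _]setTI; exact: measurable_funP.
have := approximable_sum (finmap.enum_fset (fset_set (range g))) (approximable_self P0) AF.
apply: eq_approximable => x _.
by rewrite (fimfunE g) fsbig_finite//; exact: fimfunP.
Qed.

Lemma approximable_nonneg f : measurable_fun D f -> (forall x, D x -> 0 <= f x) ->
  mu.-integrable D (fun x => (f x ^+ 2)%:E) -> A f.
Proof.
move=> mf f0 f2; have mEf : measurable_fun D (EFin \o f) by exact/measurable_EFinP.
have cf x : D x -> (fun n => nnsfun_approx mD mEf n x) @ \oo --> f x.
  move=> Dx; have : forall x, D x -> (0 <= (EFin \o f) x)%E by move=> y /f0; rewrite lee_fin.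
  by move=> /cvg_nnsfun_approx -/(_ mD mEf x Dx) /fine_cvg.
apply: (approximable_cvg (f_ := fun n => nnsfun_approx mD mEf n) (h := f)) => //.
  by move=> n; exact: approximable_sfun.
move=> n x Dx.
have gf : nnsfun_approx mD mEf n x <= f x.
  rewrite -(cvg_lim _ (cf x Dx))//; apply: nondecreasing_cvgn_le; last by apply/cvg_ex; exists (f x); exact: cf.
  by move=> i j ij; have /lefP := nd_nnsfun_approx mD mEf ij; exact.
by rewrite ger0_norm ?subr_ge0// gerBl.
Qed.

Lemma approximable_L2 f : measurable_fun D f ->
  mu.-integrable D (fun x => (f x ^+ 2)%:E) -> A f.
Proof.
move=> mf f2; have nf x := ler_norm (f x).
have nNf x : - f x <= `|f x| by rewrite -normrN ler_norm.
(* Positive and negative parts, as (|g| + g) / 2 for g = f and g = - f. *)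
have half g : measurable_fun D g -> (forall x, `|g x| = `|f x|) -> A (fun x => 2^-1 * (`|g x| + g x)).
  move=> mg gf; have mh : measurable_fun D (fun x => 2^-1 * (`|g x| + g x)).
    apply: measurable_funM; first exact: measurable_cst.
    by apply: measurable_funD => //; exact: measurableT_comp.
  have h0 x : 0 <= 2^-1 * (`|g x| + g x).
    by rewrite mulr_ge0// -lerBlDr sub0r -normrN ler_norm.
  apply: approximable_nonneg => //; apply: le_integrable f2 => //; first exact: measurable_sqr.
  move=> x _; rewrite !gee0_abs ?lee_fin ?sqr_ge0// -(real_normK (num_real (f x))) -gf.
  rewrite ler_sqr ?nnegrE// ler_pdivrMl// mulr_natl mulr2n lerD2l; exact: ler_norm.
have mNf : measurable_fun D (fun x => - f x) by exact: measurableT_comp.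
have := approximableD (half f mf (fun=> erefl)) (approximableZ (-1) (half _ mNf (fun x => normrN (f x)))).
by apply: eq_approximable => x _ /=; rewrite normrN; field.
Qed.

End Indicators.
End Closure.

End SquareMeanApproximation.

(** * Polynomials converging to a step function *)

Section Threshold.
Context (R : realType).
Implicit Types (q r t : R) (n m : nat).

Lemma bernoulli t n : t <= 1 -> 1 - n%:R * t <= (1 - t) ^+ n.
Proof.
move=> t1; elim: n => [|n IH]; first by rewrite mul0r subr0 expr0.
rewrite exprS; apply: le_trans (ler_wpM2l _ IH); last by rewrite subr_ge0.
rewrite -natr1 -subr_ge0 (_ : _ - _ = n%:R * t ^+ 2); last by ring.
by rewrite mulr_ge0// sqr_ge0.
Qed.

Lemma bernoulli_inv t n : 0 <= t <= 1 -> (1 - t) ^+ n * (1 + n%:R * t) <= 1.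
Proof.
move=> /andP[t0 t1].
have /(bernoulli n) : - t <= 1 by rewrite (le_trans _ ler01)// oppr_le0.
rewrite mulrN !opprK => H.
have s0 : 0 <= 1 - t by rewrite subr_ge0.
apply: le_trans (ler_wpM2l (exprn_ge0 n s0) H) _.
rewrite -exprMn; apply: exprn_ile1; first by rewrite mulr_ge0// addr_ge0.
by rewrite (_ : _ * _ = 1 - t ^+ 2) ?gerBl ?sqr_ge0//; ring.
Qed.

Lemma geometric_linear r n : 0 <= r < 1 -> n%:R * r ^+ n <= (1 - r)^-1.
Proof.
move=> /andP[r0 r1]; have s0 : 0 < 1 - r by rewrite subr_gt0.
have := @bernoulli_inv (1 - r) n; rewrite subKr (ltW s0) gerBl r0 => /(_ isT) H.
rewrite -[leRHS]mul1r ler_pdivlMr//; apply: le_trans H.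
rewrite -subr_ge0 (_ : _ - _ = r ^+ n) ?exprn_ge0//; set p := r ^+ n; ring.
Qed.

(** A power (1 - a)^N behaves like exp (- a N), here with a N = n (2 q)^(2 n). This tends to 0 for q
    < 1/2 and, thanks to the factor n, to infinity at 1/2 as well as above. Bernoulli's inequality
    and its inverse form make the comparison elementary. *)
Definition threshold n q := (1 - q ^+ (2 * n)) ^+ (n * 4 ^ n).

Lemma threshold_ge0 n q : 0 <= q <= 1 -> 0 <= threshold n q <= 1.
Proof.
move=> /andP[q0 q1]; have t0 : 0 <= q ^+ (2 * n) by exact: exprn_ge0.
have t1 : q ^+ (2 * n) <= 1 by exact: exprn_ile1.
by rewrite /threshold exprn_ge0 ?subr_ge0// exprn_ile1 ?subr_ge0// gerBl.
Qed.

(** The split into two powers serves both regimes: below 1/2, [geometric_linear] bounds n times the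
    first while the second tends to 0; from 1/2 on, both powers are at least 1. *)
Lemma threshold_exponent n q :
  (n * 4 ^ n)%:R * q ^+ (2 * n) = n%:R * (2 * q) ^+ n * (2 * q) ^+ n.
Proof.
rewrite natrM natrX -mulrA -mulrA; congr (_ * _).
by rewrite -exprMn exprM -exprMn; congr (_ ^+ _); ring.
Qed.

Lemma threshold_cvg q : 0 <= q <= 1 -> (fun n => threshold n q) @ \oo --> ((q < 2^-1)%R%:R : R).
Proof.
move=> q01; have [q0 q1] := andP q01.
have t01 n : 0 <= q ^+ (2 * n) <= 1 by rewrite exprn_ge0 ?exprn_ile1.
have [q2|q2] := ltP q 2^-1.
  have r01 : 0 <= 2 * q < 1 by apply/andP; split; lra.
  have [r0 r1] := andP r01.
  apply: (@squeeze_cvgr _ _ _ _ (fun n => 1 - (1 - 2 * q)^-1 * (2 * q) ^+ n) (cst 1)).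
  - apply: nearW => n; have /andP[_ ->] := threshold_ge0 n q01; rewrite andbT.
    have /andP[_ t1] := t01 n.
    apply: le_trans (bernoulli _ t1); rewrite threshold_exponent lerD2l lerN2.
    by apply: ler_wpM2r; rewrite ?exprn_ge0// geometric_linear.
  - rewrite (_ : true%:R = 1 - (1 - 2 * q)^-1 * 0); last by rewrite mulr0 subr0.
    apply: cvgB; first exact: cvg_cst.
    by apply: cvgMr; apply: cvg_expr; rewrite ger0_norm.
  - exact: cvg_cst.
apply: (@squeeze_cvgr _ _ _ _ (cst 0) (@harmonic R)).
- apply: nearW => n; have /andP[-> _] := threshold_ge0 n q01 => /=.
  have /(bernoulli_inv (n * 4 ^ n)) := t01 n.
  rewrite threshold_exponent -/(threshold n q) => H.
  rewrite -[_^-1]mul1r ler_pdivlMr//; apply: le_trans H.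
  apply: ler_wpM2l; first by have /andP[] := threshold_ge0 n q01.
  have r1 : 1 <= (2 * q) ^+ n by apply: exprn_ege1; lra.
  rewrite -natr1 addrC lerD2l -mulrA ler_peMr// -[leLHS]mulr1.
  by apply: ler_pM.
- exact: cvg_cst.
- exact: cvg_harmonic.
Qed.

End Threshold.

(** * Trigonometric polynomials and limits of multipliers *)

Section TrigonometricDensity.
Context (R : realType) (L : 'I_3 -> R) (L_gt0 : forall i, 0 < L i).
Implicit Types (k : pt R) (th c : R) (i : 'I_3) (f m : pt R -> R).

Definition wave i k th : pt R -> R := component (mode (evec R i) k th) i.

(** The span of the scalar waves occurring in the i-th component of the modes. The parity of each
    factor depends on the component, hence the index. *)
Inductive trig i : (pt R -> R) -> Prop :=
| trig0 : trig i (cst 0)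
| trigD f g of trig i f & trig i g : trig i (f \+ g)
| trigZ c f of trig i f : trig i (fun x => c * f x)
| trig_wave k th of frequency L k : trig i (wave i k th).

Lemma wave0E k th x : wave 0 k th x =
  sin (k.1.1 * x.1.1) * cos (k.1.2 * x.1.2) * cos (k.2 * x.2 - th).
Proof. by rewrite /wave /component mxE/= mul1r. Qed.

Lemma wave1E k th x : wave 1 k th x =
  cos (k.1.1 * x.1.1) * sin (k.1.2 * x.1.2) * cos (k.2 * x.2 - th).
Proof. by rewrite /wave /component mxE/= mul1r. Qed.

Lemma wave2E k th x : wave 2 k th x =
  cos (k.1.1 * x.1.1) * cos (k.1.2 * x.1.2) * sin (k.2 * x.2 - th).
Proof. by rewrite /wave /component mxE/= mul1r. Qed.

Lemma mode_evec i k th : mode (evec R i) k th = fun x => wave i k th x *: delta_mx 0 i.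
Proof.
apply: vfieldP => x; rewrite /wave /component.
by move: i; apply: forall_ord3; rewrite !mxE/= ?mul0r ?mulr0 ?mulr1.
Qed.

Lemma mode_sum_cat s s' : mode_sum (s ++ s') = mode_sum s + mode_sum s' :> vfield R.
Proof. by rewrite /mode_sum big_cat. Qed.

Lemma frequencies_cat s s' : frequencies L s -> frequencies L s' -> frequencies L (s ++ s').
Proof. by move=> fs fs'; elim: s fs => //= t s IH [ft /IH]. Qed.

Lemma trig_mode_sum i f : trig i f ->
  exists2 s, frequencies L s & mode_sum s = fun x => f x *: delta_mx 0 i.
Proof.
elim=> {f} [|f g _ [s fs E] _ [s' fs' E']|c f _ [s fs E]|k th fk].
- exists [::] => //; rewrite mode_sum_nil; apply/funext => x; rewrite scale0r//.
- exists (s ++ s'); first exact: frequencies_cat.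
  rewrite mode_sum_cat E E'.
  by apply/funext => x; rewrite /= scalerDl.
- exists [seq (c * t.1.1.1, t.1.1.2, t.1.2, t.2) | t <- s].
    by elim: s fs {E} => //= t s IH [ft /IH].
  rewrite /mode_sum big_map; under eq_bigr do rewrite -scalerA.
  by rewrite -scaler_sumr -/(mode_sum s) E; apply/funext => x; rewrite -scalerA.
- exists [:: (1, evec R i, k, th)] => //.
  by rewrite /mode_sum big_seq1 scale1r mode_evec.
Qed.

Lemma trig_smooth i f : trig i f -> smooth_closure L f.
Proof.
elim=> {f} [|f g _ sf _ sg|c f _ sf|k th fk].
- exact: smooth_closure_cst.
- exact: smooth_closureD.
- exact: smooth_closureZ.
- exact: smooth_mode.
Qed.

Lemma trig_eq i f g : f =1 g -> trig i f -> trig i g.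
Proof. by move=> /funext ->. Qed.

Lemma trig_mulr i j m : (forall k th, frequency L k -> trig j (m \* wave i k th)) ->
  forall f, trig i f -> trig j (m \* f).
Proof.
move=> mw f; elim=> {f} [|f g _ tf _ tg|c f _ tf|//].
- by apply: trig_eq (trig0 j) => x /=; rewrite mulr0.
- by apply: trig_eq (trigD tf tg) => x /=; rewrite mulrDr.
- by apply: trig_eq (trigZ c tf) => x /=; rewrite mulrCA.
Qed.

(** As operators on the span, multipliers form an algebra by construction, and product-to-sum
    formulas are needed only for the cosines of lowest frequency. *)
Definition multiplier m := forall f, trig 2 f -> trig 2 (m \* f).

Lemma multiplier_cst c : multiplier (cst c).
Proof. by move=> f tf; exact: trigZ. Qed.

Lemma multiplierD m n : multiplier m -> multiplier n -> multiplier (m \+ n).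
Proof.
move=> Mm Mn f tf; apply: trig_eq (trigD (Mm _ tf) (Mn _ tf)) => x /=.
by rewrite mulrDl.
Qed.

Lemma multiplierM m n : multiplier m -> multiplier n -> multiplier (m \* n).
Proof.
by move=> Mm Mn f tf; apply: trig_eq (Mm _ (Mn _ tf)) => x /=; rewrite mulrA.
Qed.

Lemma multiplierX m j : multiplier m -> multiplier (fun x => m x ^+ j).
Proof.
move=> Mm; elim: j => [|j IH]; first exact: (multiplier_cst 1).
have := multiplierM Mm IH; congr multiplier; apply/funext => x /=; by rewrite exprS.
Qed.

Lemma frequency_evec j : frequency L ((pi / L j) *: evec R j).
Proof.
move=> i; exists ((i == j)%R : nat)%:Z.
have -> : xcoord ((pi / L j) *: evec R j) i = (pi / L j) * (i == j)%:R.
  by rewrite -[RHS]/((pi / L j) *: _); move: i j; apply: forall_ord3; apply: forall_ord3.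
by case: eqP => [->|_]; rewrite ?mulr1 ?mulr0 ?mul1r ?mul0r.
Qed.

Lemma frequency_shift k j : frequency L k ->
  frequency L (k + (pi / L j) *: evec R j) /\ frequency L (k - (pi / L j) *: evec R j).
Proof.
by move=> fk; split; apply: frequencyD => //; [|apply: frequencyN]; exact: frequency_evec.
Qed.

Let simplE := (addr0, subr0, mulr0, mulr1, oppr0, mulN1r).

Lemma multiplier_cos0 : multiplier (fun x => cos (pi / L 0 * x.1.1)).
Proof.
apply: trig_mulr => k th /(frequency_shift 0)[fp fm].
apply: trig_eq (trigZ 2^-1 (trigD (trig_wave 2 th fp) (trig_wave 2 th fm))) => x.
by rewrite /= !wave2E /= /GRing.scale/= !simplE mulrDl mulrBl cosD cosB; field.
Qed.

Lemma multiplier_cos1 : multiplier (fun x => cos (pi / L 1 * x.1.2)).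
Proof.
apply: trig_mulr => k th /(frequency_shift 1)[fp fm].
apply: trig_eq (trigZ 2^-1 (trigD (trig_wave 2 th fp) (trig_wave 2 th fm))) => x.
by rewrite /= !wave2E /= /GRing.scale/= !simplE mulrDl mulrBl cosD cosB; field.
Qed.

Lemma multiplier_cos2 t : multiplier (fun x => cos (pi / L 2 * (x.2 - t))).
Proof.
apply: trig_mulr => k th /(frequency_shift 2)[fp fm].
apply: trig_eq (trigZ 2^-1 (trigD (trig_wave 2 (th + pi / L 2 * t) fp)
  (trig_wave 2 (th - pi / L 2 * t) fm))) => x.
rewrite /= !wave2E /= /GRing.scale/= !simplE.
rewrite (_ : _ - (th + _) = (k.2 * x.2 - th) + pi / L 2 * (x.2 - t)); last by ring.
rewrite (_ : _ - (th - _) = (k.2 * x.2 - th) - pi / L 2 * (x.2 - t)); last by ring.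
by set a := k.2 * x.2 - th; set b := pi / L 2 * _; rewrite (sinD a b) (sinB a b); field.
Qed.

(** The product turns the cosine in x_1 into sines; the shift of the phase by pi / 2 turns the sine
    in x_3 into the cosine that [wave 0] requires. *)
Lemma trig_sin0 f : trig 2 f -> trig 0 (fun x => sin (pi / L 0 * x.1.1) * f x).
Proof.
apply: trig_mulr => k th /(frequency_shift 0)[fp fm].
apply: trig_eq (trigZ 2^-1 (trigD (trig_wave 0 (th + pi / 2) fp)
  (trigZ (-1) (trig_wave 0 (th + pi / 2) fm)))) => x.
by rewrite /= !wave2E !wave0E /= /GRing.scale/= !simplE mulrDl mulrBl sinD sinB opprD addrA cosBpihalf; field.
Qed.

Lemma trig_sin1 f : trig 2 f -> trig 1 (fun x => sin (pi / L 1 * x.1.2) * f x).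
Proof.
apply: trig_mulr => k th /(frequency_shift 1)[fp fm].
apply: trig_eq (trigZ 2^-1 (trigD (trig_wave 1 (th + pi / 2) fp)
  (trigZ (-1) (trig_wave 1 (th + pi / 2) fm)))) => x.
by rewrite /= !wave2E !wave1E /= /GRing.scale/= !simplE mulrDl mulrBl sinD sinB opprD addrA cosBpihalf; field.
Qed.

(** The unit is itself a wave, of frequency 0 and phase - pi / 2. *)
Lemma trig_multiplier m : multiplier m -> trig 2 m.
Proof.
have f0 : frequency L 0 by move=> i; exists 0; rewrite !mul0r /xcoord; do 2?case: ifP.
move=> Mm; apply: trig_eq (Mm _ (trig_wave 2 (- (pi / 2)) f0)) => x /=.
by rewrite wave2E /= !mul0r cos0 sub0r opprK sin_pihalf !mulr1.
Qed.

(** The uniform bound is kept with the pointwise limit: it passes to products and dominates the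
    convergence in square mean. *)
Definition multiplier_limit f := exists p : nat -> pt R -> R,
  [/\ forall n, multiplier (p n), forall n x, `|p n x| <= 1 &
      forall x, p ^~ x @ \oo --> f x].

Lemma multiplier_limitM f g :
  multiplier_limit f -> multiplier_limit g -> multiplier_limit (f \* g).
Proof.
move=> [p [Mp p1 pf]] [q [Mq q1 qg]]; exists (fun n => p n \* q n); split.
- by move=> n; exact: multiplierM.
- by move=> n x; rewrite normrM mulr_ile1.
- by move=> x; exact: cvgM.
Qed.

Lemma multiplier_limit1 : multiplier_limit (cst 1).
Proof.
exists (fun=> cst 1); split => [n|n x|x]; first exact: multiplier_cst.
  by rewrite /= normr1.
exact: cvg_cst.
Qed.

Lemma multiplier_limit_lt y (c : R) : multiplier y -> (forall x, `|y x| <= 1) -> `|c| <= 1 ->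
  multiplier_limit (fun x => (y x < c)%R%:R).
Proof.
(* As |y - c| <= 2, this affine change puts the values in [1/4, 3/4] and the threshold y = c at
   1/2. *)
move=> My y1 c1; pose q x := 2^-1 + 8^-1 * (y x - c).
have q01 x : 0 <= q x <= 1.
  by move: (y1 x) c1; rewrite /q !ler_norml => /andP[? ?] /andP[? ?]; apply/andP; split; lra.
exists (fun n x => threshold n (q x)); split.
- move=> n; apply: multiplierX.
  have := multiplierD (multiplier_cst 1) (multiplierM (multiplier_cst (-1)) (multiplierX (2 * n) _)).
  move=> /(_ q); rewrite /=.
  have -> : (cst 1 \+ (cst (-1) \* (fun x => q x ^+ (2 * n)))) = (fun x => 1 - q x ^+ (2 * n)).
    by apply/funext => x /=; rewrite mulN1r.
  apply; have := multiplierD (multiplier_cst 2^-1) (multiplierM (multiplier_cst 8^-1) (multiplierD My (multiplier_cst (- c)))).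
  by congr multiplier; apply/funext.
- by move=> n x; have /andP[? ?] := threshold_ge0 n (q01 x); rewrite ger0_norm.
- move=> x; have := threshold_cvg (q01 x).
  by rewrite (_ : (q x < 2^-1) = (y x < c))//; rewrite /q; apply/idP/idP; lra.
Qed.

(** The cosine decreases on [0, pi], so a half-line in x_i is a sublevel set of cos (pi x_i / L_i),
    once [a] has been clamped to [0, L_i]. *)
Lemma ray_lateral i a : multiplier (fun x => cos (pi / L i * xcoord x i)) ->
  (forall x, cell L x -> 0 < xcoord x i < L i) ->
  exists2 f, multiplier_limit f & forall x, cell L x -> f x = (a < xcoord x i)%R%:R.
Proof.
move=> Mc cL; pose b := Num.min (Num.max a 0) (L i).
have b0 : 0 <= b <= L i by rewrite /b le_min le_max lexx orbT ltW//= ge_min lexx orbT.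
exists (fun x => (cos (pi / L i * xcoord x i) < cos (pi / L i * b))%R%:R).
  by apply: multiplier_limit_lt => // [x|]; exact: cos_max.
move=> x /cL /andP[x0 xL].
have inpi t : 0 <= t <= L i -> pi / L i * t \in `[0, pi].
  move=> /andP[t0 tL]; rewrite in_itv/= mulr_ge0 ?divr_ge0 ?pi_ge0 ?(ltW (L_gt0 i))//=.
  by rewrite mulrAC ler_pdivrMr// ler_pM2l ?pi_gt0.
rewrite ltr_cos ?inpi ?(ltW x0) ?(ltW xL)// ltr_pM2l ?divr_gt0 ?pi_gt0//.
by rewrite /b gt_min gt_max x0 andbT (lt_gtF xL) orbF.
Qed.

(** In the periodic direction one cosine is not injective over the period. Up to the endpoints, the
    half-line becomes the arc complementary to [0, b], and this is where the cosine centred at b / 2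
    lies below its value at the ends of that arc. *)
Lemma ray2 a : exists2 f, multiplier_limit f &
  forall x, cell L x -> f x = (a < x.2)%R%:R.
Proof.
have [a0|a0] := ltP a 0.
  exists (cst 1) => [|x [_ /andP[x0 _]]]; first exact: multiplier_limit1.
  by rewrite (lt_le_trans a0 x0).
pose b := Num.min a (2 * L 2); have L2 := L_gt0 2.
have b0 : 0 <= b by rewrite le_min a0 mulr_ge0// ltW.
have bL : b <= 2 * L 2 by rewrite ge_min lexx orbT.
exists (fun x => (cos (pi / L 2 * (x.2 - b / 2)) < cos (pi / L 2 * (b / 2)))%R%:R).
  apply: multiplier_limit_lt => [|x|]; [exact: multiplier_cos2|exact: cos_max|exact: cos_max].
move=> x [_ /andP[x0 xL]].
have -> : (a < x.2) = (b < x.2) by rewrite /b gt_min (lt_gtF xL) orbF.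
congr (nat_of_bool _)%:R; pose r := pi / (2 * L 2).
have r0 : 0 < r by rewrite divr_gt0 ?pi_gt0// mulr_gt0.
have rL : r * (2 * L 2) = pi by rewrite /r divfK// gt_eqF// mulr_gt0.
rewrite -subr_gt0.
have -> : cos (pi / L 2 * (b / 2)) - cos (pi / L 2 * (x.2 - b / 2)) =
    2 * (sin (r * x.2) * sin (r * (x.2 - b))).
  have L20 : L 2 != 0 by rewrite gt_eqF.
  have -> : pi / L 2 * (b / 2) = r * x.2 - r * (x.2 - b) by rewrite /r; field.
  have -> : pi / L 2 * (x.2 - b / 2) = r * x.2 + r * (x.2 - b) by rewrite /r; field.
  by set u := r * x.2; set v := r * _; rewrite (cosB u v) (cosD u v); ring.
rewrite pmulr_rgt0//.
(* At x_3 = 0, an end of the excluded arc, both strict inequalities fail. *)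
move: x0; rewrite le_eqVlt => /predU1P[<-|x0].
  by rewrite mulr0 sin0 mul0r ltxx; apply/esym/negbTE; rewrite -leNgt.
rewrite pmulr_rgt0; last by rewrite sin_gt0_pi// mulr_gt0//= -rL ltr_pM2l.
have [bx|xb] := ltP b x.2.
  by rewrite sin_gt0_pi// mulr_gt0 ?subr_gt0//= -rL ltr_pM2l// ltrBlDr ltr_wpDr.
apply/negbTE; rewrite -leNgt -[x.2 - b]opprB mulrN sinN oppr_le0 sin_ge0_pi//.
rewrite mulr_ge0 ?subr_ge0 ?(ltW r0)//= -rL ler_pM2l// lerBlDr.
by rewrite (le_trans bL)// lerDl ltW.
Qed.

End TrigonometricDensity.

(** * Square-mean density for the third component *)

Section Density.
Context (R : realType) (L : 'I_3 -> R) (L_gt0 : forall i, 0 < L i).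
Implicit Types (f g : pt R -> R).
Local Notation coord i := (fun x : pt R => xcoord x i).
Local Notation approx i := (@approximable _ (mpt R) R (leb3 R) (cell L) (trig L i)).
Local Notation norm2 := (@sqnorm _ (mpt R) R (leb3 R) (cell L)).

Let mc : measurable (cell L : set (mpt R)) := @measurable_cell R L.

Lemma trig_measurable i f : trig L i f -> @measurable_fun _ _ (mpt R) R (cell L) f.
Proof. by move=> /(trig_smooth L_gt0)/(smooth_closure_L2 L_gt0)/L2_measurable. Qed.

Lemma multiplier_limit_approx f : multiplier_limit L f -> approx 2 f.
Proof.
move=> [p [Mp p1 pf]]; have Tp n := trig_multiplier (Mp n).
have mf : @measurable_fun _ _ (mpt R) R (cell L) f.
  by apply: (measurable_fun_cvg (h := p)) => [n|x _]; [exact: trig_measurable|exact: pf].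
apply: (approximable_cvg mc (@trig_measurable 2) (f_ := p) (h := cst 2)) => //.
- by move=> n; apply: approximable_self => //; exact: trig_measurable.
- move=> n x _; have fx1 : `|f x| <= 1.
    have cn : (fun j => `|p j x|) @ \oo --> `|f x| by exact: cvg_norm.
    rewrite -(cvg_lim (@Rhausdorff R) cn); apply: limr_le; last by apply: nearW => j; exact: p1.
    by apply/cvg_ex; exists `|f x|.
  by rewrite (le_trans (ler_normB _ _))//= (_ : 2 = 1 + 1)// lerD.
- exact: (integrable_cst_fin mc (leb3_cell_fin L_gt0) (2 ^+ 2)).
Qed.

Definition ray (B : set R) := B = setT \/ exists a, B = `]a, +oo[%classic.

Definition box (B0 B1 B2 : set R) : set (pt R) :=
  [set x | [/\ B0 x.1.1, B1 x.1.2 & B2 x.2]].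

Lemma ray_limit B i : ray B -> exists2 f, multiplier_limit L f &
  forall x, cell L x -> f x = (xcoord x i \in B)%:R.
Proof.
move=> [->|[a ->]].
  by exists (cst 1) => [|x _]; [exact: multiplier_limit1|rewrite in_setT].
have E t : (t \in `]a, +oo[%classic) = (a < t) by rewrite mem_setE in_itv/= andbT.
move: i; apply: forall_ord3.
- by have [|x []|f ? fE] := ray_lateral (i := 0) L_gt0 a; [exact: multiplier_cos0|case|exists f => // x /fE ->; rewrite E].
- by have [|x []|f ? fE] := ray_lateral (i := 1) L_gt0 a; [exact: multiplier_cos1|case|exists f => // x /fE ->; rewrite E].
- by have [f ? fE] := ray2 L_gt0 a; exists f => // x /fE ->; rewrite E.
Qed.

Lemma box_rays B0 B1 B2 : ray B0 -> ray B1 -> ray B2 -> approx 2 \1_(box B0 B1 B2).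
Proof.
move=> /(ray_limit 0)[f lf fE] /(ray_limit 1)[g lg gE] /(ray_limit 2)[h lh hE].
have := multiplier_limit_approx (multiplier_limitM (multiplier_limitM lf lg) lh).
apply: eq_approximable => x cx /=; rewrite fE// gE// hE// -!natrM indicE !mulnb.
congr ((nat_of_bool _)%:R).
apply/idP/idP => [/andP[/andP[/set_mem b0 /set_mem b1] /set_mem b2]|/set_mem[b0 b1 b2]].
  by apply/mem_set; split.
by rewrite (mem_set b0) (mem_set b1) (mem_set b2).
Qed.

Lemma setI_closed_ray : setI_closed (@RGenOInfty.G R).
Proof.
move=> _ _ [a ->] [b ->]; exists (Num.max a b); apply/seteqP; split=> x /=.
  by rewrite !in_itv/= !andbT gt_max => -[-> ->].
by rewrite !in_itv/= !andbT gt_max => /andP[-> ->].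
Qed.

Lemma dynkin_ray (pi : mpt R -> measurableTypeR R) (Z : set (mpt R)) :
  measurable_fun setT pi -> measurable Z -> approx 2 \1_Z ->
  (forall B, ray B -> approx 2 \1_(Z `&` pi @^-1` B)) ->
  forall B : set (measurableTypeR R), measurable B -> approx 2 \1_(Z `&` pi @^-1` B).
Proof.
move=> mpi mZ AZ AB.
apply: (approximable_preimage mc (@trig_measurable 2) (@trigD R L 2) (@trigZ R L 2)
  (leb3_cell_fin L_gt0) (trig0 L 2) (RGenOInfty.measurableE R) setI_closed_ray) => //.
by move=> _ [a ->]; apply: AB; right; exists a.
Qed.

Lemma measurable_coord i : @measurable_fun _ _ (mpt R) (measurableTypeR R) setT (coord i).
Proof. by apply: (continuous_measurable3 (f := coord i)); exact: continuous_xcoord. Qed.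

Lemma measurable_preimage_coord i (B : set (measurableTypeR R)) : measurable B ->
  measurable ((coord i) @^-1` B).
Proof. by move=> mB; rewrite -[_ @^-1` _]setTI; exact: measurable_coord. Qed.

Lemma measurable_ray B : ray B -> measurable (B : set (measurableTypeR R)).
Proof. by move=> [->|[a ->]]; [exact: measurableT|exact: measurable_itv]. Qed.

Lemma measurable_box (B0 B1 B2 : set (measurableTypeR R)) :
  measurable B0 -> measurable B1 -> measurable B2 -> measurable (box B0 B1 B2 : set (mpt R)).
Proof.
move=> m0 m1 m2.
rewrite (_ : box _ _ _ = ((coord 0) @^-1` B0 `&` (coord 1) @^-1` B1) `&`
   (coord 2) @^-1` B2).
  by apply: measurableI; [apply: measurableI|]; exact: measurable_preimage_coord.
by apply/seteqP; split=> x /=; rewrite /box/=; [case|case=> -[]].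
Qed.

(** Three Dynkin inductions, each freeing one side from rays to measurable sets while the other two
    sides stay fixed. *)
Lemma box_approx (B0 B1 B2 : set (measurableTypeR R)) :
  measurable B0 -> measurable B1 -> measurable B2 -> approx 2 \1_(box B0 B1 B2).
Proof.
have rT : ray setT by left.
have mT : measurable (setT : set (measurableTypeR R)) by exact: measurableT.
have s0 A0 A1 A2 : measurable (A0 : set (measurableTypeR R)) -> ray A1 -> ray A2 -> approx 2 \1_(box A0 A1 A2).
  move=> m0 r1 r2; have E B : box setT A1 A2 `&` (coord 0) @^-1` B = box B A1 A2.
    by apply/seteqP; split=> x /=; rewrite /box/xcoord/=; [case=> -[]|case].
  rewrite -E; apply: (dynkin_ray (measurable_coord 0)) => //.
  - by apply: measurable_box; rewrite //; exact: measurable_ray.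
  - exact: box_rays.
  - by move=> B rB; rewrite E; exact: box_rays.
have s1 A0 A1 A2 : measurable (A0 : set (measurableTypeR R)) -> measurable (A1 : set (measurableTypeR R)) ->
    ray A2 -> approx 2 \1_(box A0 A1 A2).
  move=> m0 m1 r2; have E B : box A0 setT A2 `&` (coord 1) @^-1` B = box A0 B A2.
    by apply/seteqP; split=> x /=; rewrite /box/xcoord/=; [case=> -[]|case].
  rewrite -E; apply: (dynkin_ray (measurable_coord 1)) => //.
  - by apply: measurable_box; rewrite //; exact: measurable_ray.
  - exact: s0.
  - by move=> B rB; rewrite E; exact: s0.
move=> m0 m1 m2; have E B : box B0 B1 setT `&` (coord 2) @^-1` B = box B0 B1 B.
  by apply/seteqP; split=> x /=; rewrite /box/xcoord/=; [case=> -[]|case].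
rewrite -E; apply: (dynkin_ray (measurable_coord 2)) => //.
- exact: measurable_box.
- exact: s1.
- by move=> B rB; rewrite E; exact: s1.
Qed.

Lemma setI_closed_rect d1 d2 (T1 : measurableType d1) (T2 : measurableType d2) :
  setI_closed [set A `*` B | A in @measurable _ T1 & B in @measurable _ T2].
Proof.
move=> _ _ [A1 mA1 [A2 mA2 <-]] [B1 mB1 [B2 mB2 <-]].
exists (A1 `&` B1); first exact: measurableI.
by exists (A2 `&` B2); [exact: measurableI|rewrite setXI].
Qed.

(** The product sigma-algebra is built in two stages, as a pair of a pair and a line; each stage
    takes one more Dynkin induction over rectangles. *)
Lemma indic_approx (S : set (mpt R)) : measurable S -> approx 2 \1_S.
Proof.
have dyn d' (T' : measurableType d') := @approximable_preimage _ (mpt R) R (leb3 R) (cell L) mc _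
  (@trig_measurable 2) (@trigD R L 2) (@trigZ R L 2) (leb3_cell_fin L_gt0) (trig0 L 2) d' T'.
have boxT B : box setT setT B = setT `*` B.
  by apply/seteqP; split=> x /=; rewrite /box/=; [case|case].
have cyl (A : set (mpt2 R)) (B : set (measurableTypeR R)) : measurable A -> measurable B ->
    approx 2 \1_(A `*` B).
  move=> mA mB; have E (A' : set (mpt2 R)) : (setT `*` B) `&` (fst : mpt R -> mpt2 R) @^-1` A' = A' `*` B.
    by apply/seteqP; split=> x /=; [case=> -[]|case].
  rewrite -E; apply: (dyn _ (mpt2 R) _ _ _ (measurable_prod_measurableType _ _) (@setI_closed_rect _ _ _ _)) => //.
  - exact: measurableX.
  - by rewrite -boxT; exact: box_approx.
  - move=> _ [A0 mA0 [A1 mA1 <-]]; rewrite E.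
    rewrite (_ : _ `*` _ = box A0 A1 B); first exact: box_approx.
    by apply/seteqP; split=> x /=; rewrite /box/=; [case=> -[]|case].
move=> mS; rewrite -[S]setTI -[S]/(id @^-1` S).
apply: (dyn _ (mpt R) _ _ _ (measurable_prod_measurableType _ _) (@setI_closed_rect _ _ _ _)) => //.
- by rewrite -setXTT; exact: cyl.
- by move=> _ [A mA [B mB <-]]; rewrite setTI; exact: cyl.
Qed.

Lemma trig2_dense f : @measurable_fun _ _ (mpt R) R (cell L) f ->
  (leb3 R).-integrable (cell L) (fun x => (f x ^+ 2)%:E) -> approx 2 f.
Proof.
apply: (approximable_L2 mc (@trig_measurable 2) (@trigD R L 2) (@trigZ R L 2) (trig0 L 2)).
exact: indic_approx.
Qed.

End Density.

(** * Density of the remaining components and of solenoidal sums *)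

Section SolenoidalDensity.
Context (R : realType) (L : 'I_3 -> R) (L_gt0 : forall i, 0 < L i).
Implicit Types (f g : pt R -> R).
Local Notation approx i := (@approximable _ (mpt R) R (leb3 R) (cell L) (trig L i)).
Local Notation norm2 := (@sqnorm _ (mpt R) R (leb3 R) (cell L)).

Let mc : measurable (cell L : set (mpt R)) := @measurable_cell R L.

(* Division by [s], regularized as [s / (s ^+ 2 + 1 / n)], reduces the
   approximation in the span of the [s * p] to that in the span of the [p]. *)
Lemma dense_mulr (s : pt R -> R) i : continuous s -> (forall x, cell L x -> 0 < s x <= 1) ->
  (forall p, trig L 2 p -> trig L i (fun x => s x * p x)) ->
  forall f, @measurable_fun _ _ (mpt R) R (cell L) f ->
  (leb3 R).-integrable (cell L) (fun x => (f x ^+ 2)%:E) -> approx i f.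
Proof.
move=> cs s01 ts f mf f2; split => // e e0; have e4 : 0 < e / 4 by rewrite divr_gt0.
pose w n x := s x / (s x ^+ 2 + n.+1%:R^-1).
have den n x : 0 < s x ^+ 2 + n.+1%:R^-1 :> R by rewrite ltr_wpDl ?sqr_ge0// invr_gt0.
have mS : @measurable_fun _ _ (mpt R) R (cell L) s.
  by apply: measurable_funTS; exact: continuous_measurable3.
have mw n : @measurable_fun _ _ (mpt R) R (cell L) (w n).
  apply: measurable_funTS; apply: continuous_measurable3 => x.
  apply: cvgM; first exact: cs.
  apply: cvgV; first by rewrite gt_eqF.
  by apply: cvgD; [rewrite expr2; under eq_fun do rewrite expr2; apply: cvgM; exact: cs|exact: cvg_cst].
have mfw n : @measurable_fun _ _ (mpt R) R (cell L) (fun x => f x * w n x).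
  exact: measurable_funM.
have fw2 n : (leb3 R).-integrable (cell L) (fun x => ((f x * w n x) ^+ 2)%:E).
  have := integrableZl mc (n.+1%:R ^+ 2) f2; apply: le_integrable => //.
    exact: (measurable_sqr (mfw n)).
  move=> x cx; have /andP[s0 s1] := s01 x cx.
  rewrite -EFinM /= lee_fin (ger0_norm (sqr_ge0 _)) ger0_norm; last by rewrite mulr_ge0 ?sqr_ge0.
  rewrite exprMn mulrC.
  apply: ler_wpM2r; first exact: sqr_ge0.
  have w0 : 0 <= w n x by rewrite divr_ge0 ?(ltW s0)// ltW.
  rewrite ler_sqr ?nnegrE// /w ler_pdivrMr//.
  by apply: (le_trans s1); rewrite mulrDr divff// lerDr mulr_ge0// sqr_ge0.
have [n Hn] : exists n, (norm2 (f \- (fun x => s x * (f x * w n x)))%R < (e / 4)%:E)%E.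
  apply: (sqnorm_cvg mc (h := fun x => `|f x|)) => //.
  - by move=> n; apply: measurable_funM.
  - move=> x cx; have /andP[s0 s1] := s01 x cx.
    rewrite -[X in _ --> X]mulr1.
    rewrite (_ : (fun n => _) = fun n => f x * (s x ^+ 2 / (s x ^+ 2 + n.+1%:R^-1))); last first.
      by apply/funext => n; rewrite /w; ring.
    have s2 : s x ^+ 2 != 0 by rewrite expf_neq0// gt_eqF.
    apply: cvgMr; rewrite [X in _ --> X](_ : 1 = s x ^+ 2 / (s x ^+ 2 + 0)); last by rewrite addr0 divff.
    apply: cvgMr; apply: cvgV; first by rewrite addr0.
    apply: cvgD; first exact: cvg_cst.
    exact: cvg_harmonic.
  - move=> n x cx; have /andP[s0 s1] := s01 x cx.
    rewrite (_ : f x - _ = f x * (n.+1%:R^-1 / (s x ^+ 2 + n.+1%:R^-1))).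
      rewrite normrM ler_piMr// ger0_norm ?divr_ge0 ?invr_ge0 ?(ltW (den _ _))//.
      by rewrite ler_pdivrMr// mul1r lerDr sqr_ge0.
    by rewrite /w; have := den n x; move: (n.+1%:R^-1) => r rx; field; rewrite gt_eqF.
  - by under eq_fun do rewrite real_normK ?num_real//.
have [_ /(_ _ e4)[p Tp Hp]] := trig2_dense L_gt0 (mfw n) (fw2 n).
exists (fun x => s x * p x); first exact: ts.
have -> : norm2 (f \- (fun x => s x * p x))%R = norm2 ((f \- (fun x => s x * (f x * w n x))) \+
    (fun x => s x * ((fun x => f x * w n x) \- p) x))%R.
  by apply: eq_sqnorm => x _ /=; ring.
have mp := trig_measurable L_gt0 Tp.
have mwp : @measurable_fun _ _ (mpt R) R (cell L) ((fun x => f x * w n x) \- p).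
  exact: measurable_funB.
have mswp : @measurable_fun _ _ (mpt R) R (cell L) (fun x => s x * ((fun x => f x * w n x) \- p) x).
  exact: measurable_funM.
apply: sqnormD_lt => //.
  by apply: measurable_funB => //; exact: measurable_funM.
apply: le_lt_trans Hp; apply: sqnorm_le => // x /s01 /andP[s0 s1].
by rewrite normrM ler_piMl// gtr0_norm.
Qed.

Lemma continuous_sin_coord i : continuous (fun x : pt R => sin (pi / L i * xcoord x i)).
Proof.
have := smooth_continuous (smooth_sin (pi / L i) 0 i).
by under eq_fun do rewrite subr0.
Qed.

Lemma sin_coord_cell i x : 0 < xcoord x i < L i -> 0 < sin (pi / L i * xcoord x i) <= 1.
Proof.
move=> /andP[x0 xL]; rewrite (le_trans (ler_norm _) (sin_max _)) andbT.
by rewrite sin_gt0_pi// mulr_gt0 ?divr_gt0 ?pi_gt0//= mulrAC ltr_pdivrMr// ltr_pM2l ?pi_gt0.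
Qed.

Lemma trig_dense i f : L2 L f -> approx i f.
Proof.
move=> Lf; have mf := L2_measurable Lf; have [_ _ f2] := Lf.
move: i; apply: forall_ord3; last exact: trig2_dense.
- apply: (dense_mulr (@continuous_sin_coord 0)) => //; last by move=> p; exact: trig_sin0.
  by move=> x [[x0 _] _]; exact: (@sin_coord_cell 0).
- apply: (dense_mulr (@continuous_sin_coord 1)) => //; last by move=> p; exact: trig_sin1.
  by move=> x [[_ x0] _]; exact: (@sin_coord_cell 1).
Qed.

Lemma mode_sum_dense u (e : R) : L2v L u -> 0 < e ->
  exists2 s, frequencies L s & dot L (u - mode_sum s) (u - mode_sum s) < e.
Proof.
move=> Lu e0; have e3 : 0 < e / 3 by rewrite divr_gt0.
have H i : exists2 s, frequencies L s & exists2 p, mode_sum s = (fun x => p x *: delta_mx 0 i) &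
    trig L i p /\ (norm2 (component u i \- p)%R < (e / 3)%:E)%E.
  have [_ /(_ _ e3)[p Tp up]] := trig_dense i (Lu i).
  by have [s fs E] := trig_mode_sum Tp; exists s => //; exists p.
have [s0 f0 [p0 E0 [T0 H0]]] := H 0; have [s1 f1 [p1 E1 [T1 H1]]] := H 1.
have [s2 f2 [p2 E2 [T2 H2]]] := H 2.
exists (s0 ++ s1 ++ s2); first by do 2?apply: frequencies_cat.
rewrite !mode_sum_cat E0 E1 E2; set v := u - _.
have small i p : trig L i p -> (norm2 (component u i \- p)%R < (e / 3)%:E)%E ->
  component v i = component u i \- p -> L2 L (component v i) /\ intO L (fun x => v x 0 i * v x 0 i) < e / 3.
  move=> Tp Hp E; split; first by rewrite E; exact: (L2B (Lu i) (smooth_closure_L2 L_gt0 (trig_smooth L_gt0 Tp))).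
  have -> : intO L (fun x => v x 0 i * v x 0 i) = fine (norm2 (component u i \- p)%R).
    by rewrite -E /sqnorm; under eq_integral do rewrite expr2.
  move: Hp; have : (0 <= norm2 (component u i \- p)%R)%E by apply: integral_ge0 => x _; rewrite lee_fin sqr_ge0.
  by case: (norm2 _) => // r _; rewrite lte_fin.
have v0 : component v 0 = component u 0 \- p0.
  by apply/funext => x; rewrite /component /v !fctE !mxE/= !mulr0 !addr0 mulr1.
have v1 : component v 1 = component u 1 \- p1.
  by apply/funext => x; rewrite /component /v !fctE !mxE/= !mulr0 add0r !addr0 mulr1.
have v2 : component v 2 = component u 2 \- p2.
  by apply/funext => x; rewrite /component /v !fctE !mxE/= !mulr0 !add0r mulr1.
have [L0 S0] := small 0 _ T0 H0 v0; have [L1 S1] := small 1 _ T1 H1 v1.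
have [L2' S2] := small 2 _ T2 H2 v2.
have Lv : L2v L v by apply: forall_ord3.
by rewrite dotE// sum_ord3; lra.
Qed.

Lemma dot_ge0 u : 0 <= dot L u u.
Proof.
rewrite /dot /intO /Rintegral fine_ge0// integral_ge0// => x _.
by rewrite lee_fin sumr_ge0// => i _; rewrite -expr2 sqr_ge0.
Qed.

(* The gradient part of a trigonometric approximation is orthogonal to H, so
   dropping it does not increase the error. *)
Lemma proj_sum_dense h (e : R) : spaceH L h -> 0 < e ->
  exists2 s, frequencies L s & normL2 L (h - proj_sum s) < e.
Proof.
move=> Hh e0; have [Lh _] := (spaceHP L_gt0 h).1 Hh.
have [s fs hs] := mode_sum_dense Lh (exprn_gt0 2 e0); exists s => //.
have [q sq E] := mode_sum_helmholtz L_gt0 fs.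
have Hg := stokes_smooth_spaceH L_gt0 (stokes_smooth_proj_sum L_gt0 fs).
set w := h - proj_sum s.
have Hw : spaceH L w by rewrite /w -scaleN1r; apply: spaceHD => //; exact: spaceHZ.
have [Lw orth] := (spaceHP L_gt0 w).1 Hw.
have Lq := L2v_grad L_gt0 sq; have LNq := L2vZ (-1) Lq.
have hE : h - mode_sum s = w + (-1) *: grad q by rewrite E opprD addrA scaleN1r.
have : dot L w w <= dot L (h - mode_sum s) (h - mode_sum s).
  rewrite hE dotDl//; last exact: L2vD.
  rewrite dotC dotDl// dotZl// dotC orth// mulr0 addr0.
  rewrite dotZl//; last exact: L2vD.
  rewrite dotC dotDl// orth// add0r dotZl// mulrA mulrNN !mul1r.
  by rewrite lerDl dot_ge0.
move=> /le_lt_trans /(_ hs); rewrite /normL2 => H.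
by rewrite -[ltRHS](gtr0_norm e0) -sqrtr_sqr ltr_sqrt// exprn_gt0.
Qed.

End SolenoidalDensity.

(** * The set C, its generators and the conclusion *)

Section SaturatingSet.
Context (R : realType) (L : 'I_3 -> R) (L_gt0 : forall i, 0 < L i).
Implicit Types (k : 'I_3 -> nat) (z : 'rV[R]_3).
Local Notation ka i := (pi / L i).

Definition rV_pt z : pt R := (z 0 0, z 0 1, z 0 2).

Definition wave_vector k : pt R := wn L (k 0) (k 1) (k 2).

Lemma wave_vector_smooth (z : pt R) k (th : R) : dot3 z (wave_vector k) = 0 ->
  stokes_smooth L (mode z (wave_vector k) th).
Proof. by apply: stokes_smooth_mode => //; exact: frequency_wn. Qed.

Lemma phaseE (n : nat) i (t : R) : n%:R * pi * t / L i = n%:R * ka i * t.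
Proof. by rewrite mulrAC mulrA. Qed.

Lemma Yfield_mode z k : Yfield L z k = mode (rV_pt z) (wave_vector k) 0.
Proof.
by apply: vfieldP => x; rewrite /Yfield /mode !row3E /Cf /Sf !phaseE subr0.
Qed.

Lemma Zfield_mode z k : Zfield L z k = mode (rV_pt z) (wave_vector k) (pi / 2).
Proof.
apply: vfieldP => x; rewrite /Zfield /mode !row3E /Cf /Sf !phaseE cosBpihalf sinBpihalf.
by split => //=; rewrite mulrN !mulNr.
Qed.

Lemma nzerosE k : nzeros k = ((k 0%R == 0) + (k 1%R == 0) + (k 2%R == 0))%N.
Proof.
rewrite /nzeros cardsE -sum1_card big_mkcond /= !big_ord_recl big_ord0 addn0 addnA.
have -> : lift ord0 ord0 = 1 :> 'I_3 by apply: val_inj.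
by have -> : lift ord0 (lift ord0 ord0) = 2 :> 'I_3 by apply: val_inj.
Qed.

Lemma perp_dot3 k z : perp L k z -> dot3 (rV_pt z) (wave_vector k) = 0.
Proof.
move=> [_ + _]; rewrite sum_ord3 => zk; rewrite -(mulr0 pi) -zk /dot3 /rV_pt /wave_vector/=; field.
by rewrite !gt_eqF.
Qed.

Lemma vertical_dot3 k (c : R) : k 2 = 0%N -> dot3 (rV_pt (row3 0 0 c)) (wave_vector k) = 0.
Proof. by move=> k2; rewrite /dot3 /rV_pt /wave_vector/= !row3E k2 !mul0r mulr0 !addr0. Qed.

Lemma jset1 k : 1%N \in jset k. Proof. by rewrite mem_undup inE. Qed.

Lemma jset_nzeros1 k j : nzeros k = 1%N -> j \in jset k -> j = 1%N.
Proof. by rewrite /jset => ->; rewrite mem_undup !inE orbb => /eqP. Qed.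

Lemma jset_le2 k j : j \in jset k -> (j <= 2)%N.
Proof. by rewrite mem_undup !inE => /orP[] /eqP ->; rewrite // leq_subr. Qed.

(** The nonzero factor absorbs the choice of the vectors w: on the lines from which the generators
    are taken, they are prescribed only up to scaling. *)
Definition generates (C : set (vfield R)) (z p : pt R) (th : R) :=
  exists2 c, c != 0 & C (mode (c *: z) p th).

Lemma saturation_bracket_closed C : bracket_closed L (generates C) (saturation L C).
Proof.
have sS := saturation_subspace L_gt0 C; split => //.
  move=> z p th [c c0 Cc]; have [_ _ SZ] := sS.
  rewrite -[mode z p th](scalerK c0) -modeZ; apply: SZ.
  by exists 0%N => //; exact: lin_span_sub.
move=> al ka th be kb et s [c c0 Cc] fa fb fs Gb E.
exact: (saturation_bracket L_gt0 c0 fa fb fs Cc Gb E).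
Qed.

Context (wY wZ : nat -> ('I_3 -> nat) -> 'rV[R]_3).
Hypotheses (hwY : Y_vectors L wY) (hwZ : Z_vectors L wZ).
Local Notation C := (saturating_set L wY wZ).

Lemma Zfield_smooth k j : (nzeros k <= 1)%N -> j \in jset k ->
  stokes_smooth L (Zfield L (wZ j k) k).
Proof.
move=> k1 jk; rewrite Zfield_mode; apply: wave_vector_smooth.
have [k2|k2] := eqVneq (k 2) 0%N; last first.
  by have [Pk _ _] := hwZ.1 k k1 k2; exact/perp_dot3/Pk.
(* With k_3 = 0 there is exactly one zero component, hence j = 1, the one index for which
   [Z_vectors] then prescribes the vector. *)
have n1 : nzeros k = 1%N by apply/eqP; rewrite eqn_leq k1/= nzerosE k2 addn1.
have [c _ E] := hwZ.2 k k2 (or_introl n1).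
by rewrite (jset_nzeros1 n1 jk) E vertical_dot3.
Qed.

Lemma saturating_set_smooth : C `<=` stokes_smooth L.
Proof.
move=> u [[[|]|]|]; last move=> ->.
- move=> [[j k] /= [k1 _ jk] <-]; have [Pk _ _] := hwY k1; rewrite Yfield_mode.
  exact/wave_vector_smooth/perp_dot3/Pk.
- by move=> [[j k] /= [k1 _ jk] <-]; exact: Zfield_smooth.
- move=> [k /= [k2 k3 _] <-]; have [c _ ->] := hwZ.2 k k3 (or_intror k2).
  by rewrite Zfield_mode; exact/wave_vector_smooth/vertical_dot3.
- by rewrite Zfield_mode; exact/wave_vector_smooth/vertical_dot3.
Qed.

Lemma finite_bounded_index : finite_set
  [set p : nat * ('I_3 -> nat) | (p.1 <= 2)%N /\ forall i, (p.2 i <= 4)%N].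
Proof.
pose f (q : 'I_3 * {ffun 'I_3 -> 'I_5}) : nat * ('I_3 -> nat) := (val q.1, fun i => val (q.2 i)).
apply: (@sub_finite_set _ _ (f @` setT)); last exact: finite_image.
move=> [j k] /= [j2 k4]; exists (inord j, [ffun i => inord (k i)]) => //.
rewrite /f/= inordK//; congr pair; apply/funext => i.
by rewrite ffunE inordK// ltnS.
Qed.

Lemma finite_saturating_set : finite_set C.
Proof.
have fb := finite_bounded_index.
rewrite /saturating_set !finite_setU; do ![split]; last exact: finite_set1.
- apply: finite_image; apply: (@sub_finite_set _ _ _ _ fb) => -[j k] /= [_ k4 jk].
  by split => //; exact: jset_le2 jk.
- apply: finite_image; apply: (@sub_finite_set _ _ _ _ fb) => -[j k] /= [_ k4 jk].
  by split => //; exact: jset_le2 jk.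
- apply: (@sub_finite_set _ _ ((fun p => Zfield L (wZ 1%N p.2) p.2) @`
    [set p : nat * ('I_3 -> nat) | (p.1 <= 2)%N /\ forall i, (p.2 i <= 4)%N])).
    by move=> _ [k [_ _ k4] <-]; exists (0%N, k).
  exact: finite_image.
Qed.

Definition index3 (m n l : nat) (i : 'I_3) : nat :=
  if i == 0 then m else if i == 1 then n else l.

Lemma index3_le m n l b : (m <= b)%N -> (n <= b)%N -> (l <= b)%N ->
  forall i, (index3 m n l i <= b)%N.
Proof. by move=> ? ? ?; apply: forall_ord3. Qed.

Lemma saturating_set_shear m n : (m <= 2)%N -> (n <= 2)%N ->
  generates C (0, 0, -1) (wn L m n 0) (pi / 2).
Proof.
move=> m2 n2; pose k := index3 m n 0.
have k4 : forall i, (k i <= 4)%N by apply: index3_le; rewrite ?(leq_trans m2) ?(leq_trans n2).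
have E z : mode (rV_pt z) (wn L m n 0) (pi / 2) = Zfield L z k by rewrite Zfield_mode.
have rV (c : R) : (- c) *: ((0, 0, -1) : pt R) = rV_pt (row3 0 0 c).
  by rewrite /rV_pt !row3E; apply: pt_eq; rewrite /= /GRing.scale/= ?mulr0// mulrNN mulr1.
(* Three of the four families of C occur: the constant field for m = n = 0, and otherwise Z fields
   with one or with two zero components. *)
have [k0|k0] := boolP ((m == 0%N) && (n == 0%N)).
  exists 1; first exact: oner_neq0.
  have := rV (-1); rewrite opprK => ->; rewrite E; right; congr Zfield.
  by case/andP: k0 => /eqP m0 /eqP n0; apply/funext; apply: forall_ord3; rewrite /k /index3/= ?m0 ?n0.
have nz : nzeros k = 1%N \/ nzeros k = 2%N.
  by rewrite nzerosE /k /index3/=; move: k0; do 2?case: eqP => /=; auto.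
have [c c0 Ec] := hwZ.2 k erefl nz.
exists (- c); first by rewrite oppr_eq0.
rewrite rV -Ec E; left; case: nz => nz.
  by left; right; exists (1%N, k) => //; split; rewrite ?nz//; exact: jset1.
by right; exists k.
Qed.

(** The component z_2 vanishes with k_2, and orthogonality to the frequency then leaves a single
    line. *)
Lemma perp_plane0 l z : perp L (index3 1 0 l) z ->
  exists2 c, c != 0 & c *: (l%:R * ka 2, 0, - ka 0) = rV_pt z.
Proof.
move=> [z0]; rewrite sum_ord3 /index3/= => zk /(_ 1 erefl) z1.
have ka0 : ka 0 != 0 by rewrite gt_eqF// divr_gt0// pi_gt0.
have L0 i : L i != 0 by rewrite gt_eqF.
have pi0 : pi != 0 :> R by rewrite gt_eqF// pi_gt0.
have Ez : z 0 0 = - (z 0 2 * l%:R / L 2) * L 0.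
  apply: (mulIf (invr_neq0 (L0 0))); rewrite mulfK//; apply/eqP; rewrite -addr_eq0 -zk z1.
  by apply/eqP; field; rewrite ?L0.
exists (- (z 0 2 / ka 0)).
  rewrite oppr_eq0 mulf_neq0 ?invr_eq0//; apply: contraNneq z0 => z2.
  apply/eqP/rowP => j; rewrite mxE; move: j; apply: forall_ord3 => //.
  by rewrite Ez z2 !mul0r oppr0 mul0r.
apply: pt_eq; rewrite /= /GRing.scale/= ?mulr0//.
- by rewrite Ez; move: (pi : R) pi0 => p p0; field; rewrite ?L0 ?p0.
- by move: (pi : R) pi0 => p p0; field; rewrite ?L0 ?p0.
Qed.

Lemma saturating_set_plane0 l th : (0 < l <= 2)%N -> th = 0 \/ th = pi / 2 ->
  generates C (l%:R * ka 2, 0, - ka 0) (wn L 1 0 l) th.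
Proof.
move=> /andP[l0 l2]; pose k := index3 1 0 l.
have k4 : forall i, (k i <= 4)%N by apply: index3_le; rewrite ?(leq_trans l2).
have k2 : k 2 != 0%N by rewrite -lt0n.
have n1 : (nzeros k <= 1)%N by rewrite nzerosE /= (negbTE k2).
move=> [->|->].
  have [Pk _ _] := hwY n1; have [c c0 E] := perp_plane0 (Pk _ (jset1 k)).
  exists c => //; rewrite E -[wn _ _ _ _]/(wave_vector k) -Yfield_mode.
  by left; left; left; exists (1%N, k) => //; split; rewrite ?jset1.
have [Pk _ _] := hwZ.1 k n1 k2; have [c c0 E] := perp_plane0 (Pk _ (jset1 k)).
exists c => //; rewrite E -[wn _ _ _ _]/(wave_vector k) -Zfield_mode.
by left; left; right; exists (1%N, k) => //; split; rewrite ?jset1.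
Qed.

Lemma perp_plane1 l z : perp L (index3 0 1 l) z ->
  exists2 c, c != 0 & c *: (0, l%:R * ka 2, - ka 1) = rV_pt z.
Proof.
move=> [z0]; rewrite sum_ord3 /index3/= => zk /(_ 0 erefl) z1.
have ka0 : ka 1 != 0 by rewrite gt_eqF// divr_gt0// pi_gt0.
have L0 i : L i != 0 by rewrite gt_eqF.
have pi0 : pi != 0 :> R by rewrite gt_eqF// pi_gt0.
have Ez : z 0 1 = - (z 0 2 * l%:R / L 2) * L 1.
  apply: (mulIf (invr_neq0 (L0 1))); rewrite mulfK//; apply/eqP; rewrite -addr_eq0 -zk z1.
  by apply/eqP; field; rewrite ?L0.
exists (- (z 0 2 / ka 1)).
  rewrite oppr_eq0 mulf_neq0 ?invr_eq0//; apply: contraNneq z0 => z2.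
  apply/eqP/rowP => j; rewrite mxE; move: j; apply: forall_ord3 => //.
  by rewrite Ez z2 !mul0r oppr0 mul0r.
apply: pt_eq; rewrite /= /GRing.scale/= ?mulr0//.
- by rewrite Ez; move: (pi : R) pi0 => p p0; field; rewrite ?L0 ?p0.
- by move: (pi : R) pi0 => p p0; field; rewrite ?L0 ?p0.
Qed.

Lemma saturating_set_plane1 l th : (0 < l <= 2)%N -> th = 0 \/ th = pi / 2 ->
  generates C (0, l%:R * ka 2, - ka 1) (wn L 0 1 l) th.
Proof.
move=> /andP[l0 l2]; pose k := index3 0 1 l.
have k4 : forall i, (k i <= 4)%N by apply: index3_le; rewrite ?(leq_trans l2).
have k2 : k 2 != 0%N by rewrite -lt0n.
have n1 : (nzeros k <= 1)%N by rewrite nzerosE /= (negbTE k2).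
move=> [->|->].
  have [Pk _ _] := hwY n1; have [c c0 E] := perp_plane1 (Pk _ (jset1 k)).
  exists c => //; rewrite E -[wn _ _ _ _]/(wave_vector k) -Yfield_mode.
  by left; left; left; exists (1%N, k) => //; split; rewrite ?jset1.
have [Pk _ _] := hwZ.1 k n1 k2; have [c c0 E] := perp_plane1 (Pk _ (jset1 k)).
exists c => //; rewrite E -[wn _ _ _ _]/(wave_vector k) -Zfield_mode.
by left; left; right; exists (1%N, k) => //; split; rewrite ?jset1.
Qed.

Lemma proj_sum_saturation s : frequencies L s -> saturation L C (proj_sum s).
Proof.
have [S0 SD SZ] := saturation_subspace L_gt0 C.
rewrite /proj_sum; elim: s => [_|t s IH [ft /IH Gs]]; first by rewrite big_nil.
rewrite big_cons; apply: SD => //; apply: SZ.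
apply: (G_mode L_gt0 (saturation_bracket_closed C)) => //; last exact: dot3_proj.
- exact: saturating_set_shear.
- exact: saturating_set_plane0.
- exact: saturating_set_plane1.
Qed.

Lemma GL_spaceH j : GL L (domA L) C j `<=` spaceH L.
Proof.
elim: j => [|j IH] /=; last first.
  by move=> _ [e [s [/IH He _ [_ Hs _] ->]]]; exact: spaceHD.
apply: lin_span_min; last by move=> u /saturating_set_smooth; exact: stokes_smooth_spaceH.
by split; [exact: spaceH0|exact: spaceHD|exact: spaceHZ].
Qed.

End SaturatingSet.

Theorem theorem3p2 (R : realType) (L : 'I_3 -> R)
    (L_gt0 : forall i, 0 < L i)
    (wY wZ : nat -> ('I_3 -> nat) -> 'rV[R]_3)
    (hwY : Y_vectors L wY) (hwZ : Z_vectors L wZ) :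
  L_saturating L (domA L) (saturating_set L wY wZ).
Proof.
split; first exact: finite_saturating_set.
  by move=> u /(saturating_set_smooth L_gt0 hwY hwZ); exact: stokes_smooth_domA.
split; first by move=> u [j _]; exact: (GL_spaceH L_gt0 hwY hwZ).
move=> h Hh e e0; have [s fs hs] := proj_sum_dense L_gt0 Hh e0.
exists (proj_sum s) => //.
have [j _ Gj] := proj_sum_saturation L_gt0 hwY hwZ fs.
exists j => //; apply: GL_mono Gj => u; exact: stokes_smooth_domA.
Qed.
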